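(* Let $X=M+A$ be a stochastic process of class $\Sigma(H)$ and of class $(D)$ such that $X_{\overline g}=A_{\overline g}=0$, and let $$\lambda(x)=\mathbb E'[X_\infty\mid A_\infty=x],$$ where $\mathbb E'$ is the expectation with respect to $\mathbb P'$. Assume that $\lambda(A_\infty)\neq 0$. Then, with $b=\inf\{u:\mathbb P'(A_\infty\ge u)=0\}$, $$\mathbb P'(A_\infty>x)=\exp\left(-\int_0^x\frac{dz}{\lambda(z)}\right),\qquad x<b.$$
   Context: Setting. $(\Omega,\mathcal F_\infty,\mathbb Q)$ is a measure space with $\mathbb Q$ a bounded signed measure, and $\mathbb P$ is a probability measure on $\mathcal F_\infty$ with $\mathbb Q\ll\mathbb P$. $(\mathcal F_t)_{t\ge 0}$ is a right-continuous filtration completed with respect to $\mathbb P$ with $\mathcal F_\infty=\bigvee_t\mathcal F_t$. $D_t=\frac{d\mathbb Q}{d\mathbb P}\big|_{\mathcal F_t}$ (a uniformly integrable $\mathbb P$-martingale, with terminal value $D_\infty$). Standing assumptions: $D$ is continuous and $\mathbb P(D_\infty=0)=0$. Put $H=\{t: D_t=0\}$, $g=\sup H$, $\overline g=0\vee g$ (so $\overline g=0$ if $H=\emptyset$; $\overline g<\infty$ a.s.). $\mathbb P'=\frac{|D_\infty|}{\mathbb E(|D_\infty|)}\mathbb P$. An $(\mathcal F_t)$-adapted process $Y$ is a $(\mathbb Q,\mathbb P)$-martingale (resp. local martingale) if $Y$ is a $\mathbb P$-semimartingale and $YD$ is a $\mathbb P$-martingale (resp. $\mathbb P$-local martingale).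 Class $\Sigma(H)$: a nonnegative $\mathbb P$-semimartingale $X_t=M_t+A_t$ is of class $\Sigma(H)$ if (1) $M$ is a càdlàg $(\mathbb Q,\mathbb P)$-local martingale with $M_0=0$; (2) $A$ is a continuous non-decreasing process with $A_0=0$; (3) the measure $(dA_t)$ is carried by $\{t: X_t=0\}\cup H$. A process $X$ is of class $(D)$ if $\{X_\tau:\tau\text{ a finite stopping time}\}$ is uniformly integrable. $X_\infty=\lim_{t\to\infty}X_t$ and $A_\infty=\lim_{t\to\infty}A_t$.
   Formalization: Class (D) is taken with respect to P' (uniform integrability of the X_τ under P'), as the claim fails if class (D) is read under P; the formula is stated for 0 ≤ x < b. *)

(* Defs.v *)
From HB Require Import structures.
From mathcomp Require Export all_boot all_order all_algebra.
From mathcomp Require Export all_classical all_reals all_analysis.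

Set Implicit Arguments.
Unset Strict Implicit.
Unset Printing Implicit Defensive.

Export Order.TTheory GRing.Theory Num.Theory.
Export numFieldNormedType.Exports.

#[global] Open Scope classical_set_scope.
#[global] Open Scope ring_scope.

(* Time is the half-line t >= 0 of R: a process is a map R -> T -> R of which
   only the values at times t >= 0 are ever used.  Properties of sample paths
   are required for P-almost every path. *)

Section paths.
Context {R : realType}.

Definition cadlag_path (y : R -> R) :=
  (forall t, 0 <= t -> y @ t^'+ --> y t) /\
  (forall t, 0 < t -> cvg (y @ t^'-)).

Definition continuous_path (y : R -> R) := {within `[0, +oo[, continuous y}.

Definition finite_variation_path (y : R -> R) :=
  forall t, 0 <= t -> bounded_variation 0 t y.

Definition nondecreasing_path (y : R -> R) :=
  forall s t, 0 <= s -> s <= t -> y s <= y t.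

(* The measure dy on [0, +oo[ does not charge N.  The path y is extended to R
   by the constant y 0 before time 0, so that dy charges no negative time. *)
Definition null_for_path_measure (y : R -> R) (N : set R) :=
  exists2 a : cumulative R R, (forall t, a t = y (Num.max 0 t)) &
    (lebesgue_stieltjes_measure a).-negligible N.

End paths.

Section stochastic_processes.
Context {d : measure_display} {T : measurableType d} {R : realType}.
Implicit Types (P : probability T R) (F : R -> set (set T)).
Implicit Types (X Y D M A : R -> T -> R) (tau : T -> \bar R).

Definition measurable_wrt (G : set (set T)) (f : T -> R) :=
  forall B : set R, measurable B -> G (f @^-1` B).

(* The sigma-algebra F_oo is the one of the ambient measurable space T.  The
   last two fields of this record are the usual conditions. *)
Record usual_filtration P F : Prop := UsualFiltration {
  filtration_sigma : forall t, 0 <= t -> sigma_algebra setT (F t) ;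
  filtration_sub : forall t, 0 <= t -> F t `<=` d.-measurable ;
  filtration_nondecreasing : forall s t, 0 <= s -> s <= t -> F s `<=` F t ;
  filtration_generates :
    d.-measurable = <<s \bigcup_(t in [set t : R | 0 <= t]) F t >> ;
  filtration_right_continuous : forall t, 0 <= t ->
    \bigcap_(s in [set s : R | t < s]) F s `<=` F t ;
  filtration_complete : forall N, P.-negligible N -> F 0 N }.

Definition adapted F Y := forall t, 0 <= t -> measurable_wrt (F t) (Y t).

Definition stopping_time F tau :=
  (forall w, 0 <= tau w)%E /\
  (forall t, 0 <= t -> F t [set w | (tau w <= t%:E)%E]).

(* Y_tau, meaningful where tau is finite *)
Definition value_at Y tau : T -> R := fun w => Y (fine (tau w)) w.

Definition stopped Y tau : R -> T -> R :=
  fun t => value_at Y (fun w => Order.min t%:E (tau w)).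

Definition martingale P F Y :=
  [/\ adapted F Y,
      forall t, 0 <= t -> P.-integrable setT (EFin \o Y t) &
      forall s t, 0 <= s -> s <= t -> forall B, F s B ->
        (\int[P]_(w in B) (Y t w)%:E = \int[P]_(w in B) (Y s w)%:E)%E].

Definition cadlag P Y := {ae P, forall w, cadlag_path (Y ^~ w)}.

(* Y_0 is only required to be F_0-measurable: the localized processes are
   Y^tau_n - Y_0. *)
Definition local_martingale P F Y :=
  [/\ adapted F Y, cadlag P Y &
      exists tau : nat -> T -> \bar R,
      [/\ forall n, stopping_time F (tau n),
          {ae P, forall w, forall n, (tau n w <= tau n.+1 w)%E},
          {ae P, forall w, tau n w @[n --> \oo] --> +oo%E} &
          forall n, martingale P F
            (fun t w => stopped Y (tau n) t w - Y 0 w)]].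

Definition semimartingale P F Y :=
  [/\ adapted F Y, cadlag P Y &
      exists N V : R -> T -> R,
      [/\ local_martingale P F N,
          adapted F V, cadlag P V,
          {ae P, forall w, finite_variation_path (V ^~ w)} &
          {ae P, forall w, [/\ N 0 w = 0, V 0 w = 0 &
            forall t, 0 <= t -> Y t w = Y 0 w + N t w + V t w]}]].

Definition uniformly_integrable P (C : set (T -> R)) :=
  forall e : R, 0 < e -> exists K : R, forall f, C f ->
    (\int[P]_(w in [set w | (K <= `|f w|)%R]) `|f w|%:E <= e%:E)%E.

(* The measure matters: class (D) is not preserved by an equivalent change of
   measure. *)
Definition class_D P F X :=
  uniformly_integrable P [set value_at X tau | tau in
    [set tau | stopping_time F tau /\ forall w, (tau w < +oo)%E]].

(* f = dQ/dP on the sub-sigma-algebra G *)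
Definition density_on (G : set (set T)) (Q : {charge set T -> \bar R}) P
    (f : T -> R) :=
  [/\ measurable_wrt G f, P.-integrable setT (EFin \o f) &
      forall B, G B -> (Q B = \int[P]_(w in B) (f w)%:E)%E].

Record signed_measure_setting P (Q : {charge set T -> \bar R}) F D
    (Dinf : T -> R) : Prop := SignedMeasureSetting {
  setting_filtration : usual_filtration P F ;
  setting_dominated : Q `<< P ;
  setting_density : forall t, 0 <= t -> density_on (F t) Q P (D t) ;
  setting_density_infty : density_on d.-measurable Q P Dinf ;
  setting_continuous : {ae P, forall w, continuous_path (D ^~ w)} ;
  setting_neq0 : P [set w | Dinf w = 0] = 0%E }.

Definition zeros D (w : T) : set R := [set t | 0 <= t /\ D t w = 0].

(* ereal_sup set0 = -oo, so that gbar = 0 when D has no zero *)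
Definition gbar D (w : T) : \bar R :=
  Order.max 0%E (ereal_sup (EFin @` zeros D w)).

(* P' has density |D_oo| / E(|D_oo|) with respect to P; this determines P' on
   all measurable sets. *)
Definition normalized_variation P (Dinf : T -> R) (P' : probability T R) :=
  forall B, measurable B ->
    (P' B = \int[P]_(w in B) (`|Dinf w| / fine 'E_P[fun v => `|Dinf v|])%:E)%E.

(* (Q, P)-local martingales; Q enters only through D *)
Definition QP_local_martingale P F D Y :=
  semimartingale P F Y /\ local_martingale P F (fun t w => Y t w * D t w).

Record class_SigmaH P F D X M A : Prop := ClassSigmaH {
  SigmaH_semimartingale : semimartingale P F X ;
  SigmaH_ge0 : {ae P, forall w, forall t, 0 <= t -> 0 <= X t w} ;
  SigmaH_decomposition :
    {ae P, forall w, forall t, 0 <= t -> X t w = M t w + A t w} ;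
  SigmaH_M_cadlag : cadlag P M ;
  SigmaH_M : QP_local_martingale P F D M ;
  SigmaH_M0 : {ae P, forall w, M 0 w = 0} ;
  SigmaH_A_continuous : {ae P, forall w, continuous_path (A ^~ w)} ;
  SigmaH_A_nondecreasing : {ae P, forall w, nondecreasing_path (A ^~ w)} ;
  SigmaH_A0 : {ae P, forall w, A 0 w = 0} ;
  SigmaH_carried : {ae P, forall w, null_for_path_measure (A ^~ w)
    (`[0, +oo[ `\` ([set t | X t w = 0] `|` zeros D w))} }.

Definition limit_infty Y : T -> R := fun w => lim (Y t w @[t --> +oo]).

(* lam is a version of x |-> E_P[U | V = x] *)
Definition conditional_expectation_given P (U V : T -> R) (lam : R -> R) :=
  [/\ measurable_fun setT lam,
      P.-integrable setT (EFin \o (lam \o V)) &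
      forall B : set R, measurable B ->
        (\int[P]_(w in V @^-1` B) (lam (V w))%:E =
         \int[P]_(w in V @^-1` B) (U w)%:E)%E].

End stochastic_processes.

(* Main.v *)
Require Import Defs.
From mathcomp Require Import measurable_realfun ring lra.

Set Implicit Arguments.
Unset Strict Implicit.
Unset Printing Implicit Defensive.

Local Notation E mu f := (Rintegral mu setT f).
Local Notation L1 mu f := (integrable mu setT (EFin \o f)).

(** For x >= 0 let K_t = X_t 1{A_t <= x} - min(A_t, x), a balayage of X.  Before
A exceeds x it is X - A = M, and MD is a local martingale; when A exceeds x it is
stopped at -x, without a jump away from the zeros of D, because A increases only
where X or D vanishes.  Restricted to the event G_r that D has no zero after r,
the measure P' has on F_t the density |D_t| 1{no zero on [r, t]} up to a constant
([killed_closed]): D keeps its sign there, and the zeros met before t contribute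
nothing to the mean of the terminal value.  Hence K is, from time r on, a
martingale for P' restricted to G_r ([balayage_martingale]): sample the localized
MD at the exit time of A above x or of D to 0, and remove the localization by
uniform integrability.

Since 1 + x + K >= 1, the process 1/(1 + x + K) is a bounded submartingale on
G_r.  The second order term of the tangent inequality of this convex function
gives a maximal inequality ([maximal_inequality]), and so K, then X and A,
converge at infinity on the union of the G_r.  This union has probability one: a
zero of D beyond every time would force D_oo = 0 ([ae_last_zero]).

The last zero g is not a stopping time, but it is reached from the right by grid
points: the event that a grid point is the first one after g is the trace on G_q
of an event of F_q.  As K vanishes at g, the martingale property at these grid
points gives E'[K_oo] = 0, that is
  E'[X_oo 1{A_oo <= x}] = E'[min(A_oo, x)]  ([terminal_identity]).

Write nu for the law of A_oo under P' and G(z) = nu(]z, +oo[).  Conditioning on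
A_oo turns the left-hand side into the integral of lambda over [0, x] for nu, and
the layer cake formula turns the right-hand side into the integral of G over
[0, x].  So lambda nu = G dz as measures ([law_density]).  Dividing by lambda,
  1 - G(x) = integral over [0, x] of G(z) / lambda(z) dz,
whose only solution is the exponential of the statement ([exponential_decay],
[law_formula]).

Path properties hold only almost surely; completeness of the filtration allows
the processes to be changed on a null set so that they hold everywhere. *)

(** * Integrable functions on a probability space *)

Lemma cvg_minr (I : Type) (G : set_system I) (FG : Filter G) (R : realType)
    (f g : I -> R) (a b : R) :
  f x @[x --> G] --> a -> g x @[x --> G] --> b ->
  Num.min (f x) (g x) @[x --> G] --> Num.min a b.
Proof.
move=> fa gb; rewrite minr_absE; under eq_fun do rewrite minr_absE.
by apply: cvgMl; apply: cvgB; [exact: cvgD|apply: cvg_norm; exact: cvgB].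
Qed.

Section expectation.
Context {d : measure_display} {T : measurableType d} {R : realType}.
Variable mu : probability T R.
Implicit Types f g h : T -> R.

Lemma L1_measurable f : L1 mu f -> measurable_fun setT f.
Proof. by move=> /measurable_int /measurable_EFinP. Qed.

Lemma L1_le f g : measurable_fun setT f -> (forall w, `|f w| <= g w) ->
  L1 mu g -> L1 mu f.
Proof.
move=> mf fg ig; apply: (le_integrable measurableT _ _ ig).
  exact/measurable_EFinP.
by move=> w _ /=; rewrite lee_fin (le_trans (fg w))// ler_norm.
Qed.

Lemma L1_cst (k : R) : L1 mu (fun=> k).
Proof. exact: finite_measure_integrable_cst. Qed.

Lemma L1_bounded f k : measurable_fun setT f -> (forall w, `|f w| <= k) ->
  L1 mu f.
Proof. by move=> mf fk; apply: (@L1_le _ (fun=> k)) => //; exact: L1_cst. Qed.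

Lemma L1D f g : L1 mu f -> L1 mu g -> L1 mu (fun w => f w + g w).
Proof. by move=> f1 g1; exact: (integrableD measurableT f1 g1). Qed.

Lemma L1B f g : L1 mu f -> L1 mu g -> L1 mu (fun w => f w - g w).
Proof. by move=> f1 g1; exact: (integrableB measurableT f1 g1). Qed.

Lemma L1N f : L1 mu f -> L1 mu (fun w => - f w).
Proof.
by move=> f1; rewrite (_ : EFin \o _ = -%E \o (EFin \o f))//; exact: integrableN.
Qed.

Lemma L1Z k f : L1 mu f -> L1 mu (fun w => k * f w).
Proof. by move=> f1; exact: (integrableZl measurableT k f1). Qed.

Lemma L1_norm f : L1 mu f -> L1 mu (fun w => `|f w|).
Proof. exact: integrable_norm. Qed.

Lemma L1M f g k : measurable_fun setT f -> (forall w, `|f w| <= k) ->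
  L1 mu g -> L1 mu (fun w => f w * g w).
Proof.
move=> mf fk g1; apply: (@L1_le _ (fun w => k * `|g w|)).
- by apply: measurable_funM => //; exact: L1_measurable.
- by move=> w; rewrite normrM ler_wpM2r.
- exact/L1Z/L1_norm.
Qed.

Lemma norm_indic (C : set T) w : `|\1_C w : R| <= 1.
Proof. by rewrite indicE normr_nat; case: (_ \in _). Qed.

Lemma L1_indic (C : set T) f : measurable C -> L1 mu f ->
  L1 mu (fun w => \1_C w * f w).
Proof.
move=> mC f1; apply: (@L1M _ _ 1) => // w; exact: norm_indic.
Qed.

Lemma L1_indicator (C : set T) : measurable C -> L1 mu (\1_C : T -> R).
Proof. by move=> mC; apply: (L1_bounded _ (norm_indic C)); exact: measurable_indic. Qed.

Lemma indic01 (C : set T) w : (0 : R) <= \1_C w <= (1 : R).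
Proof. by rewrite indicE ler0n lern1 leq_b1. Qed.

Lemma indic_mul_bounds (C : set T) w (y : R) : 0 <= y -> 0 <= \1_C w * y <= y.
Proof. by move=> y0; have /andP[c0 c1] := indic01 C w; rewrite mulr_ge0//= ler_piMl. Qed.

Lemma indic2_mul_bounds (B C : set T) w (y : R) : 0 <= y ->
  0 <= \1_B w * (\1_C w * y) <= y.
Proof.
move=> /(indic_mul_bounds C w)/andP[h0 h1].
by have /andP[-> /le_trans->] := indic_mul_bounds B w h0.
Qed.

Lemma measurable_minc f k : measurable_fun setT f ->
  measurable_fun setT (fun w => Num.min (f w) k).
Proof. by move=> mf; apply: measurable_minr => //; exact: measurable_cst. Qed.

Lemma norm_minc (y k : R) : 0 <= y -> `|Num.min y k| <= `|k|.
Proof.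
move=> y0; rewrite ler_norml ge_min ler_norm orbT andbT le_min.
apply/andP; split; first by rewrite (le_trans _ y0)// oppr_le0.
by have := ler_norm (- k); rewrite normrN; lra.
Qed.

Lemma L1_minc f k : measurable_fun setT f -> (forall w, 0 <= f w) ->
  L1 mu (fun w => Num.min (f w) k).
Proof.
move=> mf f0; apply: (@L1_bounded _ `|k|); first exact: measurable_minc.
by move=> w; exact: norm_minc.
Qed.

Lemma L1_excess f k : L1 mu f -> L1 mu (fun w => Num.max 0 (f w - k)).
Proof.
move=> f1; have fk : L1 mu (fun w => f w - k) by apply: L1B => //; exact: L1_cst.
apply: (L1_le _ _ (L1_norm fk)).
  by apply: measurable_maxr; [exact: measurable_cst|exact: L1_measurable].
by move=> w; rewrite ger0_norm ?le_max ?lexx// ge_max normr_ge0 ler_norm.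
Qed.

Lemma ExD f g : L1 mu f -> L1 mu g ->
  E mu (fun w => f w + g w) = E mu f + E mu g.
Proof. exact: RintegralD. Qed.

Lemma ExB f g : L1 mu f -> L1 mu g ->
  E mu (fun w => f w - g w) = E mu f - E mu g.
Proof. exact: RintegralB. Qed.

Lemma ExZ k f : L1 mu f -> E mu (fun w => k * f w) = k * E mu f.
Proof. exact: RintegralZl. Qed.

Lemma Ex_cst k : E mu (fun=> k) = k.
Proof. by rewrite Rintegral_cst// [X in fine X]probability_setT mulr1. Qed.

Lemma Ex_le f g : L1 mu f -> L1 mu g -> (forall w, f w <= g w) ->
  E mu f <= E mu g.
Proof. by move=> f1 g1 fg; apply: le_Rintegral. Qed.

Lemma Ex_norm f : L1 mu f -> `|E mu f| <= E mu (fun w => `|f w|).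
Proof. exact: le_normr_Rintegral. Qed.

Lemma Ex_ge0 f : (forall w, 0 <= f w) -> 0 <= E mu f.
Proof. by move=> f0; apply: Rintegral_ge0. Qed.

Lemma eq_Ex f g : (forall w, f w = g w) -> E mu f = E mu g.
Proof. by move=> fg; congr (E mu _); apply/funext. Qed.

Lemma Ex_ae f g : measurable_fun setT f -> measurable_fun setT g ->
  {ae mu, forall w, f w = g w} -> E mu f = E mu g.
Proof.
move=> mf mg fg; congr fine; apply: ae_eq_integral => //;
  try exact/measurable_EFinP.
by apply: filterS fg => w + _ => ->.
Qed.

Lemma L1_ae f g : measurable_fun setT g -> {ae mu, forall w, f w = g w} ->
  L1 mu f -> L1 mu g.
Proof.
move=> mg fg f1; have mf := L1_measurable f1.
move/integrableP : f1 => [_ fi]; apply/integrableP; split.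
  exact/measurable_EFinP.
rewrite (_ : (\int[mu]_x `|(EFin \o g) x| = \int[mu]_x `|(EFin \o f) x|)%E)//.
apply: ae_eq_integral => //.
- by apply: measurableT_comp => //; apply/measurable_EFinP.
- by apply: measurableT_comp => //; apply/measurable_EFinP.
- by apply: filterS fg => w + _ /= => ->.
Qed.

Lemma Ex_EFin f : L1 mu f -> (E mu f)%:E = (\int[mu]_w (f w)%:E)%E.
Proof. by move=> f1; rewrite fineK// integrable_fin_num. Qed.

Lemma Ex_indic (C : set T) f : measurable C ->
  E mu (fun w => \1_C w * f w) = fine (\int[mu]_(w in C) (f w)%:E)%E.
Proof.
move=> mC; rewrite integral_mkcond; congr fine; apply: eq_integral => w _.
by rewrite patchE indicE; case: ifPn => wC; rewrite ?mul1r ?mul0r.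
Qed.

Lemma Ex_indic_EFin (C : set T) f : measurable C -> L1 mu f ->
  (E mu (fun w => \1_C w * f w))%:E = (\int[mu]_(w in C) (f w)%:E)%E.
Proof.
move=> mC f1; rewrite Ex_indic// fineK//.
by apply: integrable_fin_num => //; apply: integrableS f1.
Qed.

Lemma Ex_prob (C : set T) : measurable C -> E mu \1_C = fine (mu C).
Proof.
by move=> mC; rewrite /Rintegral integral_indic// setIT.
Qed.

Lemma negligible_of_Ex (C : set T) : measurable C -> E mu \1_C <= 0 -> mu.-negligible C.
Proof.
move=> mC; rewrite Ex_prob// => h; exists C; split => //; apply/eqP.
by rewrite -fine_eq0 ?fin_num_measure// eq_le h fine_ge0.
Qed.

Lemma dct (f_ : nat -> T -> R) f g :
  (forall n, measurable_fun setT (f_ n)) -> measurable_fun setT f ->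
  {ae mu, forall w, f_ n w @[n --> \oo] --> f w} ->
  L1 mu g -> (forall n w, `|f_ n w| <= g w) ->
  L1 mu f /\ E mu (f_ n) @[n --> \oo] --> E mu f.
Proof.
move=> mf_ mf ff ig fg.
have [] := @dominated_convergence _ T R mu setT measurableT
  (fun n => EFin \o f_ n) (EFin \o f) (EFin \o g).
- by move=> n; exact/measurable_EFinP.
- exact/measurable_EFinP.
- by apply: filterS ff => w fw _; apply: cvg_EFin; [exact: nearW|exact: fw].
- exact: ig.
- by apply: aeW => w n _ /=; rewrite lee_fin.
move=> f1 _ fE; split => //.
apply: (fine_cvg (F := \oo)); move: fE.
by rewrite -Ex_EFin.
Qed.

Lemma Ex_limn_einf (g_ : nat -> T -> R) e :
  (forall n, L1 mu (g_ n)) -> (forall n w, 0 <= g_ n w) ->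
  (forall n, E mu (g_ n) <= e) ->
  (\int[mu]_w limn_einf (fun n => (g_ n w)%:E) <= e%:E)%E.
Proof.
move=> g1 g0 ge; apply: (le_trans (fatou _ _ _ _)) => //.
- by move=> n; exact: measurable_int (g1 n).
- by move=> n w _; rewrite lee_fin.
rewrite limn_einf_lim; apply: lime_le; first exact: is_cvg_einfs.
apply: nearW => n; apply: (@le_trans _ _ (\int[mu]_w (g_ n w)%:E)%E).
  by apply: ereal_inf_lbound; exists n => /=.
by rewrite -Ex_EFin// lee_fin.
Qed.

Lemma measurable_limn_einf (g_ : nat -> T -> R) : (forall n, L1 mu (g_ n)) ->
  measurable_fun setT (fun w => limn_einf (fun n => (g_ n w)%:E)).
Proof.
move=> g1; have mgn n : measurable_fun setT (EFin \o g_ n) by exact: measurable_int (g1 n).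
have me := measurable_fun_einfs mgn.
apply: (@emeasurable_fun_cvg _ _ _ _ (fun n w => einfs (fun k => (g_ k w)%:E) n)) => // w _.
by rewrite limn_einf_lim; exact: is_cvg_einfs.
Qed.

Lemma fatou_real (g_ : nat -> T -> R) g e :
  (forall n, L1 mu (g_ n)) -> measurable_fun setT g ->
  (forall n w, 0 <= g_ n w) -> {ae mu, forall w, g_ n w @[n --> \oo] --> g w} ->
  (forall w, 0 <= g w) -> (forall n, E mu (g_ n) <= e) ->
  L1 mu g /\ E mu g <= e.
Proof.
move=> g1 mg g0 gg gg0 ge.
have Ex_lim : (\int[mu]_w (g w)%:E <= e%:E)%E.
  apply: (@le_trans _ _ (\int[mu]_w limn_einf (fun n => (g_ n w)%:E))%E).
    rewrite le_eqVlt; apply/orP; left; apply/eqP; apply: ae_eq_integral => //.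
    - exact/measurable_EFinP.
    - exact: measurable_limn_einf.
    apply: filterS gg => w cw _; apply/esym.
    have cE : (g_ n w)%:E @[n --> \oo] --> (g w)%:E.
      by apply: cvg_EFin => //; exact: nearW.
    by rewrite is_cvg_limn_einfE; [exact/cvg_lim|apply/cvg_ex; exists (g w)%:E].
  exact: Ex_limn_einf.
have g1' : L1 mu g.
  apply/integrableP; split; first exact/measurable_EFinP.
  rewrite (eq_integral (fun w => (g w)%:E)) ?(le_lt_trans Ex_lim) ?ltry// => w _ /=.
  by rewrite ger0_norm.
by split => //; rewrite -lee_fin Ex_EFin.
Qed.

(** The lower limit has a finite integral by Fatou's lemma.  This is what keeps
the paths of X and of A from escaping to infinity. *)
Lemma ae_not_cvg_infty (g_ : nat -> T -> R) e :
  (forall n, L1 mu (g_ n)) -> (forall n w, 0 <= g_ n w) ->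
  (forall n, E mu (g_ n) <= e) ->
  {ae mu, forall w, ~ (g_ n w)%:E @[n --> \oo] --> +oo%E}.
Proof.
move=> g1 g0 ge; pose G w := limn_einf (fun n => (g_ n w)%:E).
have mG : measurable_fun setT G by exact: measurable_limn_einf.
have G0 w : (0 <= G w)%E.
  rewrite /G limn_einf_lim; apply: lime_ge; first exact: is_cvg_einfs.
  by apply: nearW => n; apply: le_ereal_inf_tmp => _ [m _ <-]; rewrite lee_fin.
have Ge : (\int[mu]_w G w <= e%:E)%E := Ex_limn_einf g1 g0 ge.
have iG : mu.-integrable setT G.
  apply/integrableP; split => //; apply: le_lt_trans (ltry e); apply: le_trans Ge.
  by under eq_integral do rewrite gee0_abs//.
apply: filterS (integrable_ae measurableT iG) => w /(_ I) finG cw.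
have GE : G w = +oo%E by rewrite /G is_cvg_limn_einfE; [exact/cvg_lim|apply/cvg_ex; exists +oo%E].
by rewrite GE in finG.
Qed.

(** Uniform integrability is expressed by the mean excess over a level, a form
that passes from [Y_] to the smaller [f_].  Below the level convergence is
bounded, and Fatou's lemma bounds the excess of the limit. *)
Lemma vitali_dominated (f_ Y_ : nat -> T -> R) f :
  (forall n w, 0 <= f_ n w) -> (forall n w, f_ n w <= Y_ n w) ->
  (forall n, measurable_fun setT (f_ n)) -> (forall n, L1 mu (Y_ n)) ->
  measurable_fun setT f -> (forall w, 0 <= f w) ->
  {ae mu, forall w, f_ n w @[n --> \oo] --> f w} ->
  (forall e, 0 < e -> exists k, forall n,
     E mu (fun w => Num.max 0 (Y_ n w - k)) <= e) ->
  L1 mu f /\ E mu (f_ n) @[n --> \oo] --> E mu f.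
Proof.
move=> f_0 fY mf_ Y1 mf f0 ff Yui.
have f_1 n : L1 mu (f_ n) by apply: (L1_le _ _ (Y1 n)) => // w; rewrite ger0_norm.
pose ex k (h : T -> R) w := Num.max 0 (h w - k).
have exE k (h : T -> R) w : ex k h w = h w - Num.min (h w) k.
  by rewrite /ex maxEle minEle; case: ifPn; case: ifPn; rewrite -?ltNge; lra.
have ex0 k h w : 0 <= ex k h w by rewrite le_max lexx.
have ui e : 0 < e -> exists k, forall n, E mu (ex k (f_ n)) <= e.
  move=> /Yui[k Hk]; exists k => n; apply: le_trans (Hk n).
  apply: Ex_le; [exact: L1_excess|exact: L1_excess|] => w.
  by rewrite ge_max le_max lexx/= le_max lerB ?fY ?orbT.
have cvmin k : {ae mu, forall w, Num.min (f_ n w) k @[n --> \oo] --> Num.min (f w) k}.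
  by apply: filterS ff => w fw; apply: cvg_minr => //; exact: cvg_cst.
have step k e : (forall n, E mu (ex k (f_ n)) <= e) ->
    L1 mu (ex k f) /\ E mu (ex k f) <= e.
  move=> He; apply: (@fatou_real (fun n => ex k (f_ n))) => //.
  - by move=> n; exact: L1_excess.
  - rewrite (_ : ex k f = fun w => f w - Num.min (f w) k).
      by apply: measurable_funB => //; exact: measurable_minc.
    by apply/funext => w; rewrite exE.
  - near=> w; rewrite exE; under eq_fun do rewrite exE.
    by apply: cvgB; near: w; [exact: ff|exact: cvmin].
have dctk k := @dct (fun n w => Num.min (f_ n w) k)
    (fun w => Num.min (f w) k) (fun=> `|k|)
    (fun n => measurable_minc k (mf_ n)) (measurable_minc k mf) (cvmin k)
    (L1_cst _) (fun n w => norm_minc k (f_0 n w)).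
have split_ h k : L1 mu h -> (forall w, 0 <= h w) ->
    E mu h = E mu (fun w => Num.min (h w) k) + E mu (ex k h).
  move=> h1 h0; rewrite -ExD; [|apply: L1_minc => //; exact: L1_measurable|exact: L1_excess].
  by apply: eq_Ex => w; rewrite exE; lra.
have f1 : L1 mu f.
  have [k /step[exk _]] := ui 1 ltr01.
  rewrite (_ : f = fun w => Num.min (f w) k + ex k f w).
    by apply: L1D => //; exact: L1_minc.
  by apply/funext => w; rewrite exE; lra.
split => //; apply/cvgrPdist_le => e e0.
have e3 : 0 < e / 3 by lra.
have [k He] := ui _ e3; have [exk lek] := step _ _ He.
have [_ /cvgrPdist_le/(_ _ e3) near_min] := dctk k.
near=> n; rewrite (split_ f k)// (split_ (f_ n) k)//.
have H1 : `|E mu (fun w => Num.min (f w) k) - E mu (fun w => Num.min (f_ n w) k)|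
    <= e / 3 by near: n.
have H2 : 0 <= E mu (ex k f) by exact: Ex_ge0.
have H3 : 0 <= E mu (ex k (f_ n)) by exact: Ex_ge0.
have H4 := He n.
move: H1; rewrite !ler_norml => /andP[H1 H1']; apply/andP; split; move: lek H4; lra.
Unshelve. all: by end_near. Qed.

End expectation.

(** * Sub-sigma-algebras and densities *)

Section sub_sigma_algebra.
Context {d : measure_display} {T : measurableType d} {R : realType}.
Variable G : set (set T).
Hypothesis Gs : sigma_algebra setT G.
Hypothesis Gm : G `<=` d.-measurable.

(** Makes the stability lemmas of [measurable_fun] available for a
sub-sigma-algebra. *)
Lemma measurable_wrtP (f : T -> R) : measurable_wrt G f <->
  measurable_fun (setT : set (g_sigma_algebraType G)) f.
Proof.
split.
  move=> Gf _ B mB; rewrite setTI; apply: sub_sigma_algebra; exact: Gf.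
move=> mf B mB; have := mf measurableT B mB; rewrite setTI.
by rewrite /measurable/= sigma_algebra_id.
Qed.

Lemma sub_measurable_fun (f : T -> R) : measurable_wrt G f -> measurable_fun setT f.
Proof. by move=> Gf _ B mB; rewrite setTI; apply: Gm; exact: Gf. Qed.

Lemma sigma_setT : G setT.
Proof.
rewrite -(sigma_algebra_id Gs); have := @measurableT _ (g_sigma_algebraType G).
by [].
Qed.

Lemma sigma_setC C : G C -> G (~` C).
Proof. by case: Gs => _ GC _ /GC; rewrite setTD. Qed.

Lemma sigma_bigcup (C : nat -> set T) : (forall n, G (C n)) -> G (\bigcup_n C n).
Proof. by case: Gs => _ _; apply. Qed.

Lemma sigma_setU A B : G A -> G B -> G (A `|` B).
Proof.
move=> GA GB; rewrite -bigcup2E; apply: sigma_bigcup => -[|[|n]] //=.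
by case: Gs.
Qed.

Lemma sigma_setI A B : G A -> G B -> G (A `&` B).
Proof. by move=> GA GB; rewrite -[_ `&` _]setCK setCI; apply/sigma_setC/sigma_setU; exact: sigma_setC. Qed.

End sub_sigma_algebra.

Section weighted_integrals.
Context {d : measure_display} {T : measurableType d} {R : realType}.
Variables (m1 m2 : {measure set T -> \bar R}) (D : set T) (f1 f2 : T -> R).
Variable G : set (set T).
Hypotheses (Gs : sigma_algebra setT G) (Gm : G `<=` d.-measurable).
Hypotheses (mD : measurable D) (mf1 : measurable_fun setT f1) (mf2 : measurable_fun setT f2).
Hypotheses (f10 : forall x, 0 <= f1 x) (f20 : forall x, 0 <= f2 x).
Hypothesis f12 : forall B, G B ->
  (\int[m1]_(x in D `&` B) (f1 x)%:E = \int[m2]_(x in D `&` B) (f2 x)%:E)%E.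

Import HBNNSimple.

Let level (h : {nnsfun g_sigma_algebraType G >-> R}) y : G (h @^-1` [set y]).
Proof. by apply: (measurable_wrtP Gs h).2 => //; exact: measurable_funPT. Qed.

Let mlevel (h : {nnsfun g_sigma_algebraType G >-> R}) y :
  measurable_fun setT (\1_(h @^-1` [set y]) : T -> R).
Proof. exact/measurable_indic/Gm/level. Qed.

(** The sum runs over the values of h, whose level sets are events of G. *)
Let simple_mul (m : {measure set T -> \bar R}) (f : T -> R) (h : {nnsfun g_sigma_algebraType G >-> R}) :
  measurable_fun setT f -> (forall x, 0 <= f x) ->
  (\int[m]_(x in D) ((h x)%:E * (f x)%:E) =
   \sum_(y \in range h) y%:E * \int[m]_(x in D `&` (h @^-1` [set y])) (f x)%:E)%E.
Proof.
move=> mf f0; have mfD : measurable_fun D (EFin \o f).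
  by apply/measurable_EFinP; exact: measurable_funTS.
transitivity (\int[m]_(x in D) (\sum_(y \in range h)
    (y * \1_(h @^-1` [set y]) x)%:E * (f x)%:E))%E.
  apply: eq_integral => x xD; rewrite -ge0_mule_fsuml => [|y]; last first.
    exact: nnfun_muleindic_ge0.
  by rewrite fsumEFin // (fimfunE h x).
rewrite ge0_integral_fsum//; last 2 first.
- move=> y; apply: emeasurable_funM => //; apply: measurable_funTS.
  by apply/measurable_EFinP; apply: measurable_funM => //; exact: mlevel.
- move=> y x Dx; apply: mule_ge0; last by rewrite lee_fin.
  exact: nnfun_muleindic_ge0.
apply: eq_fsbigr => y yh.
under eq_integral do rewrite EFinM -muleA.
rewrite ge0_integralZl//.
- congr (_ * _)%E; rewrite integral_mkcondr; apply: eq_integral => x xD.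
  by rewrite epatch_indic muleC.
- by apply: emeasurable_funM => //; apply/measurable_EFinP/measurable_funTS/mlevel.
- by move=> x Dx; rewrite mule_ge0// lee_fin.
- by move: yh; rewrite inE => -[t _ <-]; rewrite lee_fin.
Qed.

(** Approximation of h by simple functions whose level sets are events of G, on
which the two densities have the same integral. *)
Lemma integral_same_density (h : T -> R) : measurable_wrt G h ->
  (forall x, 0 <= h x) ->
  (\int[m1]_(x in D) ((h x)%:E * (f1 x)%:E) =
   \int[m2]_(x in D) ((h x)%:E * (f2 x)%:E))%E.
Proof.
move=> mh h0.
have mhG : measurable_fun (setT : set (g_sigma_algebraType G)) (EFin \o h).
  by apply/measurable_EFinP/(measurable_wrtP Gs).
pose hn := nnsfun_approx measurableT mhG.
have mhn n : measurable_fun setT (hn n : T -> R).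
  by apply: (sub_measurable_fun Gm); apply/(measurable_wrtP Gs); exact: measurable_funPT.
have approx_lim (m : {measure set T -> \bar R}) (f : T -> R) :
    measurable_fun setT f -> (forall x, 0 <= f x) ->
    (\int[m]_(x in D) ((h x)%:E * (f x)%:E) =
     lim (\int[m]_(x in D) ((hn n x)%:E * (f x)%:E) @[n --> \oo]))%E.
  move=> mf f0; have mfD : measurable_fun D (EFin \o f).
    by apply/measurable_EFinP; exact: measurable_funTS.
  have hf x : D x ->
      ((h x)%:E * (f x)%:E = lim ((hn n x)%:E * (f x)%:E @[n --> \oo]))%E.
    move=> Dx; apply/esym/cvg_lim => //; apply: cvgeZr => //.
    by apply: (cvg_nnsfun_approx measurableT mhG _ I) => y _; rewrite lee_fin.
  under eq_integral => x /[!inE] /hf -> //.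
  apply: monotone_convergence => [//| | |].
  - move=> n; apply: emeasurable_funM => //; apply: measurable_funTS.
    by apply/measurable_EFinP; exact: mhn.
  - by move=> n x Dx; rewrite mule_ge0// lee_fin.
  - move=> x Dx a b ab; rewrite lee_wpmul2r ?lee_fin//.
    exact: (lefP _ _ (nd_nnsfun_approx measurableT mhG ab)).
rewrite !approx_lim//.
suff -> : (fun n => \int[m1]_(x in D) ((hn n x)%:E * (f1 x)%:E))%E =
    (fun n => \int[m2]_(x in D) ((hn n x)%:E * (f2 x)%:E))%E by [].
apply/funext => n; rewrite !simple_mul//; apply: eq_fsbigr => y _.
by congr (_ * _)%E; exact: f12.
Qed.

End weighted_integrals.

Section conditional_mean.
Context {d : measure_display} {T : measurableType d} {R : realType}.
Variables (P : probability T R) (G : set (set T)).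
Hypotheses (Gs : sigma_algebra setT G) (Gm : G `<=` d.-measurable).

(** If xi and Y have the same integral over the events of G, they have the same
mean against every bounded weight known to G. *)
Lemma Ex_sub_bounded (Y xi Z : T -> R) k :
  L1 P Y -> L1 P xi ->
  (forall C, G C -> E P (fun w => \1_C w * Y w) = E P (fun w => \1_C w * xi w)) ->
  measurable_wrt G Z -> (forall w, `|Z w| <= k) ->
  E P (fun w => Z w * Y w) = E P (fun w => Z w * xi w).
Proof.
move=> Y1 xi1 YxiC GZ Zk.
have L1abs f : L1 P f -> L1 P (fun w => `|f w| + f w).
  by move=> f1; apply: L1D => //; exact: L1_norm.
have abs0 (y : R) : 0 <= `|y| + y by have := ler_norm (- y); rewrite normrN; lra.
(* adding |Y| + |xi| to both functions and k to the weight makes all three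
   nonnegative, and leaves the difference of the two integrals unchanged *)
pose f1 w := (`|Y w| + Y w) + `|xi w|; pose f2 w := (`|xi w| + xi w) + `|Y w|.
have f11 : L1 P f1 by apply: L1D; [exact: L1abs|exact: L1_norm].
have f21 : L1 P f2 by apply: L1D; [exact: L1abs|exact: L1_norm].
have f10 w : 0 <= f1 w by rewrite addr_ge0.
have f20 w : 0 <= f2 w by rewrite addr_ge0.
have mZ := sub_measurable_fun Gm GZ.
pose h w := Z w + k.
have h0 w : 0 <= h w by have := Zk w; rewrite ler_norml /h; lra.
have Gh : measurable_wrt G h.
  apply/(measurable_wrtP Gs); apply: measurable_funD; last exact: measurable_cst.
  exact/(measurable_wrtP Gs).
have diff (f : T -> R) : measurable_fun setT f -> (exists k', forall w, `|f w| <= k') ->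
    E P (fun w => f w * f1 w) - E P (fun w => f w * f2 w) =
    E P (fun w => f w * Y w) - E P (fun w => f w * xi w).
  move=> mf [k' fk]; have i g := @L1M _ _ _ P f g k' mf fk.
  rewrite -!ExB; [|exact: i|exact: i|exact: i|exact: i].
  by apply: eq_Ex => w; rewrite /f1 /f2; ring.
have f12 B : G B -> (\int[P]_(w in setT `&` B) (f1 w)%:E =
    \int[P]_(w in setT `&` B) (f2 w)%:E)%E.
  move=> GB; have mB := Gm GB; rewrite setTI -!Ex_indic_EFin//; congr EFin.
  apply/eqP; rewrite -subr_eq0 diff; last by exists 1 => w; exact: norm_indic.
    by rewrite YxiC// subrr.
  exact: measurable_indic.
have hk w : `|h w| <= k + k.
  by rewrite ger0_norm// lerD2r (le_trans (ler_norm _)).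
have mh := sub_measurable_fun Gm Gh.
have := integral_same_density Gs Gm measurableT (L1_measurable f11) (L1_measurable f21)
  f10 f20 f12 Gh h0.
rewrite -(@Ex_EFin _ _ _ P (fun w => h w * f1 w)); last exact: L1M mh hk f11.
rewrite -(@Ex_EFin _ _ _ P (fun w => h w * f2 w)); last exact: L1M mh hk f21.
move=> e; have /eqP := EFin_inj e; rewrite -subr_eq0 diff//; last by exists (k + k).
have expand g : L1 P g -> E P (fun w => h w * g w) = E P (fun w => Z w * g w) + k * E P g.
  move=> g1; rewrite -ExZ// -ExD; [|exact: L1M mZ Zk g1|exact: L1Z].
  by apply: eq_Ex => w; rewrite /h mulrDl.
have -> : E P (fun w => h w * xi w) = E P (fun w => Z w * xi w) + k * E P Y.
  rewrite expand//; congr (_ + _ * _); apply/esym; have := YxiC _ (sigma_setT Gs).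
  by under eq_Ex do rewrite indicT mul1r; under [in RHS]eq_Ex do rewrite indicT mul1r.
by rewrite expand// subr_eq0 => /eqP/addIr.
Qed.

End conditional_mean.

Section change_of_measure.
Context {d : measure_display} {T : measurableType d} {R : realType}.
Variables (P P' : probability T R) (rho : T -> R).
Hypothesis rho1 : L1 P rho.
Hypothesis rho0 : forall w, 0 <= rho w.
Hypothesis P'E : forall B, measurable B -> P' B = (\int[P]_(w in B) (rho w)%:E)%E.

Lemma density_dominates : P' `<< P.
Proof.
apply/null_content_dominatesP => B mB PB0 /=; rewrite P'E//.
apply: null_set_integral => //; apply/measurable_funTS/measurable_EFinP.
exact: L1_measurable rho1.
Qed.

(** The density 1 for P' and the density rho for P have the same integral over every
event. *)
Lemma integral_density (f : T -> R) : measurable_fun setT f ->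
  (forall w, 0 <= f w) ->
  (\int[P']_w (f w)%:E = \int[P]_w (f w * rho w)%:E)%E.
Proof.
move=> mf f0; have := @integral_same_density _ _ _ P' P setT (fun=> 1) rho d.-measurable
  (@sigma_algebra_measurable _ T) (@subset_refl _ _) measurableT (measurable_cst _)
  (L1_measurable rho1) (fun=> ler01) rho0 _ f _ f0.
under eq_integral do rewrite mule1.
apply; last by move=> B mB; rewrite -[_ @^-1` _]setTI; exact: mf.
by move=> B mB; rewrite setTI -P'E// integral_cst// mul1e.
Qed.

Lemma L1_density (f : T -> R) : measurable_fun setT f ->
  L1 P' f <-> L1 P (fun w => f w * rho w).
Proof.
move=> mf; have mr := L1_measurable rho1.
have key : (\int[P']_w `|(EFin \o f) w| =
    \int[P]_w `|(EFin \o (fun w => (f w * rho w)%R)) w|)%E.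
  transitivity (\int[P']_w (`|f w|)%R%:E)%E; first by [].
  rewrite (@integral_density (fun w => `|f w|)%R)//; last exact: measurableT_comp.
  by apply: eq_integral => w _ /=; rewrite normrM (ger0_norm (rho0 w)).
split=> /integrableP[_ fi]; apply/integrableP; split.
- by apply/measurable_EFinP; exact: measurable_funM.
- by rewrite -key.
- exact/measurable_EFinP.
- by rewrite key.
Qed.

Lemma Ex_density (f : T -> R) : L1 P' f ->
  E P' f = E P (fun w => f w * rho w).
Proof.
move=> f1; have n1 := L1_norm f1.
have a1 : L1 P' (fun w => `|f w| + f w) by exact: L1D.
have key (g : T -> R) : L1 P' g -> (forall w, 0 <= g w) ->
    L1 P (fun w => g w * rho w) /\ E P' g = E P (fun w => g w * rho w).
  move=> g1 g0; have mg := L1_measurable g1; split; first exact/L1_density.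
  by rewrite /Rintegral integral_density.
have [an nE] := key _ n1 (fun w => normr_ge0 (f w)).
have [|aa aE] := key _ a1; first by move=> w; have := ler_norm (- f w); rewrite normrN; lra.
have -> : E P' f = E P' (fun w => `|f w| + f w) - E P' (fun w => `|f w|).
  by rewrite -ExB//; apply: eq_Ex => w; rewrite addrC addKr.
by rewrite nE aE -ExB//; apply: eq_Ex => w; ring.
Qed.

End change_of_measure.

(** * Functions determined by the events of the filtration *)

Section approximation.
Context {d : measure_display} {T : measurableType d} {R : realType}.
Variables (P : probability T R) (F : R -> set (set T)).
Hypothesis hF : usual_filtration P F.

(** The probability of the symmetric difference. *)
Definition sym_dist (C C' : set T) := E P (fun w => `|\1_C w - \1_C' w|).

Lemma L1_indicB (C C' : set T) : measurable C -> measurable C' ->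
  L1 P (fun w => `|\1_C w - \1_C' w : R|).
Proof.
move=> mC mC'; apply/L1_norm/(@L1_bounded _ _ _ _ _ 1).
  by apply: measurable_funB; exact: measurable_indic.
move=> w; rewrite !indicE.
by case: (_ \in C); case: (_ \in C'); rewrite ?subr0 ?sub0r ?subrr ?normrN ?normr1 ?normr0.
Qed.

(** Events that the filtration sees in finite time up to small probability; they
form a sigma-algebra, hence are all events. *)
Definition approximable (C : set T) := measurable C /\
  forall e, 0 < e -> exists t C', [/\ 0 <= t, F t C' & sym_dist C C' <= e].

Lemma filtration_measurable t C : 0 <= t -> F t C -> measurable C.
Proof. by move=> t0; exact: (filtration_sub hF). Qed.

Lemma approximableC C : approximable C -> approximable (~` C).
Proof.
move=> [mC aC]; split; first exact: measurableC.
move=> e /aC[t [C' [t0 FC' CC']]]; exists t, (~` C'); split => //.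
  by apply: sigma_setC => //; exact: (filtration_sigma hF).
apply: le_trans CC'; rewrite le_eqVlt; apply/orP; left; apply/eqP.
apply: eq_Ex => w; rewrite !indicE !in_setC.
by case: (_ \in C); case: (_ \in C'); rewrite /= ?subr0 ?sub0r ?subrr ?normrN.
Qed.

Lemma approximableU C D : approximable C -> approximable D ->
  approximable (C `|` D).
Proof.
move=> [mC aC] [mD aD]; split; first exact: measurableU.
move=> e e0; have e2 : 0 < e / 2 by lra.
have [t [C' [t0 FC' CC']]] := aC _ e2; have [s [D' [s0 FD' DD']]] := aD _ e2.
have m0 : 0 <= Num.max t s by rewrite le_max t0.
have FC : F (Num.max t s) C'.
  by apply: (filtration_nondecreasing hF t0) FC'; rewrite le_max lexx.
have FD : F (Num.max t s) D'.
  by apply: (filtration_nondecreasing hF s0) FD'; rewrite le_max lexx orbT.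
exists (Num.max t s), (C' `|` D'); split => //.
  by apply: sigma_setU => //; exact: (filtration_sigma hF).
have mC' := filtration_measurable t0 FC'; have mD' := filtration_measurable s0 FD'.
rewrite (le_trans (_ : _ <= sym_dist C C' + sym_dist D D'))//; last by lra.
rewrite -ExD; [|exact: L1_indicB|exact: L1_indicB].
apply: Ex_le.
- by apply: L1_indicB; exact: measurableU.
- by apply: L1D; exact: L1_indicB.
move=> w; rewrite !indicE !in_setU.
case: (_ \in C); case: (_ \in C'); case: (_ \in D); case: (_ \in D') => /=;
  rewrite ?subr0 ?sub0r ?subrr ?normrN ?normr1 ?normr0; lra.
Qed.

Lemma sigma_algebra_approximable : sigma_algebra setT approximable.
Proof.
have a0 : approximable set0.
  split => // e e0; exists 0, set0; split => //.
    by case: (filtration_sigma hF (lexx 0)).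
  rewrite /sym_dist (_ : (fun w => _) = (fun=> 0)) ?Ex_cst ?ltW//.
  by apply/funext => w; rewrite subrr normr0.
split => //.
  by move=> C aC; rewrite setTD; exact: approximableC.
move=> C aC; have mC i : measurable (C i) by case: (aC i).
have mU : measurable (\bigcup_i C i) by exact: bigcupT_measurable.
split => // e e0; pose U n := \big[setU/set0]_(i < n) C i.
have aU n : approximable (U n).
  by elim: n => [|n IH]; rewrite /U ?big_ord0 ?big_ord_recr//=; exact: approximableU.
(* finitely many of the events approximate the union *)
have e2 : 0 < e / 2 by lra.
have [||||w n|_] := @dct _ _ _ P (fun n w => `|\1_(\bigcup_i C i) w - \1_(U n) w|)
  (fun=> 0) (fun=> 1).
- by move=> n; apply: L1_measurable (L1_indicB mU (aU n).1).
- exact: measurable_cst.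
- apply: aeW => w; apply: cvg_near_cst.
  have [[N _ CN]|nU] := pselect ((\bigcup_i C i) w).
    exists N.+1 => // n /= Nn; rewrite !indicE !mem_set ?subrr ?normr0//.
      by rewrite /U -bigcup_mkord; exists N.
    by exists N.
  apply: nearW => n; rewrite !indicE !memNset ?subrr ?normr0//.
  by rewrite /U -bigcup_mkord => -[i _ Ci]; apply: nU; exists i.
- exact: L1_cst.
- rewrite normr_id !indicE.
  by case: (_ \in _); case: (_ \in _); rewrite ?subr0 ?sub0r ?subrr ?normrN ?normr1 ?normr0.
rewrite Ex_cst => /cvgrPdist_le/(_ _ e2)[N _ /(_ N (leqnn N))].
rewrite sub0r normrN => /(le_trans (ler_norm _)) HN.
have [t [C' [t0 FC' CC']]] := (aU N).2 _ e2.
have mC' := filtration_measurable t0 FC'.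
exists t, C'; split => //.
rewrite (le_trans (_ : _ <= sym_dist (\bigcup_i C i) (U N) + sym_dist (U N) C'))//.
  rewrite -ExD; [|exact: (L1_indicB mU (aU N).1)|exact: (L1_indicB (aU N).1)].
  apply: Ex_le; first exact: L1_indicB.
    by apply: L1D; apply: L1_indicB => //; case: (aU N).
  by move=> w; exact: ler_distD.
by move: HN CC'; rewrite -/(sym_dist _ _); lra.
Qed.

Lemma measurable_approximable C : measurable C -> approximable C.
Proof.
rewrite (filtration_generates hF); apply: smallest_sub.
  exact: sigma_algebra_approximable.
move=> D [t /= t0 FD]; split; first exact: filtration_measurable FD.
move=> e e0; exists t, D; split => //.
rewrite /sym_dist (_ : (fun w => _) = (fun=> 0)) ?Ex_cst ?ltW//.
by apply/funext => w; rewrite subrr normr0.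
Qed.

(** The event that h is negative is close to an event of some F t, and truncating
h at a level k makes the error at most k times the distance between the two. *)
Lemma ae_ge0_of_filtration (h : T -> R) : L1 P h ->
  (forall t C, 0 <= t -> F t C -> 0 <= E P (fun w => \1_C w * h w)) ->
  {ae P, forall w, 0 <= h w}.
Proof.
move=> h1 hC; have mh := L1_measurable h1.
pose C := [set w | h w < 0].
have mC : measurable C.
  by rewrite -[C]setTI; apply: measurable_fun_ltr => //; exact: measurable_cst.
have i1 := L1_indic mC h1.
have ge0 : 0 <= E P (fun w => \1_C w * h w).
  apply/ler_addgt0Pr => e e0; have e2 : 0 < e / 2 by lra.
  have mn : measurable_fun setT (fun w => `|h w|) by exact: measurableT_comp.
  have rest k w : `| `|h w| - Num.min `|h w| k%:R | <= `|h w|.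
    rewrite ger0_norm ?subr_ge0 ?ge_min ?lexx// lerBlDr lerDl.
    by rewrite le_min normr_ge0 ler0n.
  have mrest k : measurable_fun setT (fun w => `|h w| - Num.min `|h w| k%:R).
    by apply: measurable_funB => //; exact: measurable_minc.
  have [||||n w|_] := @dct _ _ _ P
    (fun k w => `|h w| - Num.min `|h w| k%:R) (fun=> 0) (fun w => `|h w|).
  - exact: mrest.
  - exact: measurable_cst.
  - apply: aeW => w; apply: cvg_near_cst; exists (Num.truncn `|h w|).+1 => // n /= hn.
    rewrite min_l ?subrr// ltW// (lt_le_trans (truncnS_gt _))//.
    by rewrite ler_nat.
  - exact: L1_norm.
  - exact: rest.
  rewrite Ex_cst => /cvgrPdist_le/(_ _ e2)[k _ /(_ k (leqnn k))].
  rewrite sub0r normrN => /(le_trans (ler_norm _)) Hk.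
  have e3 : 0 < e / 2 / k.+1%:R by apply: divr_gt0.
  have [t [C' [t0 FC' CC']]] := (measurable_approximable mC).2 _ e3.
  have mC' := filtration_measurable t0 FC'.
  have L1m := L1_le (mrest k) (rest k) (L1_norm h1).
  have L1d := L1_indicB mC mC'.
  have : E P (fun w => \1_C' w * h w - \1_C w * h w) <=
      E P (fun w => k.+1%:R * `|\1_C w - \1_C' w| + (`|h w| - Num.min `|h w| k%:R)).
    apply: Ex_le.
    - by apply: L1B => //; exact: L1_indic.
    - by apply: L1D => //; exact: L1Z.
    move=> w; rewrite -mulrBl (le_trans (ler_norm _))// normrM distrC.
    set y := `|h w|; set a := Num.min _ _; set u := `|_ - _|.
    have b0 : 0 <= y - a by rewrite subr_ge0 ge_min lexx.
    have ab : a <= k.+1%:R by rewrite ge_min ler_nat leqnSn orbT.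
    have u0 : 0 <= u by exact: normr_ge0.
    have u1 : u <= 1.
      rewrite /u !indicE.
      by case: (_ \in C); case: (_ \in C'); rewrite ?subr0 ?sub0r ?subrr ?normrN ?normr1 ?normr0.
    have h2 : u * a <= k.+1%:R * u by rewrite mulrC ler_wpM2r.
    have h3 : u * (y - a) <= y - a by rewrite ler_piMl.
    by move: h2 h3; lra.
  rewrite ExB//; last exact: L1_indic.
  rewrite ExD//; last exact: L1Z.
  rewrite ExZ// -/(sym_dist C C').
  have HC := hC _ _ t0 FC'.
  have : k.+1%:R * sym_dist C C' <= e / 2 by rewrite mulrC -ler_pdivlMr.
  by move: HC Hk; lra.
have le0 w : 0 <= - (\1_C w * h w).
  rewrite indicE; have [|] := boolP (w \in C); last by rewrite mul0r oppr0.
  by rewrite inE /C /= mul1r oppr_ge0 => /ltW.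
have E0 : (\int[P]_w `|(- (\1_C w * h w))%R%:E| = 0)%E.
  rewrite (eq_integral (fun w => (- (\1_C w * h w))%:E)); last first.
    by move=> w _; rewrite abse_EFin ger0_norm.
  rewrite -Ex_EFin; last exact: L1N.
  congr EFin; apply/eqP; rewrite eq_le Ex_ge0// andbT.
  rewrite (_ : E P _ = - E P (fun w => \1_C w * h w)) ?oppr_le0//.
  by rewrite -mulN1r -ExZ//; apply: eq_Ex => w; rewrite mulN1r.
have mg : measurable_fun setT (fun w => (- (\1_C w * h w))%:E).
  by apply/measurable_EFinP; apply: L1_measurable (L1N i1).
have /(ae_eq_integral_abs _ measurableT mg) := E0.
apply: filterS => w /(_ I) /= hw.
rewrite leNgt; apply/negP => h0; case: hw.
by rewrite indicE mem_set// mul1r => /eqP; rewrite oppr_eq0 lt_eqF.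
Qed.

End approximation.

(** * Optional sampling *)

Section finite_sums.
Context {d : measure_display} {T : measurableType d} {R : realType}.
Variable mu : probability T R.

Lemma L1_sum (f : nat -> T -> R) n : (forall i, L1 mu (f i)) ->
  L1 mu (fun w => \sum_(i < n) f i w).
Proof.
move=> f1; elim: n => [|n IH].
  by under eq_fun do rewrite big_ord0; exact: L1_cst.
by under eq_fun do rewrite big_ord_recr/=; exact: L1D.
Qed.

Lemma Ex_sum (f : nat -> T -> R) n : (forall i, L1 mu (f i)) ->
  E mu (fun w => \sum_(i < n) f i w) = \sum_(i < n) E mu (f i).
Proof.
move=> f1; elim: n => [|n IH].
  by under eq_Ex do rewrite big_ord0; rewrite Ex_cst big_ord0.
under eq_Ex do rewrite big_ord_recr/=.
by rewrite ExD ?IH ?big_ord_recr//; exact: L1_sum.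
Qed.

End finite_sums.

Section optional_sampling.
Context {d : measure_display} {T : measurableType d} {R : realType}.
Variables (P : probability T R) (F : R -> set (set T)).
Hypothesis hF : usual_filtration P F.

Definition right_continuous (y : R -> R) (r : R) :=
  forall u, r <= u -> y x @[x --> u^'+] --> y u.

Definition adapted_from (r : R) (Y : R -> T -> R) :=
  forall u, r <= u -> measurable_wrt (F u) (Y u).

(** xi closes the martingale Y up to time N. *)
Definition closed_by (r N : R) (Y : R -> T -> R) (xi : T -> R) :=
  forall u, r <= u -> u <= N -> L1 P (Y u) /\
    forall C, F u C -> E P (fun w => \1_C w * Y u w) = E P (fun w => \1_C w * xi w).

(** Exit times satisfy the condition on S < u directly, while S <= u would involve
the path just after u. *)
Record optional_time (r N : R) (S : T -> R) : Prop := OptionalTime {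
  optional_ge : forall w, r <= S w ;
  optional_le : forall w, S w <= N ;
  optional_lt : forall u, 0 <= u -> F u [set w | S w < u] }.

Variables (r N : R) (S : T -> R).
Hypothesis r0 : 0 <= r.
Hypothesis hS : optional_time r N S.

(* [disc m w] is the first point of the grid of step 1/(m+1) strictly after S w *)
Let idx m w := Num.truncn (m.+1%:R * S w).
Let grid m i : R := i.+1%:R / m.+1%:R.
Let disc m w := grid m (idx m w).

Let S0 w : 0 <= S w. Proof. exact: le_trans (optional_ge hS w). Qed.

Let disc_gt m w : S w < disc m w.
Proof. by rewrite /disc /grid ltr_pdivlMr// mulrC truncnS_gt. Qed.

Let disc_le m w : disc m w <= S w + m.+1%:R^-1.
Proof.
rewrite /disc /grid -natr1 mulrDl mul1r lerD2r ler_pdivrMr// mulrC.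
by rewrite /idx truncn_le mulr_ge0.
Qed.

Let disc_cvg w : disc m w @[m --> \oo] --> (S w)^'+.
Proof.
move=> A; rewrite /at_right /within/= => /nbhs_ballP[e/= e0 He].
change (\forall m \near \oo, A (disc m w)).
near=> m; apply: (He (disc m w) _ (disc_gt m w)).
rewrite /ball/= ltr_distlC; apply/andP; split.
  by rewrite (lt_trans _ (disc_gt m w))// ltrBlDr ltrDl.
rewrite (le_lt_trans (disc_le m w))// ltrD2l.
near: m; exact: (near_infty_natSinv_lt (PosNum e0)).
Unshelve. all: by end_near. Qed.

Let grid0 m i : 0 <= grid m i. Proof. by rewrite divr_ge0. Qed.

Let F_idx m i : F (grid m i) [set w | idx m w = i].
Proof.
have Fs := filtration_sigma hF (grid0 m i).
have -> : [set w | idx m w = i] =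
    [set w | S w < grid m i] `&` ~` [set w | S w < i%:R / m.+1%:R].
  apply/seteqP; split => w /=.
    move=> <-; split; first exact: disc_gt.
    apply/negP; rewrite -leNgt ler_pdivrMr// mulrC truncn_le.
    by rewrite mulr_ge0.
  rewrite /grid ltr_pdivlMr// => -[h1 /negP]; rewrite -leNgt ler_pdivrMr// => h2.
  by apply: truncn_def; rewrite mulrC h2.
apply: (sigma_setI Fs); first exact: (optional_lt hS).
apply: (sigma_setC Fs).
apply: (filtration_nondecreasing hF _ _ (optional_lt hS _)).
- by rewrite divr_ge0.
- by rewrite /grid ler_pM2r// ler_nat.
- by rewrite divr_ge0.
Qed.

Let idx_grid m w i : idx m w = i -> r <= grid m i /\ grid m i <= N + 1.
Proof.
move=> <-; split; first by rewrite (le_trans (optional_ge hS w))// ltW// disc_gt.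
rewrite (le_trans (disc_le m w))// lerD ?(optional_le hS)//.
by rewrite invf_le1// ler1n.
Qed.

Let grid_out m i : ~ (r <= grid m i /\ grid m i <= N + 1) ->
  [set w | idx m w = i] = set0.
Proof. by move=> h; apply/seteqP; split => // w /= /idx_grid. Qed.

Let disc_measurable m V : adapted_from r V ->
  measurable_fun setT (fun w => V (disc m w) w).
Proof.
move=> aV _ B mB; rewrite setTI.
have -> : (fun w => V (disc m w) w) @^-1` B =
    \bigcup_i ([set w | idx m w = i] `&` V (grid m i) @^-1` B).
  apply/seteqP; split => w /=; first by exists (idx m w).
  by move=> [i _ [/= <-]].
apply: bigcupT_measurable => i.
have [gi|/grid_out ->] := pselect (r <= grid m i /\ grid m i <= N + 1); last first.
  by rewrite set0I.
apply: measurableI; first exact: (filtration_measurable hF (grid0 m i) (F_idx m i)).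
apply: (filtration_measurable hF (grid0 m i)).
by apply: aV => //; case: gi.
Qed.

Let value_cvg V w : right_continuous (V ^~ w) r ->
  V (disc m w) w @[m --> \oo] --> V (S w) w.
Proof.
move=> rV; apply: (@cvg_comp _ _ _ (fun m => disc m w) (V ^~ w) _ _ _ (disc_cvg (w := w))).
exact: (rV _ (optional_ge hS w)).
Qed.

Lemma value_measurable V : adapted_from r V ->
  (forall w, right_continuous (V ^~ w) r) ->
  measurable_fun setT (fun w => V (S w) w).
Proof.
move=> aV rV; apply: (@measurable_fun_cvg _ _ _ _ (fun m w => V (disc m w) w)) => [m|w _].
  exact: disc_measurable.
exact: value_cvg.
Qed.

Variables (Y : R -> T -> R) (xi : T -> R).
Hypothesis xi1 : L1 P xi.
Hypothesis aY : adapted_from r Y.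
Hypothesis rY : forall w, right_continuous (Y ^~ w) r.
Hypothesis cY : closed_by r (N + 1) Y xi.

(** On the event that [disc m] is a given grid point, this is the closing
property of Y at a fixed time. *)
Let disc_closed m V (k : R) : adapted_from r V ->
  (forall u w, r <= u -> `|V u w| <= k) ->
  E P (fun w => V (disc m w) w * Y (disc m w) w) =
  E P (fun w => V (disc m w) w * xi w).
Proof.
move=> aV Vk; pose M := (Num.truncn (m.+1%:R * N)).+1.
have idxM w : (idx m w < M)%N.
  by rewrite ltnS le_truncn// ler_wpM2l// (optional_le hS).
pose W i w := \1_[set w | idx m w = i] w * V (grid m i) w.
have sumE (H : nat -> T -> R) w :
    V (disc m w) w * H (idx m w) w = \sum_(i < M) W i w * H i w.
  rewrite (bigD1 (Ordinal (idxM w)))//= big1 ?addr0.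
    by rewrite /W indicE mem_set// mul1r.
  move=> i iw; rewrite /W indicE memNset ?mul0r// => /= h.
  by move/eqP: iw; apply; apply/val_inj.
have Wi i : r <= grid m i /\ grid m i <= N + 1 ->
    measurable_wrt (F (grid m i)) (W i) /\ forall w, `|W i w| <= `|k|.
  move=> gi; have Fs := filtration_sigma hF (grid0 m i); split.
    apply/(measurable_wrtP Fs); apply: measurable_funM.
      apply: measurable_indic; apply: sub_sigma_algebra; exact: F_idx.
    by apply/(measurable_wrtP Fs)/aV; case: gi.
  move=> w; rewrite normrM -[leRHS]mul1r ler_pM//; first exact: norm_indic.
  by rewrite (le_trans (Vk _ _ _)) ?ler_norm//; case: gi.
have Wm i : measurable_fun setT (W i).
  have [gi|gi] := pselect (r <= grid m i /\ grid m i <= N + 1).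
    by apply: sub_measurable_fun (Wi i gi).1; exact: (filtration_sub hF).
  rewrite (_ : W i = fun=> 0); first exact: measurable_cst.
  by apply/funext => w; rewrite /W grid_out// indic0 mul0r.
have Wk i w : `|W i w| <= `|k|.
  have [gi|gi] := pselect (r <= grid m i /\ grid m i <= N + 1).
    exact: (Wi i gi).2.
  by rewrite /W grid_out// indic0 mul0r normr0.
have WY i : L1 P (fun w => W i w * Y (grid m i) w).
  have [gi|gi] := pselect (r <= grid m i /\ grid m i <= N + 1).
    by apply: (L1M (Wm i) (Wk i)); exact: (cY gi.1 gi.2).1.
  rewrite (_ : (fun w => _) = fun=> 0); first exact: L1_cst.
  by apply/funext => w; rewrite /W grid_out// indic0 !mul0r.
have Wxi i : L1 P (fun w => W i w * xi w) by exact: (L1M (Wm i) (Wk i)).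
rewrite (eq_Ex _ (sumE (fun i => Y (grid m i)))).
rewrite (eq_Ex _ (sumE (fun=> xi))).
rewrite [LHS](Ex_sum _ WY) [RHS](Ex_sum _ Wxi); apply: eq_bigr => i _.
have [gi|gi] := pselect (r <= grid m i /\ grid m i <= N + 1); last first.
  by apply: eq_Ex => w; rewrite /W grid_out// indic0 !mul0r.
have [Yi1 Yic] := cY gi.1 gi.2.
apply: (Ex_sub_bounded (filtration_sigma hF (grid0 m i))
  (filtration_sub hF (grid0 m i)) Yi1 xi1 Yic (Wi i gi).1 (Wi i gi).2).
Qed.

(** The values of Y at the discretized times lack an obvious integrable bound.  The
factor [damp a] bounds its product with |Y| by a, and tends to 1 as a grows. *)
Let damp (a y : R) : R := (1 + `|y| / a)^-1.

Let damp_pos (a y : R) : 0 < a -> 0 < 1 + `|y| / a.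
Proof. by move=> a0; rewrite ltr_pwDl// divr_ge0// ltW. Qed.

Let damp_ge0 (a y : R) : 0 < a -> 0 <= damp a y.
Proof. by move=> a0; rewrite invr_ge0 ltW// damp_pos. Qed.

Let damp_le1 (a y : R) : 0 < a -> damp a y <= 1.
Proof.
by move=> a0; rewrite invf_le1 ?damp_pos// lerDl divr_ge0// ltW.
Qed.

Let damp_mul (a y : R) : 0 < a -> damp a y * `|y| <= a.
Proof.
move=> a0; rewrite mulrC ler_pdivrMr ?damp_pos// mulrDr mulr1 mulrCA mulfV ?gt_eqF//.
by rewrite mulr1 lerDr ltW.
Qed.

Let measurable_damp (a : R) : 0 < a -> measurable_fun setT (damp a).
Proof.
move=> a0; apply: measurable_funTS; apply: continuous_measurable_fun => y.
apply: cvgV; first by rewrite gt_eqF// damp_pos.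
by apply: cvgD; [exact: cvg_cst|apply: cvgMl; exact: norm_continuous].
Qed.

Let damped (Z : R -> T -> R) (a u : R) (w : T) : R := Z u w * damp a (Y u w).

Let adapted_damped Z (a : R) : 0 < a -> adapted_from r Z -> adapted_from r (damped Z a).
Proof.
move=> a0 aZ u ru; have u0 := le_trans r0 ru.
have Fs := filtration_sigma hF u0.
apply/(measurable_wrtP Fs); apply: measurable_funM.
  by apply/(measurable_wrtP Fs); exact: aZ.
apply: (measurableT_comp (measurable_damp a0)).
by apply/(measurable_wrtP Fs); exact: aY.
Qed.

Let rc_damped Z (a : R) : 0 < a -> (forall w, right_continuous (Z ^~ w) r) ->
  forall w, right_continuous ((damped Z a) ^~ w) r.
Proof.
move=> a0 rZ w u ru; apply: cvgM; first exact: rZ.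
apply: cvgV; first by rewrite gt_eqF// damp_pos.
by apply: cvgD; [exact: cvg_cst|apply: cvgMl; apply: cvg_norm; exact: rY].
Qed.

Let sampling_damped Z (k a : R) : 0 < a -> adapted_from r Z ->
  (forall w, right_continuous (Z ^~ w) r) ->
  (forall u w, r <= u -> `|Z u w| <= k) ->
  E P (fun w => damped Z a (S w) w * Y (S w) w) =
  E P (fun w => damped Z a (S w) w * xi w).
Proof.
move=> a0 aZ rZ Zk.
have aD := adapted_damped a0 aZ; have rD := rc_damped a0 rZ.
have Dk u w : r <= u -> `|damped Z a u w| <= k.
  move=> ru; rewrite normrM (ger0_norm (damp_ge0 _ a0)) -[leRHS]mulr1.
  by rewrite ler_pM ?damp_ge0 ?damp_le1 ?Zk.
have DYk u w : r <= u -> `|damped Z a u w * Y u w| <= k * a.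
  move=> ru; rewrite -mulrA normrM normrM (ger0_norm (damp_ge0 _ a0)).
  by rewrite ler_pM ?damp_mul ?Zk// mulr_ge0// damp_ge0.
have rdisc m w : r <= disc m w by rewrite (le_trans (optional_ge hS w))// ltW// disc_gt.
have mD := value_measurable aD rD; have mY := value_measurable aY rY.
have [||||m w|_ c1] := @dct _ _ _ P
  (fun m w => damped Z a (disc m w) w * Y (disc m w) w)
  (fun w => damped Z a (S w) w * Y (S w) w) (fun=> k * a).
- by move=> m; apply: measurable_funM; exact: disc_measurable.
- exact: measurable_funM.
- by apply: aeW => w; apply: cvgM; exact: value_cvg.
- exact: L1_cst.
- exact: DYk.
have [||||m w|_ c2] := @dct _ _ _ P
  (fun m w => damped Z a (disc m w) w * xi w)
  (fun w => damped Z a (S w) w * xi w) (fun w => k * `|xi w|).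
- move=> m; apply: measurable_funM; first exact: disc_measurable.
  exact: L1_measurable xi1.
- by apply: measurable_funM => //; exact: L1_measurable xi1.
- by apply: aeW => w; apply: cvgMl; exact: value_cvg.
- exact/L1Z/L1_norm.
- by rewrite normrM ler_wpM2r// Dk.
apply: (cvg_unique _ c1) => //.
rewrite (_ : (fun m => _) = fun m => E P (fun w => damped Z a (disc m w) w * xi w)).
  exact: c2.
by apply/funext => m; exact: disc_closed Dk.
Qed.

Let damp_cvg (y : R) : damp n.+1%:R y @[n --> \oo] --> (1 : R).
Proof.
rewrite -[X in _ --> X]invr1; apply: cvgV; first exact: oner_neq0.
rewrite -[X in _ --> X]addr0; apply: cvgD; first exact: cvg_cst.
rewrite -(mulr0 `|y|); apply: cvgM; first exact: cvg_cst.
exact: cvg_harmonic.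
Qed.

(** For the weight Y / (1 + |Y|) the sampled product is Y^2 / (1 + |Y|), at least
|Y| - 1, so that damped sampling bounds the mean of |Y_S|. *)
Lemma optional_L1 : L1 P (fun w => Y (S w) w).
Proof.
have mY := value_measurable aY rY.
pose Z u w := Y u w / (1 + `|Y u w|).
have pos u w : 0 < 1 + `|Y u w| by rewrite ltr_pwDl.
have Z1 u w : r <= u -> `|Z u w| <= 1.
  move=> _; rewrite normrM normfV (gtr0_norm (pos u w)) ler_pdivrMr// mul1r.
  by rewrite lerDr.
have ZE : Z = damped Y 1 by apply/funext => u; apply/funext => w; rewrite /Z /damped /damp divr1.
have aZ : adapted_from r Z by rewrite ZE; exact: adapted_damped.
have rZ w : right_continuous (Z ^~ w) r by rewrite ZE; exact: rc_damped.
have mZ := value_measurable aZ rZ.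
pose g n w := damp n.+1%:R (Y (S w) w) * `|Y (S w) w|.
have mg n : measurable_fun setT (g n).
  apply: measurable_funM; last exact: measurableT_comp.
  exact: (measurableT_comp (measurable_damp _)).
have g0 n w : 0 <= g n w by rewrite mulr_ge0// damp_ge0.
have g1 n : L1 P (g n).
  by apply: (@L1_bounded _ _ _ _ _ n.+1%:R) => // w; rewrite ger0_norm// damp_mul.
suff H : L1 P (fun w => `|Y (S w) w|) by apply: (L1_le mY _ H).
have [] // := @fatou_real _ _ _ P g (fun w => `|Y (S w) w|)
  (1 + E P (fun w => `|xi w|)) g1 _ g0.
- exact: measurableT_comp.
- apply: aeW => w; rewrite -[X in _ --> X]mul1r; apply: cvgM; last exact: cvg_cst.
  exact: damp_cvg.
move=> n; have n0 : (0 : R) < n.+1%:R by [].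
have aD := adapted_damped n0 aZ; have rD := rc_damped n0 rZ.
have mD := value_measurable aD rD.
have Dk w : `|damped Z n.+1%:R (S w) w| <= 1.
  rewrite normrM (ger0_norm (damp_ge0 _ n0)) -[leRHS]mulr1.
  by rewrite ler_pM ?damp_ge0 ?damp_le1 ?Z1 ?(optional_ge hS).
have i1 : L1 P (fun w => damped Z n.+1%:R (S w) w * xi w) by exact: (L1M mD Dk).
have i2 : L1 P (fun w => damped Z n.+1%:R (S w) w * Y (S w) w).
  apply: (@L1_bounded _ _ _ _ _ (1 * n.+1%:R)); first exact: measurable_funM.
  move=> w; rewrite /damped -[X in `|X|]mulrA normrM [X in _ * X]normrM (ger0_norm (damp_ge0 _ n0)).
  by rewrite ler_pM ?damp_mul ?Z1 ?(optional_ge hS)// mulr_ge0// damp_ge0.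
rewrite (le_trans (_ : _ <= E P (fun w => 1 + damped Z n.+1%:R (S w) w * Y (S w) w)))//.
  apply: Ex_le => //; first by apply: L1D => //; exact: L1_cst.
  move=> w; rewrite /g /damped /Z.
  set y := Y _ _; set q := damp _ _.
  have -> : y / (1 + `|y|) * q * y = q * (`|y| ^+ 2 / (1 + `|y|)).
    by rewrite real_normK ?num_real//; ring.
  have ypos : 0 < 1 + `|y| by rewrite ltr_pwDl.
  have h : `|y| - 1 <= `|y| ^+ 2 / (1 + `|y|).
    by rewrite ler_pdivlMr// (_ : (`|y| - 1) * (1 + `|y|) = `|y| ^+ 2 - 1); [lra|ring].
  have h2 : q * (`|y| - 1) <= q * (`|y| ^+ 2 / (1 + `|y|)) by rewrite ler_wpM2l// damp_ge0.
  have h3 : q <= 1 by rewrite damp_le1.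
  by move: h2 h3; lra.
rewrite ExD//; last exact: L1_cst.
rewrite Ex_cst lerD2l (sampling_damped n0 aZ rZ Z1).
rewrite (le_trans (ler_norm _))// (le_trans (Ex_norm i1))//.
apply: Ex_le; [exact: L1_norm|exact: L1_norm|].
by move=> w; rewrite normrM ler_piMl.
Qed.

(** Damped sampling, where the damping tends to 1; integrability of Y_S allows
dominated convergence. *)
Lemma optional_sampling Z (k : R) : adapted_from r Z ->
  (forall w, right_continuous (Z ^~ w) r) ->
  (forall u w, r <= u -> `|Z u w| <= k) ->
  E P (fun w => Z (S w) w * Y (S w) w) = E P (fun w => Z (S w) w * xi w).
Proof.
move=> aZ rZ Zk.
have mZ := value_measurable aZ rZ; have mY := value_measurable aY rY.
have cv eta : L1 P eta ->
    E P (fun w => damped Z n.+1%:R (S w) w * eta w) @[n --> \oo] -->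
    E P (fun w => Z (S w) w * eta w).
  move=> e1; have me := L1_measurable e1.
  have [||||n w|_ //] := @dct _ _ _ P
    (fun n w => damped Z n.+1%:R (S w) w * eta w)
    (fun w => Z (S w) w * eta w) (fun w => k * `|eta w|).
  - move=> n; apply: measurable_funM => //; apply: value_measurable.
      exact: adapted_damped.
    exact: rc_damped.
  - exact: measurable_funM.
  - apply: aeW => w; apply: cvgMl; rewrite -[X in _ --> X]mulr1.
    by apply: cvgM; [exact: cvg_cst|exact: damp_cvg].
  - exact/L1Z/L1_norm.
  - rewrite normrM ler_wpM2r// normrM (ger0_norm (damp_ge0 _ _))//.
    rewrite (le_trans _ (Zk (S w) w (optional_ge hS w)))//.
    by rewrite ler_piMr// damp_le1.
apply: (cvg_unique _ (cv _ optional_L1)) => //.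
rewrite (_ : (fun n => _) = fun n => E P (fun w => damped Z n.+1%:R (S w) w * xi w)).
  exact: cv.
by apply/funext => n; exact: (@sampling_damped _ k).
Qed.

End optional_sampling.

(** * Zero-free intervals and exit times of a path *)

Section zero_free_intervals.
Context {R : realType}.
Implicit Types (y : R -> R) (r t : R).

Definition zero_free y r t := forall u, r <= u -> u <= t -> y u != 0.

Lemma zero_free_sub y r t r' t' : r <= r' -> t' <= t ->
  zero_free y r t -> zero_free y r' t'.
Proof. by move=> rr tt h u ru ut; apply: h; [exact: le_trans ru|exact: le_trans tt]. Qed.

Lemma zero_free_cat y r s t : zero_free y r s -> zero_free y s t -> zero_free y r t.
Proof. by move=> h1 h2 u ru ut; have [us|/ltW su] := leP u s; [exact: h1|exact: h2]. Qed.

Lemma zero_free_sg y r t : continuous y -> r <= t -> zero_free y r t ->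
  Num.sg (y t) = Num.sg (y r).
Proof.
move=> cy rt nzy.
have yr := nzy r (lexx r) rt; have yt := nzy t rt (lexx t).
(* a change of sign would give a zero by the intermediate value theorem *)
have no0 : ~ (Num.min (y r) (y t) <= 0 <= Num.max (y r) (y t)).
  move=> h; have [c] := IVT rt (continuous_subspaceT cy) h.
  by rewrite in_itv/= => /andP[rc ct] yc; move: (nzy c rc ct); rewrite yc eqxx.
have [r0|r0|r0] := ltgtP (y r) 0; last by rewrite r0 eqxx in yr.
  rewrite ltr0_sg ?[RHS]ltr0_sg// ltNge; apply/negP => t0; apply: no0.
  by rewrite ge_min le_max (ltW r0) t0 orbT.
rewrite gtr0_sg ?[RHS]gtr0_sg// ltNge; apply/negP => t0; apply: no0.
by rewrite ge_min le_max (ltW r0) t0 orbT.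
Qed.

(** The minimum keeps the points in [r, t] for every index i. *)
Definition mesh r t (m i : nat) : R := r + (t - r) * Num.min 1 (i%:R / m.+1%:R).

Lemma mesh_in r t m i : r <= t -> r <= mesh r t m i <= t.
Proof.
move=> rt; have tr : 0 <= t - r by rewrite subr_ge0.
rewrite /mesh lerDl mulr_ge0 ?le_min ?ler01 ?divr_ge0//=.
rewrite -lerBrDl ler_piMr// ge_min lexx//.
Qed.

(** By compactness a continuous path without zeros on [r, t] stays away from 0; the
converse uses that the mesh points are dense.  The right-hand side only involves
countably many times, whence the measurability of the event. *)
Lemma zero_freeP y r t : continuous y -> r <= t -> zero_free y r t <->
  exists n, forall m i, n.+1%:R^-1 <= `|y (mesh r t m i)|.
Proof.
move=> cy rt; split.
  move=> nzy.
  have cn : {within `[r, t], continuous (fun u => `|y u|)}.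
    by apply: continuous_subspaceT => u; apply: cvg_norm; exact: cy.
  have [c crt cmin] := EVT_min rt cn.
  have yc : 0 < `|y c|.
    by rewrite normr_gt0; move: crt; rewrite in_itv/= => /andP[]; exact: nzy.
  exists (Num.truncn `|y c|^-1) => m i.
  rewrite (le_trans _ (cmin _ _))//; last by rewrite in_itv/= mesh_in.
  by rewrite invf_ple ?posrE// ltW// truncnS_gt.
move=> [n Hn] u ru ut; apply/eqP => yu.
pose th := if t == r then 0 else (u - r) / (t - r).
have uth : u = r + (t - r) * th.
  rewrite /th; case: eqP => [tr|/eqP tr].
    by rewrite mulr0 addr0; apply/eqP; rewrite eq_le ru -tr ut.
  by rewrite mulrC divfK ?subr_eq0// addrC subrK.
have th0 : 0 <= th.
  by rewrite /th; case: ifP => // _; rewrite divr_ge0// subr_ge0.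
have th1 : th <= 1.
  rewrite /th; case: eqP => // /eqP tr; rewrite ler_pdivrMr ?mul1r ?lerD2r//.
  by rewrite subr_gt0 lt_neqAle eq_sym tr.
pose i m := Num.truncn (m.+1%:R * th).
have cvi : mesh r t m (i m) @[m --> \oo] --> u.
  rewrite uth; apply: cvgD; first exact: cvg_cst.
  apply: cvgM; first exact: cvg_cst.
  apply/cvgrPdist_le => e e0; near=> m.
  have m0 : 0 <= m.+1%:R * th by rewrite mulr_ge0.
  have /andP[h1 h2] := truncn_itv m0; rewrite -/(i m) in h1 h2.
  have h3 : (i m)%:R / m.+1%:R <= th by rewrite ler_pdivrMr// mulrC.
  rewrite min_r ?(le_trans h3)// ger0_norm ?subr_ge0//.
  have h4 : th <= (i m)%:R / m.+1%:R + m.+1%:R^-1.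
    by rewrite -[X in _ + X]mul1r -mulrDl natr1 ler_pdivlMr// mulrC ltW.
  rewrite lerBlDl (le_trans h4)// lerD2l ltW//.
  near: m; exact: (near_infty_natSinv_lt (PosNum e0)).
have cvy : `|y (mesh r t m (i m))| @[m --> \oo] --> `|y u|.
  apply: cvg_norm.
  exact: (@cvg_comp _ _ _ (fun m => mesh r t m (i m)) y _ _ _ cvi (cy u)).
have : n.+1%:R^-1 <= `|y u| by apply: (cvgr_to_ge cvy); apply: nearW.
by rewrite yu normr0 leNgt invr_gt0 ltr0n.
Unshelve. all: by end_near. Qed.

End zero_free_intervals.

Section first_exit.
Context {R : realType}.
Variables (y a : R -> R) (x r t : R).
Hypotheses (cy : continuous y) (ca : continuous a).
Hypothesis nda : forall u v, u <= v -> a u <= a v.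
Hypothesis rt : r <= t.

(* times up to which no exit has occurred; r belongs to it even if a r > x *)
Let before : set R := [set u | u = r \/
  [/\ r <= u, u <= t, a u <= x & forall v, r <= v -> v < u -> y v != 0]].

(** The first time after r at which a exceeds x or y vanishes, or t if there is
none. *)
Definition first_exit : R := sup before.

Let before_r : before r. Proof. by left. Qed.

Let before_ub : ubound before t.
Proof. by move=> u [->//|[]]. Qed.

Let before_nonempty : before !=set0.
Proof. by exists r; exact: before_r. Qed.

Let before_bounded : has_ubound before.
Proof. by exists t; exact: before_ub. Qed.

Lemma first_exit_ge : r <= first_exit.
Proof. by apply: ub_le_sup; [exact: before_bounded|exact: before_r]. Qed.

Lemma first_exit_le : first_exit <= t.
Proof. by apply: ge_sup; [exists r; exact: before_r|exact: before_ub]. Qed.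

Let before_down u v : before v -> r <= u -> u <= v -> before u.
Proof.
move=> [->|[rv vt av nzv]] ru uv; first by left; apply/eqP; rewrite eq_le uv.
right; split => //; [exact: le_trans vt|exact: le_trans (nda uv) av|].
by move=> s rs su; apply: nzv => //; exact: lt_le_trans uv.
Qed.

Let before_lt u : r <= u -> u < first_exit -> before u.
Proof.
move=> ru /(sup_gt before_nonempty)[v Bv uv].
exact: before_down Bv ru (ltW uv).
Qed.

Let before_exit : before first_exit.
Proof.
have := first_exit_ge; rewrite le_eqVlt => /predU1P[<-//|rS].
right; split; [exact: ltW|exact: first_exit_le| |]; last first.
  move=> v rv vS.
  have h1 : r <= (v + first_exit) / 2 by lra.
  have h2 : (v + first_exit) / 2 < first_exit by lra.
  by case: (before_lt h1 h2) => [h|[_ _ _ h]]; [exfalso|apply: h]; lra.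
rewrite leNgt; apply/negP => xa.
have nx : \forall u \near first_exit^'-, x < a u.
  have nx : \forall u \near first_exit, x < a u.
    exact: (cvgr_gt (a first_exit) (@ca first_exit) x xa).
  by apply: filterS nx => u xu _.
have : \forall u \near first_exit^'-, False.
  near=> u.
  have xu : x < a u by near: u.
  have ru : r < u by near: u; exact: nbhs_left_gt.
  have uS : u < first_exit by near: u; exact: nbhs_left_lt.
  have [ur|[_ _ au _]] := before_lt (ltW ru) uS.
    by rewrite ur ltxx in ru.
  by rewrite ltNge au in xu.
by move/filter_ex => [].
Unshelve. all: by end_near. Qed.

Lemma first_exit_ltP u : r < u -> u <= t ->
  first_exit < u <-> x < a u \/ exists v, [/\ r <= v, v < u & y v = 0].
Proof.
move=> ru ut; split.
  move=> Su; have nB : ~ before u.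
    by move=> Bu; have := ub_le_sup before_bounded Bu; rewrite leNgt Su.
  have [|au] := ltP x (a u); first by left.
  right; apply: contrapT => nE; apply: nB; right; split => //; first exact: ltW.
  move=> v rv vu; apply/eqP => yv; apply: nE; by exists v.
move=> H; rewrite ltNge; apply/negP => uS.
have [ur|[_ _ au nzu]] := before_down before_exit (ltW ru) uS.
  by rewrite ur ltxx in ru.
case: H => [|[v [rv vu yv]]]; first by rewrite ltNge au.
by move: (nzu v rv vu); rewrite yv eqxx.
Qed.

Hypothesis ar : a r <= x.

Lemma first_exit_bound : a first_exit <= x.
Proof. by case: before_exit => [->|[]]. Qed.

Lemma first_exit_free v : r <= v -> v < first_exit -> y v != 0.
Proof.
case: before_exit => [->|[_ _ _ h]]; last exact: h.
by move=> rv vr; rewrite ltNge rv in vr.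
Qed.

Lemma first_exit_end : a t <= x -> zero_free y r t -> first_exit = t.
Proof.
move=> at_ nzt; apply/eqP; rewrite eq_le first_exit_le/=.
apply: (ub_le_sup before_bounded); right; split => // v rv vt.
by apply: nzt => //; exact: ltW.
Qed.

(** An exit before t where y does not vanish is caused by a, which exceeds x
immediately after it. *)
Lemma first_exit_after v : first_exit < t -> y first_exit != 0 ->
  first_exit < v -> x < a v.
Proof.
move=> St yS Sv.
have nzS : \forall u \near first_exit^'+, forall s, first_exit < s -> s <= u -> y s != 0.
  have : \forall u \near first_exit, y u != 0 by exact: (cvgr_neq0 (y first_exit) (@cy first_exit) yS).
  move=> /nbhs_ballP[e /= e0 He]; near=> u => s Ss su; apply: He.
  rewrite /ball/= ltr_distlC; apply/andP; split; first by lra.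
  rewrite (le_lt_trans su)//; near: u; apply: nbhs_right_lt; lra.
near first_exit^'+ => u.
have Su : first_exit < u by near: u; exact: nbhs_right_gt.
have uv : u < v by near: u; exact: nbhs_right_lt.
have ut : u < t by near: u; exact: nbhs_right_lt.
have nzu : forall s, first_exit < s -> s <= u -> y s != 0 by near: u.
have ru : r < u := le_lt_trans first_exit_ge Su.
have [|] := (first_exit_ltP ru (ltW ut)).1 Su.
  by move=> xa; rewrite (lt_le_trans xa)// nda// ltW.
move=> [s [rs su ys]]; exfalso.
have [sS|sS|sS] := ltgtP s first_exit.
- by move: (first_exit_free rs sS); rewrite ys eqxx.
- by move: (nzu s sS (ltW su)); rewrite ys eqxx.
- by rewrite -sS ys eqxx in yS.
Unshelve. all: by end_near. Qed.

End first_exit.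

(** * Zeros of a closed martingale *)

Section signed_density.
Context {d : measure_display} {T : measurableType d} {R : realType}.
Variables (P : probability T R) (F : R -> set (set T)).
Hypothesis hF : usual_filtration P F.

Lemma F_bigcap t (C : nat -> set T) : 0 <= t -> (forall n, F t (C n)) ->
  F t (\bigcap_n C n).
Proof.
move=> t0 FC; have Fs := filtration_sigma hF t0.
rewrite -[X in F t X]setCK setC_bigcap; apply/(sigma_setC Fs)/(sigma_bigcup Fs) => n.
exact: sigma_setC.
Qed.

Lemma indic_measurable_wrt t C : 0 <= t -> F t C -> measurable_wrt (F t) (\1_C : T -> R).
Proof.
move=> t0 FC; apply/(measurable_wrtP (filtration_sigma hF t0)).
by apply: measurable_indic; apply: sub_sigma_algebra.
Qed.

Lemma mul_measurable_wrt t (f g : T -> R) : 0 <= t -> measurable_wrt (F t) f ->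
  measurable_wrt (F t) g -> measurable_wrt (F t) (fun w => f w * g w).
Proof.
move=> t0 Ff Fg; have Fs := filtration_sigma hF t0.
apply/(measurable_wrtP Fs); apply: measurable_funM; exact/(measurable_wrtP Fs).
Qed.

Lemma comp_measurable_wrt t (f : T -> R) (phi : R -> R) :
  measurable_wrt (F t) f -> measurable_fun setT phi ->
  measurable_wrt (F t) (phi \o f).
Proof.
move=> Ff mphi B mB; rewrite comp_preimage; apply: Ff.
by rewrite -[X in measurable X]setTI; exact: mphi.
Qed.

Lemma measurable_wrt_mono s t (f : T -> R) : 0 <= s -> s <= t ->
  measurable_wrt (F s) f -> measurable_wrt (F t) f.
Proof. by move=> s0 st Ff B mB; apply: (filtration_nondecreasing hF s0 st); exact: Ff. Qed.

Lemma measurable_sg : measurable_fun setT (@Num.sg R).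
Proof.
rewrite (_ : @Num.sg R = fun z => \1_[set z | 0 < z] z - \1_[set z | z < 0] z).
  apply: measurable_funB; apply: measurable_indic.
    have -> : [set z : R | 0 < z] = `]0, +oo[%classic.
      by apply/seteqP; split => z /=; rewrite in_itv/= andbT.
    exact: measurable_itv.
  have -> : [set z : R | z < 0] = `]-oo, 0[%classic.
    by apply/seteqP; split => z /=; rewrite in_itv.
  exact: measurable_itv.
apply/funext => z; rewrite !indicE.
have -> : (z \in [set z : R | 0 < z]) = (0 < z) by apply/idP/idP; rewrite inE.
have -> : (z \in [set z : R | z < 0]) = (z < 0) by apply/idP/idP; rewrite inE.
have [z0|z0|->] := ltgtP z 0.
- by rewrite ltr0_sg// sub0r.
- by rewrite gtr0_sg// subr0.
- by rewrite sgr0 subrr.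
Qed.

Variables (D : R -> T -> R) (Dinf : T -> R).
Hypothesis aD : forall t, 0 <= t -> measurable_wrt (F t) (D t).
Hypothesis cD : forall w, continuous (D ^~ w).
Hypothesis Dinf1 : L1 P Dinf.
Hypothesis D_closed : forall t, 0 <= t -> L1 P (D t) /\
  forall C, F t C -> E P (fun w => \1_C w * D t w) = E P (fun w => \1_C w * Dinf w).
Hypothesis Dinf0 : P [set w | Dinf w = 0] = 0%E.

Definition nozero r t := [set w | zero_free (D ^~ w) r t].
Definition nozero_after r := [set w | forall u, r <= u -> D u w != 0].

Lemma F_nozero r t : 0 <= r -> r <= t -> F t (nozero r t).
Proof.
move=> r0 rt; have t0 := le_trans r0 rt; have Fs := filtration_sigma hF t0.
have -> : nozero r t = \bigcup_n \bigcap_m \bigcap_i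
    [set w | n.+1%:R^-1 <= `|D (mesh r t m i) w|].
  apply/seteqP; split => w.
    move=> /(zero_freeP (@cD w) rt)[n Hn]; exists n => // m _ i _; exact: Hn.
  move=> [n _ Hn]; apply/(zero_freeP (@cD w) rt); exists n => m i; exact: Hn.
apply: (sigma_bigcup Fs) => n; apply: F_bigcap => // m; apply: F_bigcap => // i.
have /andP[rm mt] := mesh_in m i rt; have m0 := le_trans r0 rm.
apply: (filtration_nondecreasing hF m0 mt).
have := comp_measurable_wrt (aD m0) (@normr_measurable R setT).
move=> /(_ `[n.+1%:R^-1, +oo[%classic (measurable_itv _)).
by congr (F _ _); apply/seteqP; split => w /=; rewrite in_itv/= andbT.
Qed.

Lemma nozero_afterE r : nozero_after r = \bigcap_n nozero r (r + n%:R).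
Proof.
apply/seteqP; split => w /=.
  by move=> h n _ u ru _; exact: h.
move=> h u ru; apply: (h (Num.truncn (u - r)).+1) => //.
by rewrite -lerBlDl ltW// truncnS_gt.
Qed.

Lemma measurable_nozero r t : 0 <= r -> r <= t -> measurable (nozero r t).
Proof. by move=> r0 rt; apply: (filtration_measurable hF (le_trans r0 rt)); exact: F_nozero. Qed.

Lemma measurable_nozero_after r : 0 <= r -> measurable (nozero_after r).
Proof.
move=> r0; rewrite nozero_afterE; apply: bigcapT_measurable => n.
by apply: measurable_nozero => //; rewrite lerDl.
Qed.

Lemma cvg_indic_nozero r w : \1_(nozero r (r + n%:R)) w @[n --> \oo] --> (\1_(nozero_after r) w : R).
Proof.
apply: cvg_near_cst.
have [h|h] := pselect (nozero_after r w).
  by apply: nearW => n; rewrite !indicE !mem_set// => u ru _; exact: h.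
have : ~ (\bigcap_n nozero r (r + n%:R)) w by rewrite -nozero_afterE.
move=> /existsNP[N /not_implyP[_ hN]].
exists N => // n /= Nn; rewrite !indicE (memNset h) memNset// => hn; apply: hN.
by apply: zero_free_sub hn; rewrite ?lexx ?lerD2l ?ler_nat.
Qed.

(** A zero in [r, u[ lies before some u - (u - r)/(n+1), so that S < u is a countable
union of events of F_u. *)
Lemma optional_first_exit (A : R -> T -> R) x r t :
  (forall t, 0 <= t -> measurable_wrt (F t) (A t)) ->
  (forall w, continuous (A ^~ w)) ->
  (forall w u v, u <= v -> A u w <= A v w) ->
  0 <= r -> r <= t ->
  optional_time F r t (fun w => first_exit (D ^~ w) (A ^~ w) x r t).
Proof.
move=> aA cA ndA r0 rt; split.
- by move=> w; exact: first_exit_ge.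
- by move=> w; exact: first_exit_le.
move=> u u0; have Fs := filtration_sigma hF u0.
have [ur|ru] := leP u r.
  rewrite (_ : [set w | _] = set0); first by case: Fs.
  apply/seteqP; split => // w /=; rewrite ltNge.
  by rewrite (le_trans ur)// first_exit_ge.
have [ut|tu] := leP u t; last first.
  rewrite (_ : [set w | _] = setT); first exact: sigma_setT.
  by apply/seteqP; split => // w _ /=; rewrite (le_lt_trans _ tu)// first_exit_le.
pose s n := u - (u - r) / n.+1%:R.
have rs n : r <= s n.
  by rewrite /s lerBrDl -lerBrDr ler_pdivrMr// ler_peMr ?subr_ge0 ?ler1n// ltW.
have su n : s n < u by rewrite /s ltrBlDr ltrDl divr_gt0// subr_gt0.
have -> : [set w | first_exit (D ^~ w) (A ^~ w) x r t < u] =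
    [set w | x < A u w] `|` \bigcup_n ~` nozero r (s n).
  apply/seteqP; split => w /=.
    move=> /(first_exit_ltP (D ^~ w) x (@cA w) (ndA w) rt ru ut)[|[v [rv vu Dv]]].
      by left.
    right; exists (Num.truncn ((u - r) / (u - v))) => // /(_ v rv) h.
    have : D v w != 0.
      apply: h; rewrite /s lerBrDl -lerBrDr ler_pdivrMr// mulrC -ler_pdivrMr.
        by rewrite ltW// truncnS_gt.
      by rewrite subr_gt0.
    by rewrite Dv eqxx.
  move=> H; apply/(first_exit_ltP (D ^~ w) x (@cA w) (ndA w) rt ru ut).
  case: H => [|[n _ /existsNP[v /not_implyP[rv /not_implyP[vs /negP]]]]]; first by left.
  rewrite negbK => /eqP Dv; right; exists v; split => //.
  exact: le_lt_trans (su n).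
apply: (sigma_setU Fs).
  have := aA u u0 `]x, +oo[%classic (measurable_itv _).
  by congr (F _ _); apply/seteqP; split => w /=; rewrite in_itv/= andbT.
apply: (sigma_bigcup Fs) => n; apply: (sigma_setC Fs).
apply: (filtration_nondecreasing hF _ (ltW (su n))).
  exact: le_trans (rs n).
exact: F_nozero.
Qed.

Lemma D_closed_by r N : 0 <= r -> closed_by P F r N D Dinf.
Proof. by move=> r0 u ru _; exact/D_closed/(le_trans r0). Qed.

Lemma D_right_continuous w r : right_continuous (D ^~ w) r.
Proof. by move=> u _; apply: cvg_within_filter; exact: cD. Qed.

(** Sampling D at its first zero after r, capped at t: the value is 0 unless D has
no zero on [r, t].  So the events with a zero contribute nothing. *)
Lemma Ex_nozero r t Z k : 0 <= r -> r <= t -> measurable_wrt (F r) Z ->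
  (forall w, `|Z w| <= k) ->
  E P (fun w => Z w * (\1_(nozero r t) w * Dinf w)) = E P (fun w => Z w * Dinf w).
Proof.
move=> r0 rt FZ Zk; have t0 := le_trans r0 rt.
pose S w := first_exit (D ^~ w) (fun=> 0) 0 r t.
have hS : optional_time F r t S.
  apply: (@optional_first_exit (fun _ _ => 0)) => // [s s0|w].
    apply/(measurable_wrtP (filtration_sigma hF s0)); exact: measurable_cst.
  by move=> u; exact: cvg_cst.
have rZ w : right_continuous ((fun _ : R => Z) ^~ w) r by move=> u _; exact: cvg_cst.
have aZ : adapted_from F r (fun _ : R => Z).
  by move=> u ru; exact: measurable_wrt_mono FZ.
have aDr : adapted_from F r D by move=> u ru; exact/aD/(le_trans r0).
have rD w : right_continuous (D ^~ w) r by exact: D_right_continuous.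
have <- := @optional_sampling _ _ _ P F hF r t S r0 hS D Dinf Dinf1 aDr rD
  (@D_closed_by r (t + 1) r0) (fun _ => Z) k aZ rZ (fun _ w _ => Zk w).
have [Dt1 Dtc] := D_closed t0.
have mz := F_nozero r0 rt.
transitivity (E P (fun w => (Z w * \1_(nozero r t) w) * D t w)).
  under [LHS]eq_Ex do rewrite mulrA.
  apply/esym; apply: (Ex_sub_bounded (filtration_sigma hF t0) (filtration_sub hF t0)
    Dt1 Dinf1 Dtc (k := k)).
    apply: mul_measurable_wrt => //; first exact: measurable_wrt_mono FZ.
    exact: indic_measurable_wrt.
  move=> w; rewrite normrM -[leRHS]mulr1 ler_pM//; exact: norm_indic.
apply: eq_Ex => w; rewrite -mulrA; congr (_ * _).
have ca : continuous (fun _ : R => 0 : R) by move=> u; exact: cvg_cst.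
have na : forall u v : R, u <= v -> (0 : R) <= 0 by [].
rewrite indicE; have [h|h] := pselect (nozero r t w).
  by rewrite mem_set// mul1r /S (first_exit_end rt).
rewrite memNset// mul0r; apply/esym.
have [St|] := ltP (S w) t; last first.
  move=> tS; have St : S w = t by apply/eqP; rewrite eq_le tS first_exit_le.
  apply/eqP; apply: contra_notT h => Dt u ru ut.
  have [uS|Su] := ltP u (S w); last first.
    by rewrite (_ : u = S w)//; apply/eqP; rewrite eq_le Su St ut.
  exact: (first_exit_free ca na rt ru uS).
apply/eqP; apply/contraT => DS.
by have := first_exit_after (@cD w) ca na rt St DS (ltr_pwDr ltr01 (lexx (S w))); rewrite ltxx.
Qed.

Lemma Ex_nozero_after r Z k : 0 <= r -> measurable_wrt (F r) Z ->
  (forall w, `|Z w| <= k) ->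
  E P (fun w => Z w * (\1_(nozero_after r) w * Dinf w)) = E P (fun w => Z w * Dinf w).
Proof.
move=> r0 FZ Zk; have mZ := sub_measurable_fun (filtration_sub hF r0) FZ.
have mD := L1_measurable Dinf1.
have mi n : measurable (nozero r (r + n%:R)) by apply: measurable_nozero => //; rewrite lerDl.
have [||||n w|_ c1] := @dct _ _ _ P
  (fun n w => Z w * (\1_(nozero r (r + n%:R)) w * Dinf w))
  (fun w => Z w * (\1_(nozero_after r) w * Dinf w)) (fun w => k * `|Dinf w|).
- move=> n; apply: measurable_funM => //; apply: measurable_funM => //.
- apply: measurable_funM => //; apply: measurable_funM => //.
  exact/measurable_indic/measurable_nozero_after.
- apply: aeW => w; apply: cvgM; first exact: cvg_cst.
  by apply: cvgMl; exact: cvg_indic_nozero.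
- exact/L1Z/L1_norm.
- rewrite normrM ler_pM// normrM ler_piMl//; exact: norm_indic.
apply: (cvg_unique _ c1) => //.
rewrite (_ : (fun n => _) = fun n => E P (fun w => Z w * Dinf w)); first exact: cvg_cst.
by apply/funext => n; apply: (Ex_nozero _ _ FZ Zk) => //; rewrite lerDl.
Qed.

Lemma sg_D_measurable r : 0 <= r -> measurable_wrt (F r) (Num.sg \o D r).
Proof. by move=> r0; apply: comp_measurable_wrt; [exact: aD|exact: measurable_sg]. Qed.

Lemma sg_le1 (z : R) : `|Num.sg z| <= 1.
Proof. by rewrite normr_sg; case: eqP. Qed.

(** Without zeros after r the sign of D is frozen, and the integral of
sg(D_r) Dinf over such an event of F_t is that of |D_t|, so nonnegative. *)
Lemma sg_Dinf r : 0 <= r -> {ae P, forall w,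
  Num.sg (D r w) * (\1_(nozero_after r) w * Dinf w) = \1_(nozero_after r) w * `|Dinf w|}.
Proof.
move=> r0; pose h w := Num.sg (D r w) * (\1_(nozero_after r) w * Dinf w).
have msg : measurable_fun setT (fun w => Num.sg (D r w)).
  exact: (sub_measurable_fun (filtration_sub hF r0) (sg_D_measurable r0)).
have mD := L1_measurable Dinf1.
have h1 : L1 P h.
  apply: (@L1M _ _ _ _ _ _ 1) => // [w|]; first exact: sg_le1.
  by apply: L1_indic => //; exact: measurable_nozero_after.
have : {ae P, forall w, 0 <= h w}.
  apply: (ae_ge0_of_filtration hF h1) => s C s0 FC.
  have mC := filtration_measurable hF s0 FC.
  have mi n : measurable (nozero r (r + n%:R)) by apply: measurable_nozero => //; rewrite lerDl.
  have [||||n w|_ c1] := @dct _ _ _ P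
    (fun n w => \1_C w * (Num.sg (D r w) * (\1_(nozero r (r + n%:R)) w * Dinf w)))
    (fun w => \1_C w * h w) (fun w => `|Dinf w|).
  - move=> n; apply: measurable_funM; first exact: measurable_indic.
    apply: measurable_funM => //; apply: measurable_funM => //.
  - apply: measurable_funM; first exact: measurable_indic.
    exact: L1_measurable h1.
  - apply: aeW => w; apply: cvgM; first exact: cvg_cst.
    apply: cvgM; first exact: cvg_cst.
    by apply: cvgMl; exact: cvg_indic_nozero.
  - exact: L1_norm.
  - rewrite !normrM !mulrA ler_piMl// !mulr_ile1 ?sg_le1 ?norm_indic//.
  apply: (cvgr_to_ge c1).
  exists (Num.truncn (s - r)).+1 => // n /= Nn.
  have rt : r <= r + n%:R by rewrite lerDl.
  have t0 := le_trans r0 rt.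
  have st : s <= r + n%:R.
    rewrite -lerBlDl (le_trans (ltW (truncnS_gt _)))// ler_nat//.
  have FCt : F (r + n%:R) C by apply: (filtration_nondecreasing hF s0 st).
  have [Dt1 Dtc] := D_closed t0.
  rewrite (_ : E P _ = E P (fun w => \1_C w * (\1_(nozero r (r + n%:R)) w * `|D (r + n%:R) w|))).
    by apply: Ex_ge0 => w; rewrite !mulr_ge0.
  transitivity (E P (fun w => (\1_C w * (Num.sg (D r w) * \1_(nozero r (r + n%:R)) w)) * Dinf w)).
    by apply: eq_Ex => w; ring.
  rewrite -(@Ex_sub_bounded _ _ _ P (F (r + n%:R)) (filtration_sigma hF t0)
    (filtration_sub hF t0) (D (r + n%:R)) Dinf _ 1 Dt1 Dinf1 Dtc); last 2 first.
  - apply: mul_measurable_wrt => //; first exact: indic_measurable_wrt.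
    apply: mul_measurable_wrt => //; last by apply: indic_measurable_wrt => //; exact: F_nozero.
    exact: measurable_wrt_mono (sg_D_measurable r0).
  - move=> w; rewrite !normrM mulr_ile1 ?norm_indic//.
    by rewrite mulr_ile1 ?norm_indic ?sg_le1.
  apply: eq_Ex => w; rewrite -!mulrA; congr (_ * _).
  rewrite indicE; have [hz|hz] := pselect (nozero r (r + n%:R) w).
    by rewrite mem_set// !mul1r -(zero_free_sg (@cD w) rt hz) -normrEsg.
  by rewrite memNset// !mul0r mulr0.
apply: filterS => w hw; rewrite -[LHS](ger0_norm hw) /h !normrM.
rewrite indicE; have [hz|hz] := pselect (nozero_after r w); last first.
  by rewrite memNset// normr0 !mul0r mulr0.
by rewrite mem_set// normr1 !mul1r normr_sg (hz r (lexx r)) mul1r.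
Qed.

Lemma Ex_abs_D r C : 0 <= r -> F r C ->
  E P (fun w => \1_C w * `|D r w|) =
  E P (fun w => \1_C w * (\1_(nozero_after r) w * `|Dinf w|)).
Proof.
move=> r0 FC; have mC := filtration_measurable hF r0 FC.
have [D1 Dc] := D_closed r0; have mD := L1_measurable Dinf1.
have FZ : measurable_wrt (F r) (fun w => \1_C w * Num.sg (D r w)).
  by apply: mul_measurable_wrt => //; [exact: indic_measurable_wrt|exact: sg_D_measurable].
have Z1 w : `|\1_C w * Num.sg (D r w)| <= 1.
  by rewrite normrM mulr_ile1 ?norm_indic ?sg_le1.
transitivity (E P (fun w => (\1_C w * Num.sg (D r w)) * D r w)).
  by apply: eq_Ex => w; rewrite -mulrA -normrEsg.
rewrite (Ex_sub_bounded (filtration_sigma hF r0) (filtration_sub hF r0) D1 Dinf1 Dc FZ Z1).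
rewrite -(Ex_nozero_after r0 FZ Z1).
have mz := measurable_nozero_after r0.
have mZ := sub_measurable_fun (filtration_sub hF r0) FZ.
apply: Ex_ae.
- by apply: measurable_funM => //; apply: measurable_funM => //; exact: measurable_indic.
- apply: measurable_funM; first exact: measurable_indic.
  apply: measurable_funM; first exact: measurable_indic.
  exact: measurableT_comp.
by apply: filterS (sg_Dinf r0) => w; rewrite -mulrA => ->.
Qed.

(** |D| killed at its first zero after r.  Up to a constant this is the density on
F_t of P' restricted to [nozero_after r]. *)
Definition killed r t w := \1_(nozero r t) w * `|D t w|.
Definition killed_infty r w := \1_(nozero_after r) w * `|Dinf w|.

Lemma killed_infty_L1 r : 0 <= r -> L1 P (killed_infty r).
Proof. by move=> r0; apply: L1_indic; [exact: measurable_nozero_after|exact: L1_norm]. Qed.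

Lemma killed_closed r N : 0 <= r -> closed_by P F r N (killed r) (killed_infty r).
Proof.
move=> r0 u ru _; have u0 := le_trans r0 ru; split.
  by apply: L1_indic; [exact: measurable_nozero|exact/L1_norm/(D_closed u0).1].
move=> C FC; have Fs := filtration_sigma hF u0.
have indicM (B B' : set T) w : \1_B w * \1_B' w = \1_(B `&` B') w :> R.
  by rewrite indicI.
transitivity (E P (fun w => \1_(C `&` nozero r u) w * `|D u w|)).
  by apply: eq_Ex => w; rewrite /killed mulrA indicM.
rewrite Ex_abs_D//; last by apply: (sigma_setI Fs) => //; exact: F_nozero.
apply: eq_Ex => w; rewrite /killed_infty !mulrA !indicM; congr (_ * _).
congr (\1_ _ w); rewrite -setIA; congr (_ `&` _).
apply/seteqP; split => v /=.
  move=> [h1 h2] s rs; have [su|us] := leP s u; first exact: h1.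
  exact/h2/ltW.
move=> h; split=> [s rs _|s us]; first exact: h.
by apply: h; exact: le_trans us.
Qed.

Lemma killed_adapted r : 0 <= r -> adapted_from F r (killed r).
Proof.
move=> r0 u ru; have u0 := le_trans r0 ru.
apply: mul_measurable_wrt => //; first by apply: indic_measurable_wrt => //; exact: F_nozero.
by apply: (comp_measurable_wrt (aD u0)); exact: normr_measurable.
Qed.

Lemma killed_right_continuous r w : right_continuous ((killed r) ^~ w) r.
Proof.
move=> u ru; rewrite /killed.
have cDu : `|D x w| @[x --> u^'+] --> `|D u w|.
  by apply: cvg_norm; exact: D_right_continuous.
have [h|h] := pselect (nozero r u w); last first.
  rewrite indicE memNset// mul0r; apply: cvg_near_cst; near=> v.
  have uv : u <= v by near: v; exact: nbhs_right_ge.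
  by rewrite indicE memNset ?mul0r// => hv; apply: h; exact: zero_free_sub hv.
have Du : D u w != 0 by exact: h.
rewrite indicE mem_set// mul1r; apply: cvg_trans cDu; apply: near_eq_cvg.
have : \forall v \near u, D v w != 0 by exact: (cvgr_neq0 (D u w) (@cD w u) Du).
move=> /nbhs_ballP[e /= e0 He]; near=> v.
have ve : v < u + e by near: v; apply: nbhs_right_lt; lra.
rewrite indicE mem_set ?mul1r//; apply: (zero_free_cat h) => s us sv; apply: He.
rewrite /ball/= ltr_distlC; apply/andP; split; first by lra.
exact: le_lt_trans sv _.
Unshelve. all: by end_near. Qed.

(** By [Ex_nozero_after] the variable Dinf has mean zero on each event of F_n
intersected with the existence of a zero after n; in the limit Dinf vanishes on
the event of zeros beyond every time, which contradicts Dinf <> 0. *)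
Lemma ae_last_zero : {ae P, forall w, exists n : nat, nozero_after n%:R w}.
Proof.
pose Bad := \bigcap_n ~` nozero_after n%:R.
have mD := L1_measurable Dinf1.
have mz n : measurable (~` nozero_after n%:R).
  by apply: measurableC; exact: measurable_nozero_after.
have mBad : measurable Bad by exact: bigcapT_measurable.
have B1 := L1_indic mBad Dinf1.
have E0 s C : 0 <= s -> F s C -> E P (fun w => \1_C w * (\1_Bad w * Dinf w)) = 0.
  move=> s0 FC; have mC := filtration_measurable hF s0 FC.
  have [||||n w|_ c1] := @dct _ _ _ P
    (fun n w => \1_C w * (\1_(~` nozero_after n%:R) w * Dinf w))
    (fun w => \1_C w * (\1_Bad w * Dinf w)) (fun w => `|Dinf w|).
  - move=> n; apply: measurable_funM; first exact: measurable_indic.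
    by apply: measurable_funM => //; exact: measurable_indic.
  - apply: measurable_funM; first exact: measurable_indic.
    by apply: measurable_funM => //; exact: measurable_indic.
  - apply: aeW => w; apply: cvgM; first exact: cvg_cst.
    apply: cvgMl; apply: cvg_near_cst.
    have [hB|hB] := pselect (Bad w).
      by apply: nearW => n; rewrite !indicE !mem_set//; exact: hB.
    have [N hN] : exists N : nat, nozero_after N%:R w.
      by apply: contrapT => h; apply: hB => n _ /= hn; apply: h; exists n.
    exists N => // n /= Nn; rewrite !indicE (memNset hB) memNset//= => h; apply: h.
    by move=> u nu; apply: hN; rewrite (le_trans _ nu)// ler_nat.
  - exact: L1_norm.
  - by rewrite !normrM mulrA ler_piMl// mulr_ile1 ?norm_indic.
  apply/esym; apply: (cvg_unique _ _ c1) => //; apply: cvg_near_cst.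
  exists (Num.truncn s).+1 => // n /= Nn.
  have sn : s <= n%:R by rewrite (le_trans (ltW (truncnS_gt _)))// ler_nat.
  have n0 : (0 : R) <= n%:R by [].
  have FCn : F n%:R C by apply: (filtration_nondecreasing hF s0 sn).
  have mzn := measurable_nozero_after n0.
  have := Ex_nozero_after n0 (indic_measurable_wrt n0 FCn) (norm_indic C).
  have i1 := L1_indic mC Dinf1; have i2 := L1_indic mC (L1_indic mzn Dinf1).
  move/eqP; rewrite eq_sym -subr_eq0 -ExB// => /eqP H.
  rewrite -[RHS]H; apply: eq_Ex => w; rewrite !indicE in_setC.
  by case: (_ \in nozero_after _); rewrite /= ?mul0r ?mul1r ?mulr0 ?subrr ?subr0.
have H1 : {ae P, forall w, 0 <= \1_Bad w * Dinf w}.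
  by apply: (ae_ge0_of_filtration hF B1) => s C s0 FC; rewrite (E0 s C s0 FC).
have H2 : {ae P, forall w, 0 <= - (\1_Bad w * Dinf w)}.
  apply: (ae_ge0_of_filtration hF (L1N B1)) => s C s0 FC.
  have mC := filtration_measurable hF s0 FC.
  have -> : E P (fun w => \1_C w * - (\1_Bad w * Dinf w)) =
      -1 * E P (fun w => \1_C w * (\1_Bad w * Dinf w)).
    rewrite -ExZ; last exact: L1_indic.
    by apply: eq_Ex => w; rewrite mulN1r mulrN.
  by rewrite (E0 s C s0 FC) mulr0.
have H3 : {ae P, forall w, Dinf w != 0}.
  exists [set w | Dinf w = 0]; split => //.
    by have := mD measurableT [set 0] (measurable_set1 0); rewrite setTI.
  by move=> w /= /negP; rewrite negbK => /eqP.
near=> w.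
have h1 : 0 <= \1_Bad w * Dinf w by near: w.
have h2 : 0 <= - (\1_Bad w * Dinf w) by near: w.
have h3 : Dinf w != 0 by near: w.
apply: contrapT => h.
have hB : Bad w by move=> n _ /= hn; apply: h; exists n.
move: h1 h2; rewrite indicE mem_set// mul1r oppr_ge0 => h1 h2.
by move: h3; rewrite eq_le h1 h2.
Unshelve. all: by end_near. Qed.

End signed_density.

(** * The balayage martingale of a process of class Sigma *)

Section stopped_paths.
Context {R : realType}.

Definition stop_at (tau : \bar R) (u : R) : R := fine (Order.min u%:E tau).

Lemma stop_at_lt tau u : (u%:E <= tau)%E -> stop_at tau u = u.
Proof. by move=> h; rewrite /stop_at min_l. Qed.

Lemma stop_at_ge tau u : (tau <= u%:E)%E -> stop_at tau u = fine tau.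
Proof. by move=> h; rewrite /stop_at min_r. Qed.

Lemma stop_at_le tau u : (0 <= tau)%E -> stop_at tau u <= u.
Proof.
move=> t0; have [h|/ltW h] := leP u%:E tau; first by rewrite stop_at_lt.
rewrite stop_at_ge// -lee_fin fineK//; case: tau t0 h => //.
Qed.

Lemma stop_at_geP tau r u : (r%:E < tau)%E -> r <= u -> r <= stop_at tau u.
Proof.
move=> rt ru; have [h|/ltW h] := leP u%:E tau; first by rewrite stop_at_lt.
rewrite stop_at_ge//; case: tau rt h => [s|//|//]; rewrite lte_fin => /ltW//.
Qed.

Lemma stop_at_ltP tau u v : (0 <= tau)%E ->
  stop_at tau u < v <-> u < v \/ (tau < v%:E)%E.
Proof.
move=> t0; have [h|h] := leP u%:E tau.
  rewrite stop_at_lt//; split => [|[//|]]; first by left.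
  by move=> tv; rewrite -lte_fin (le_lt_trans h).
rewrite (stop_at_ge (ltW h)); case: tau t0 h => [s|//|//] t0; rewrite !lte_fin /= => h.
by split => [|[|//]]; [right|move=> uv; exact: lt_trans uv].
Qed.

Lemma stop_at_right_continuous (y : R -> R) tau r : (0 <= tau)%E ->
  right_continuous y r ->
  right_continuous (y \o stop_at tau) r.
Proof.
move=> t0 ry u ru /=.
have [ut|tu] := ltP u%:E tau.
  rewrite (stop_at_lt (ltW ut)); apply: cvg_trans (ry u ru).
  apply: near_eq_cvg; case: tau t0 ut => [s|//|//] t0; last first.
    by move=> _; near=> v; rewrite stop_at_lt// leey.
  rewrite lte_fin => us; near=> v; rewrite stop_at_lt// lee_fin.
  by near: v; exact: nbhs_right_le.
rewrite (stop_at_ge tu); apply: cvg_near_cst; near=> v.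
have uv : u < v by near: v; exact: nbhs_right_gt.
by rewrite stop_at_ge// (le_trans tu)// lee_fin ltW.
Unshelve. all: by end_near. Qed.

End stopped_paths.

Section sigma_class.
Context {d : measure_display} {T : measurableType d} {R : realType}.
Variables (P P' : probability T R) (F : R -> set (set T)).
Hypothesis hF : usual_filtration P F.
Variables (D : R -> T -> R) (Dinf : T -> R) (c : R).
Hypothesis aD : forall t, 0 <= t -> measurable_wrt (F t) (D t).
Hypothesis cD : forall w, continuous (D ^~ w).
Hypothesis Dinf1 : L1 P Dinf.
Hypothesis D_closed : forall t, 0 <= t -> L1 P (D t) /\
  forall C, F t C -> E P (fun w => \1_C w * D t w) = E P (fun w => \1_C w * Dinf w).
Hypothesis Dinf0 : P [set w | Dinf w = 0] = 0%E.
Hypothesis c0 : 0 < c.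
Hypothesis P'E : forall B, measurable B ->
  P' B = (\int[P]_(w in B) (`|Dinf w| / c)%:E)%E.

Variables (X A : R -> T -> R) (tau : nat -> T -> \bar R).
Hypothesis aX : forall t, 0 <= t -> measurable_wrt (F t) (X t).
Hypothesis rX : forall w r, right_continuous (X ^~ w) r.
Hypothesis X0 : forall t w, 0 <= X t w.
Hypothesis aA : forall t, 0 <= t -> measurable_wrt (F t) (A t).
Hypothesis cA : forall w, continuous (A ^~ w).
Hypothesis ndA : forall w u v, u <= v -> A u w <= A v w.
Hypothesis A0 : forall t w, 0 <= A t w.
Hypothesis carried : forall w u v, 0 <= u -> u < v -> A u w < A v w ->
  exists s, [/\ u < s, s <= v & X s w = 0 \/ D s w = 0].
Hypothesis tau_stop : forall n, stopping_time F (tau n).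
Hypothesis tau_cvg : forall w t, \forall n \near \oo, (t%:E < tau n w)%E.
Let L t w := (X t w - A t w) * D t w.
Hypothesis L_mart : forall n, martingale P F (fun t w => L (stop_at (tau n w) t) w).
Hypothesis X_L1 : forall N S, optional_time F 0 N S -> L1 P' (fun w => X (S w) w).
Hypothesis X_UI : forall e, 0 < e -> exists k, forall N S, optional_time F 0 N S ->
  E P' (fun w => Num.max 0 (X (S w) w - k)) <= e.

Local Notation rho := (fun w => `|Dinf w| / c).
Local Notation z r := (nozero_after D r).

Let rho1 : L1 P rho.
Proof.
rewrite (_ : (fun w => _) = fun w => c^-1 * `|Dinf w|); first exact/L1Z/L1_norm.
by apply/funext => w; rewrite mulrC.
Qed.

Let rho0 w : 0 <= rho w. Proof. by rewrite divr_ge0// ltW. Qed.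

Let mz r : 0 <= r -> measurable (z r).
Proof. exact: (measurable_nozero_after hF aD cD). Qed.

Lemma Ex_killed_infty r (f : T -> R) : 0 <= r -> L1 P' f ->
  L1 P (fun w => f w * killed_infty D Dinf r w) /\
  E P (fun w => f w * killed_infty D Dinf r w) = c * E P' (fun w => \1_(z r) w * f w).
Proof.
move=> r0 f1; have mf := L1_measurable f1.
have i1 := L1_indic (mz r0) f1.
have i2 : L1 P (fun w => \1_(z r) w * f w * rho w).
  by apply/(L1_density rho1 rho0 P'E) => //; exact: L1_measurable i1.
have e w : f w * killed_infty D Dinf r w = c * (\1_(z r) w * f w * rho w).
  by rewrite /killed_infty; field; exact: lt0r_neq0.
have -> : (fun w => f w * killed_infty D Dinf r w) =
    fun w => c * (\1_(z r) w * f w * rho w) by apply/funext.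
split; first exact: L1Z.
by rewrite ExZ// (Ex_density rho1 rho0 P'E i1).
Qed.

Lemma optional_from0 r N S : 0 <= r -> optional_time F r N S -> optional_time F 0 N S.
Proof. by move=> r0 [h1 h2 h3]; split => // w; exact: le_trans (h1 w). Qed.

Section conversion.
Variables (r N : R) (S : T -> R) (C : set T) (V : R -> T -> R).
Hypotheses (r0 : 0 <= r) (hS : optional_time F r N S) (FC : F r C).
Hypothesis aV : adapted_from F r V.
Hypothesis rV : forall w, right_continuous (V ^~ w) r.
Hypothesis V0 : forall u w, 0 <= V u w.
Hypothesis V1 : L1 P' (fun w => V (S w) w).

(** Under P' restricted to [z r], the density at the optional time S is [killed].
Sampling needs bounded weights, so V is truncated and the levels increased. *)
Lemma Ex_killed_optional :
  L1 P (fun w => \1_C w * V (S w) w * killed D r (S w) w) /\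
  E P (fun w => \1_C w * V (S w) w * killed D r (S w) w) =
  c * E P' (fun w => \1_(z r) w * (\1_C w * V (S w) w)).
Proof.
have mC := filtration_measurable hF r0 FC.
have aDn := killed_adapted hF aD cD r0.
have rDn w := killed_right_continuous cD (r := r) (w := w).
have cDn : closed_by P F r (N + 1) (killed D r) (killed_infty D Dinf r).
  exact: killed_closed.
have dn1 := killed_infty_L1 hF aD cD Dinf1 r0.
(* the truncated weights, bounded by k, as sampling requires *)
pose Vk k u w := \1_C w * Num.min (V u w) k%:R.
have aVk k : adapted_from F r (Vk k).
  move=> u ru; have u0 := le_trans r0 ru.
  apply: (mul_measurable_wrt hF u0).
    apply: (indic_measurable_wrt hF u0).
    exact: (filtration_nondecreasing hF r0 ru).
  apply: (comp_measurable_wrt (aV ru) (phi := fun y => Num.min y k%:R)).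
  by apply: measurable_minr => //; exact: measurable_cst.
have rVk k w : right_continuous ((Vk k) ^~ w) r.
  move=> u ru; apply: cvgM; first exact: cvg_cst.
  by apply: cvg_minr; [exact: rV|exact: cvg_cst].
have Vkb k u w : `|Vk k u w| <= k%:R.
  rewrite normrM -[leRHS]mul1r ler_pM ?norm_indic//.
  by rewrite ger0_norm ?ge_min ?lexx ?orbT// le_min V0 ler0n.
have Vkle k u w : `|Vk k u w| <= V u w.
  rewrite normrM -[leRHS]mul1r ler_pM ?norm_indic//.
  by rewrite ger0_norm ?ge_min ?lexx ?orbT// le_min V0 ler0n.
have Vk0 k u w : 0 <= Vk k u w.
  by rewrite mulr_ge0 ?indicE ?ler0n// le_min V0 ler0n.
have mVk k := value_measurable hF r0 hS (aVk k) (rVk k).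
have mdn := value_measurable hF r0 hS aDn rDn.
have mV := value_measurable hF r0 hS aV rV.
have dnS1 := optional_L1 hF r0 hS dn1 aDn rDn cDn.
have OS k := optional_sampling hF r0 hS dn1 aDn rDn cDn (aVk k) (rVk k)
  (fun u w _ => Vkb k u w).
have VE k : E P (fun w => Vk k (S w) w * killed_infty D Dinf r w) =
    c * E P' (fun w => \1_(z r) w * Vk k (S w) w).
  have b1 : L1 P' (fun w => Vk k (S w) w) by exact: (L1_bounded _ (mVk k) (fun w => Vkb k (S w) w)).
  exact: (Ex_killed_infty r0 b1).2.
have limVk w : Vk k (S w) w @[k --> \oo] --> \1_C w * V (S w) w.
  apply: cvgM; first exact: cvg_cst.
  apply: cvg_near_cst; exists (Num.truncn (V (S w) w)).+1 => // n /= gn.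
  by rewrite min_l// ltW// (lt_le_trans (truncnS_gt _))// ler_nat.
have [||||k w|_ c1] := @dct _ _ _ P' (fun k w => \1_(z r) w * Vk k (S w) w)
  (fun w => \1_(z r) w * (\1_C w * V (S w) w)) (fun w => V (S w) w).
- by move=> k; apply: measurable_funM => //; exact/measurable_indic/mz.
- apply: measurable_funM; first exact/measurable_indic/mz.
  by apply: measurable_funM => //; exact: measurable_indic.
- by apply: aeW => w; apply: cvgM; [exact: cvg_cst|exact: limVk].
- exact: V1.
- by rewrite normrM (le_trans _ (Vkle k (S w) w))// ler_piMl// norm_indic.
have le k : E P (fun w => Vk k (S w) w * killed D r (S w) w) <=
    c * E P' (fun w => V (S w) w).
  rewrite OS VE ler_pM2l//; apply: Ex_le => //.
    by apply: L1_indic; [exact: mz|exact: (L1_bounded _ (mVk k) (fun w => Vkb k (S w) w))].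
  move=> w; rewrite (le_trans _ (Vkle k (S w) w))// ger0_norm ?Vk0//.
  by rewrite ler_piMl// indicE lern1 leq_b1.
have dn0 u w : 0 <= killed D r u w by rewrite mulr_ge0 ?indicE ?ler0n.
have [||||w|f1 _] := @fatou_real _ _ _ P
  (fun k w => Vk k (S w) w * killed D r (S w) w)
  (fun w => \1_C w * V (S w) w * killed D r (S w) w) _ _ _ _ _ _ le.
- by move=> k; exact: (L1M (mVk k) (fun w => Vkb k (S w) w) dnS1).
- apply: measurable_funM => //; apply: measurable_funM => //.
- by move=> k w; rewrite mulr_ge0.
- by apply: aeW => w; apply: cvgMl; exact: limVk.
- by rewrite !mulr_ge0// indicE ler0n.
split => //.
have [||||k w|_ c2] := @dct _ _ _ P
  (fun k w => Vk k (S w) w * killed D r (S w) w)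
  (fun w => \1_C w * V (S w) w * killed D r (S w) w)
  (fun w => \1_C w * V (S w) w * killed D r (S w) w).
- by move=> k; exact: measurable_funM.
- exact: L1_measurable f1.
- by apply: aeW => w; apply: cvgMl; exact: limVk.
- exact: f1.
- rewrite ger0_norm; last exact: mulr_ge0.
  apply: ler_wpM2r => //; apply: ler_wpM2l; first by rewrite indicE ler0n.
  by rewrite ge_min lexx.
apply: (cvg_unique _ c2) => //.
rewrite (_ : (fun k => _) = fun k => c * E P' (fun w => \1_(z r) w * Vk k (S w) w)).
  by apply: cvgM; [exact: cvg_cst|exact: c1].
by apply/funext => k; rewrite OS VE.
Qed.

End conversion.

(** X f(A) - (integral of f over [0, A]) for f the indicator of [0, x]: the
value is X - A until A exceeds x, and -x afterwards. *)
Definition balayage x t w := if A t w <= x then X t w - A t w else - x.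

Lemma stopping_lt n u : 0 <= u -> F u [set w | (tau n w < u%:E)%E].
Proof.
move=> u0; have Fs := filtration_sigma hF u0.
have [t0 tF] := tau_stop n.
rewrite (_ : [set w | _] = \bigcup_k
    (if k.+1%:R^-1 <= u then [set w | (tau n w <= (u - k.+1%:R^-1)%:E)%E] else set0)).
  apply: (sigma_bigcup Fs) => k; case: ifPn => h; last by case: Fs.
  have v0 : 0 <= u - k.+1%:R^-1 by rewrite subr_ge0.
  apply: (filtration_nondecreasing hF v0) (tF _ v0).
  by rewrite gerBl.
apply/seteqP; split => w /=; last first.
  move=> [k _]; case: ifP => // h /= /le_lt_trans; apply.
  by rewrite lte_fin ltrBlDr ltrDl.
have := t0 w; case tw : (tau n w) => [s|//|//]; rewrite lee_fin lte_fin => s0 su.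
have us : 0 < u - s by rewrite subr_gt0.
have h : (Num.truncn (u - s)^-1).+1%:R^-1 <= u - s.
  by rewrite invf_ple ?posrE// ltW// truncnS_gt.
exists (Num.truncn (u - s)^-1) => //; move: h; set q := _^-1 => h.
rewrite ifT /= ?tw ?lee_fin; last by rewrite (le_trans h)// gerBl.
by rewrite lerBrDr addrC -lerBrDr.
Qed.

Section martingale_K.
Variables (r t x : R) (C : set T).
Hypotheses (r0 : 0 <= r) (rt : r <= t) (x0 : 0 <= x) (FC : F r C).
Hypothesis CA : forall w, C w -> A r w <= x.

Let S0 w := first_exit (D ^~ w) (A ^~ w) x r t.
Let Cn n := C `&` [set w | (r%:E < tau n w)%E].
Let Sn n w := if (r%:E < tau n w)%E then stop_at (tau n w) (S0 w) else r.

Let t0 : 0 <= t. Proof. exact: le_trans rt. Qed.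

Let S0_optional : optional_time F r t S0.
Proof. exact: (optional_first_exit hF aD cD x aA cA ndA r0 rt). Qed.

Let F_Cn n : F r (Cn n).
Proof.
have Fs := filtration_sigma hF r0.
apply: (sigma_setI Fs) => //.
rewrite (_ : [set w | _] = ~` [set w | (tau n w <= r%:E)%E]).
  by apply: (sigma_setC Fs); exact: (tau_stop n).2.
by apply/seteqP; split => w /=; [move=> h; apply/negP; rewrite -ltNge|move/negP; rewrite -ltNge].
Qed.

Let Sn_optional n : optional_time F r t (Sn n).
Proof.
have [tau0 _] := tau_stop n; have [Sr St Sl] := S0_optional.
split.
- by move=> w; rewrite /Sn; case: ifPn => // h; exact: stop_at_geP.
- move=> w; rewrite /Sn; case: ifPn => // h; apply: le_trans (St w).
  exact: stop_at_le.
move=> u u0; have Fs := filtration_sigma hF u0.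
have [ur|ru] := leP u r.
  rewrite (_ : [set w | _] = set0); first by case: Fs.
  apply/seteqP; split => // w /=; rewrite ltNge (le_trans ur)// /Sn.
  by case: ifPn => // h; exact: stop_at_geP.
rewrite (_ : [set w | _] = [set w | S0 w < u] `|` [set w | (tau n w < u%:E)%E]).
  by apply: (sigma_setU Fs); [exact: Sl|exact: stopping_lt].
apply/seteqP; split => w /=; rewrite /Sn; case: ifPn => h.
- by move/(stop_at_ltP _ _ (tau0 w)).
- by move=> _; right; rewrite -leNgt in h; rewrite (le_lt_trans h).
- by move=> h2; apply/(stop_at_ltP _ _ (tau0 w)).
- by move=> _.
Qed.

Let killed_signed w s : r <= s -> s <= S0 w ->
  Num.sg (D r w) * D s w = killed D r s w.
Proof.
move=> rs sS; rewrite /killed indicE.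
have [h|h] := pselect (nozero D r s w).
  by rewrite mem_set// mul1r -(zero_free_sg (@cD w) rs h) -normrEsg.
rewrite memNset// mul0r.
suff -> : D s w = 0 by rewrite mulr0.
apply/eqP; apply: contra_notT h => Ds u ru us.
have [us'|su] := ltP u s; last by rewrite (_ : u = s)//; apply/eqP; rewrite eq_le us.
exact: (first_exit_free (@cA w) (@ndA w) rt ru (lt_le_trans us' sS)).
Qed.

Let L_right_continuous w s : right_continuous (L ^~ w) s.
Proof.
move=> u su; apply: cvgM; last by apply: cvg_within_filter; exact: cD.
by apply: cvgB; [exact: (rX su)|apply: cvg_within_filter; exact: cA].
Qed.

(** Optional sampling of the stopped local martingale at the exit time.  Up to this
time the sign of D is that of D_r, which turns D into its killed absolute value. *)
Let localized_sampling n :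
  E P (fun w => \1_(Cn n) w * (killed D r (Sn n w) w * (X (Sn n w) w - A (Sn n w) w))) =
  E P (fun w => \1_(Cn n) w * (killed D r r w * (X r w - A r w))).
Proof.
have [aY Y1 YE] := L_mart n; have [tau0 _] := tau_stop n.
pose Y u w := L (stop_at (tau n w) u) w.
have t10 : 0 <= t + 1 by rewrite addr_ge0.
have rt1 : r <= t + 1 by rewrite (le_trans rt)// lerDl.
have cY : closed_by P F r (t + 1) Y (Y (t + 1)).
  move=> u ru ut; have u0 := le_trans r0 ru; split; first exact: Y1.
  move=> B FB; have mB := filtration_measurable hF u0 FB.
  by rewrite !Ex_indic//; congr fine; apply/esym; exact: YE.
have rY w : right_continuous (Y ^~ w) r.
  exact: (stop_at_right_continuous (tau0 w) (@L_right_continuous w r)).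
have aYr : adapted_from F r Y by move=> u ru; apply: aY; exact: le_trans ru.
pose Z w := \1_(Cn n) w * Num.sg (D r w).
have FZ : measurable_wrt (F r) Z.
  apply: (mul_measurable_wrt hF r0); first exact: (indic_measurable_wrt hF r0).
  exact: sg_D_measurable.
have Z1 w : `|Z w| <= 1 by rewrite normrM mulr_ile1 ?norm_indic ?sg_le1.
have aZ : adapted_from F r (fun _ : R => Z).
  by move=> u ru; exact: (measurable_wrt_mono hF r0 ru).
have rZ w : right_continuous ((fun _ : R => Z) ^~ w) r.
  by move=> u _; exact: cvg_cst.
have Yt1 := Y1 _ t10.
have OS := optional_sampling hF r0 S0_optional Yt1 aYr rY cY aZ rZ (fun _ w _ => Z1 w).
have [Yr1 Yrc] := cY r (lexx r) rt1.
have OS' := Ex_sub_bounded (filtration_sigma hF r0) (filtration_sub hF r0) Yr1 Yt1 Yrc FZ Z1.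
transitivity (E P (fun w => Z w * Y (S0 w) w)).
  apply: eq_Ex => w; rewrite /Z -mulrA indicE.
  have [[Cw h]|h] := pselect (Cn n w); last by rewrite memNset// !mul0r.
  have -> : Sn n w = stop_at (tau n w) (S0 w) by rewrite /Sn h.
  rewrite mem_set// !mul1r /Y /L -killed_signed; first by ring.
    by apply: stop_at_geP => //; exact: first_exit_ge.
  exact: stop_at_le.
rewrite OS -OS'; apply: eq_Ex => w; rewrite /Z -mulrA indicE.
have [[Cw h]|h] := pselect (Cn n w); last by rewrite memNset// !mul0r.
rewrite mem_set// !mul1r /Y stop_at_lt ?(ltW h)// /L.
rewrite -(killed_signed (lexx r)); last exact: first_exit_ge.
by ring.
Qed.

Let minA u w := Num.min (A u w) x.

Let minA_adapted : adapted_from F r minA.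
Proof.
move=> u ru; have u0 := le_trans r0 ru.
apply: (comp_measurable_wrt (aA u0) (phi := fun y => Num.min y x)).
by apply: measurable_minr => //; exact: measurable_cst.
Qed.

Let minA_rc w : right_continuous (minA ^~ w) r.
Proof.
move=> u ru; apply: cvg_minr; last exact: cvg_cst.
by apply: cvg_within_filter; exact: cA.
Qed.

Let minA0 u w : 0 <= minA u w. Proof. by rewrite le_min A0. Qed.

Let minA_le u w : `|minA u w| <= x.
Proof. by rewrite ger0_norm// ge_min lexx orbT. Qed.

Let X_adapted : adapted_from F r X.
Proof. by move=> u ru; apply: aX; exact: le_trans ru. Qed.

Let C_bound w u : C w -> u <= S0 w -> A u w <= x.
Proof.
move=> Cw uS; apply: (le_trans (ndA w uS)).
exact: (first_exit_bound (D ^~ w) (@cA w) (@ndA w) rt (CA Cw)).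
Qed.

(** Means under P' of X and of min(A, x) at S, on the localized event. *)
Let side S (f : R -> T -> R) n := E P' (fun w => \1_(z r) w * (\1_(Cn n) w * f (S w) w)).

Let sideE S n : optional_time F r t S ->
  (forall w, C w -> S w <= S0 w) ->
  E P (fun w => \1_(Cn n) w * (killed D r (S w) w * (X (S w) w - A (S w) w))) =
  c * (side S X n - side S minA n).
Proof.
move=> hS SS0; have hS' := optional_from0 r0 hS.
have mA1 : L1 P' (fun w => minA (S w) w).
  apply: (L1_bounded _ _ (fun w => minA_le (S w) w)).
  exact: (value_measurable hF r0 hS minA_adapted minA_rc).
have [x1 xE] := Ex_killed_optional r0 hS (F_Cn n) X_adapted (fun w => @rX w r) X0 (X_L1 hS').
have [a1 aE] := Ex_killed_optional r0 hS (F_Cn n) minA_adapted minA_rc minA0 mA1.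
rewrite mulrBr -xE -aE -ExB//; apply: eq_Ex => w.
rewrite !indicE; have [h|h] := pselect (Cn n w); last by rewrite memNset// !mul0r subr0.
rewrite mem_set// /minA min_l; first by ring.
by apply: C_bound; [case: h|apply: SS0; case: h].
Qed.

Let cst_optional : optional_time F r t (fun=> r).
Proof.
split => // u u0; have Fs := filtration_sigma hF u0.
have [ru|ur] := ltP r u.
  rewrite (_ : [set w | _] = setT); first exact: sigma_setT.
  by apply/seteqP; split.
rewrite (_ : [set w | _] = set0); first by case: Fs.
by apply/seteqP; split => // w _.
Qed.

Let side_eq n : side (Sn n) X n - side (Sn n) minA n =
  side (fun=> r) X n - side (fun=> r) minA n.
Proof.
have h1 w : C w -> Sn n w <= S0 w.
  move=> _; rewrite /Sn; case: ifPn => h; last exact: first_exit_ge.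
  by apply: stop_at_le; case: (tau_stop n).
have h2 w : C w -> r <= S0 w by move=> _; exact: first_exit_ge.
apply: (@mulfI _ c); first by rewrite gt_eqF.
rewrite -(sideE n (Sn_optional n) h1) -(sideE n cst_optional h2).
exact: localized_sampling.
Qed.

Let eventually_C w : \forall n \near \oo, \1_(Cn n) w = \1_C w :> R.
Proof.
near=> n; rewrite /Cn indicI /= [X in _ * X]indicE mem_set ?mulr1//=.
by near: n; exact: tau_cvg.
Unshelve. all: by end_near. Qed.

Let eventually_S w : \forall n \near \oo, Sn n w = S0 w.
Proof.
near=> n; have h : (t%:E < tau n w)%E by near: n; exact: tau_cvg.
rewrite /Sn ifT; last by rewrite (le_lt_trans _ h)// lee_fin.
by rewrite stop_at_lt// (le_trans _ (ltW h))// lee_fin first_exit_le.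
Unshelve. all: by end_near. Qed.

Let eventually_side S0' S' (f : R -> T -> R) w :
  (\forall n \near \oo, S' n w = S0' w :> R) ->
  \1_(z r) w * (\1_(Cn n) w * f (S' n w) w) @[n --> \oo] -->
  \1_(z r) w * (\1_C w * f (S0' w) w).
Proof.
move=> hS; apply: cvg_near_cst; near=> n.
have -> : \1_(Cn n) w = \1_C w :> R by near: n; exact: eventually_C.
by have -> : S' n w = S0' w by near: n.
Unshelve. all: by end_near. Qed.

(** Removing the localization: X is uniformly integrable along optional times, and
min(A, x) is bounded. *)
Let limit_side S S' :
  (forall n, optional_time F r t (S' n)) -> optional_time F r t S ->
  (forall w, \forall n \near \oo, S' n w = S w) ->
  (fun n => side (S' n) X n - side (S' n) minA n) @ \oo -->
  E P' (fun w => \1_(z r) w * (\1_C w * X (S w) w)) -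
  E P' (fun w => \1_(z r) w * (\1_C w * minA (S w) w)).
Proof.
move=> hS' hS ev; have mC := filtration_measurable hF r0 FC.
have mCn n := filtration_measurable hF r0 (F_Cn n).
apply: cvgB.
  have mX S0' : optional_time F r t S0' -> measurable_fun setT (fun w => X (S0' w) w).
    by move=> hS0; exact: (value_measurable hF r0 hS0 X_adapted (fun w => @rX w r)).
  have [||||||||_ //] := @vitali_dominated _ _ _ P'
    (fun n w => \1_(z r) w * (\1_(Cn n) w * X (S' n w) w)) (fun n w => X (S' n w) w)
    (fun w => \1_(z r) w * (\1_C w * X (S w) w)).
  - by move=> n w; case/andP: (indic2_mul_bounds (z r) (Cn n) w (X0 (S' n w) w)).
  - by move=> n w; case/andP: (indic2_mul_bounds (z r) (Cn n) w (X0 (S' n w) w)).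
  - move=> n; apply: measurable_funM; first exact/measurable_indic/mz.
    by apply: measurable_funM; [exact: measurable_indic|exact: mX].
  - by move=> n; exact: X_L1 (optional_from0 r0 (hS' n)).
  - apply: measurable_funM; first exact/measurable_indic/mz.
    by apply: measurable_funM; [exact: measurable_indic|exact: mX].
  - by move=> w; case/andP: (indic2_mul_bounds (z r) C w (X0 (S w) w)).
  - by apply: aeW => w; exact: (@eventually_side S S' X w (ev w)).
  - by move=> e /X_UI[k Hk]; exists k => n; exact: Hk (optional_from0 r0 (hS' n)).
have [||||n w|//] := @dct _ _ _ P'
  (fun n w => \1_(z r) w * (\1_(Cn n) w * minA (S' n w) w))
  (fun w => \1_(z r) w * (\1_C w * minA (S w) w)) (fun=> x).
- move=> n; apply: measurable_funM; first exact/measurable_indic/mz.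
  apply: measurable_funM; first exact: measurable_indic.
  exact: (value_measurable hF r0 (hS' n) minA_adapted minA_rc).
- apply: measurable_funM; first exact/measurable_indic/mz.
  apply: measurable_funM; first exact: measurable_indic.
  exact: (value_measurable hF r0 hS minA_adapted minA_rc).
- by apply: aeW => w; exact: (@eventually_side S S' minA w (ev w)).
- exact: L1_cst.
- rewrite !normrM mulrA (le_trans _ (minA_le (S' n w) w))// ler_piMl//.
  by rewrite mulr_ile1 ?norm_indic.
Qed.

(** If A exceeds x by time t it increases immediately after the exit time, so that
zeros of X accumulate there from the right, and X vanishes at the exit time. *)
Let X_exit w : z r w -> C w -> X (S0 w) w = (if A t w <= x then X t w else 0).
Proof.
move=> zw Cw; have zt : nozero D r t w by move=> u ru _; exact: zw.
case: ifPn => [At|]; first by rewrite /S0 (first_exit_end rt).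
rewrite -ltNge => xA.
have rS : r <= S0 w by exact: first_exit_ge.
have AS : A (S0 w) w <= x by exact: C_bound.
have St : S0 w < t.
  rewrite lt_neqAle first_exit_le// andbT; apply/eqP => St.
  by rewrite -St ltNge AS in xA.
apply/eqP; apply: contraT => XS.
have : \forall u \near (S0 w)^'+, X u w != 0.
  exact: (cvgr_neq0 (X (S0 w) w) (@rX w r (S0 w) rS) XS).
move=> /nbhs_ballP[e/= e0 He].
have nX : \forall v \near (S0 w)^'+, forall s, S0 w < s -> s <= v -> X s w != 0.
  near=> v => s Ss sv.
  have ve : v < S0 w + e by near: v; apply: nbhs_right_lt; lra.
  apply: He => //; rewrite /ball/= ltr_distlC; apply/andP; split; first by lra.
  exact: le_lt_trans sv _.
near (S0 w)^'+ => v.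
have Sv : S0 w < v by near: v; exact: nbhs_right_gt.
have xv : x < A v w.
  exact: (first_exit_after (@cD w) (@cA w) (@ndA w) rt St (zw _ rS) Sv).
have [s [Ss sv]] := carried (le_trans r0 rS) Sv (le_lt_trans AS xv).
have Xs : X s w != 0.
  by have := near nX v; apply.
case=> h; first by rewrite h eqxx in Xs.
by have := zw s (le_trans rS (ltW Ss)); rewrite h eqxx.
Unshelve. all: by end_near. Qed.

Let A_exit w : z r w -> C w -> minA (S0 w) w = minA t w.
Proof.
move=> zw Cw; have zt : nozero D r t w by move=> u ru _; exact: zw.
have [At|xA] := leP (A t w) x; first by rewrite /S0 (first_exit_end rt).
have rS : r <= S0 w by exact: first_exit_ge.
have AS : A (S0 w) w <= x by exact: C_bound.
have St : S0 w < t.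
  rewrite lt_neqAle first_exit_le// andbT; apply/eqP => St.
  by rewrite -St ltNge AS in xA.
rewrite /minA (min_r (ltW xA)) min_l//; apply/eqP; rewrite eq_le AS/=.
rewrite leNgt; apply/negP => Sx.
have nA : \forall u \near (S0 w)^'+, A u w < x.
  apply: (cvgr_lt (A (S0 w) w) _ x Sx).
  by apply: cvg_within_filter; exact: cA.
near (S0 w)^'+ => v.
have Sv : S0 w < v by near: v; exact: nbhs_right_gt.
have vx : A v w < x by near: v.
have := first_exit_after (@cD w) (@cA w) (@ndA w) rt St (zw _ rS) Sv.
by rewrite ltNge (ltW vx).
Unshelve. all: by end_near. Qed.

(** At the exit time X - min(A, x) is the balayage at time t, by [X_exit] and
[A_exit]; at r it is the balayage at r. *)
Lemma balayage_martingale : E P' (fun w => \1_(z r) w * (\1_C w * balayage x t w)) =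
  E P' (fun w => \1_(z r) w * (\1_C w * balayage x r w)).
Proof.
have mC := filtration_measurable hF r0 FC.
have hS0 := S0_optional.
have lim1 := limit_side Sn_optional hS0 eventually_S.
have ev w : \forall n \near \oo, (fun (_ : nat) (_ : T) => r) n w = r.
  exact: nearW.
have lim2 := limit_side (fun=> cst_optional) cst_optional ev.
have seqE : (fun n => side (Sn n) X n - side (Sn n) minA n) =
    (fun n => side (fun=> r) X n - side (fun=> r) minA n).
  by apply/funext => n; exact: side_eq.
rewrite seqE in lim1.
have lims := cvg_unique (@norm_hausdorff _ R^o) lim1 lim2.
have i1 S : optional_time F r t S -> L1 P' (fun w => \1_(z r) w * (\1_C w * X (S w) w)).
  move=> hS; apply: L1_indic; first exact: mz.
  apply: L1_indic => //; exact: (X_L1 (optional_from0 r0 hS)).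
have i2 S : optional_time F r t S -> L1 P' (fun w => \1_(z r) w * (\1_C w * minA (S w) w)).
  move=> hS; apply: L1_indic; first exact: mz.
  apply: L1_indic => //; apply: (L1_bounded _ _ (fun w => minA_le (S w) w)).
  exact: (value_measurable hF r0 hS minA_adapted minA_rc).
rewrite -!ExB in lims; [|exact: i1|exact: i2|exact: i1|exact: i2].
transitivity (E P' (fun w => \1_(z r) w * (\1_C w * X (S0 w) w) -
    \1_(z r) w * (\1_C w * minA (S0 w) w))).
  apply: eq_Ex => w; rewrite !indicE.
  have [zw|zw] := pselect (z r w); last by rewrite memNset// !mul0r subr0.
  have [Cw|Cw] := pselect (C w); last by rewrite [w \in C]memNset// !mul0r mulr0 subr0.
  rewrite !mem_set// !mul1r X_exit// A_exit// /balayage /minA.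
  by case: ifPn => [h|]; [rewrite min_l|rewrite -ltNge => /ltW h; rewrite min_r// sub0r].
rewrite lims; apply: eq_Ex => w; rewrite !indicE.
have [Cw|Cw] := pselect (C w); last by rewrite [w \in C]memNset// !mul0r !mulr0 subr0.
by rewrite -mulrBr [w \in C]mem_set// !mul1r /balayage /minA (CA Cw) min_l// CA.
Qed.

End martingale_K.
End sigma_class.

(** * Convergence at infinity *)

Section convergence.
Context {d : measure_display} {T : measurableType d} {R : realType}.
Variables (P mu : probability T R) (F : R -> set (set T)).
Hypothesis hF : usual_filtration P F.
(* z r stands for the absence of zeros after r, nz r s for that on [r, s] *)
Variables (X A : R -> T -> R) (z : R -> set T) (nz : R -> R -> set T).
Hypothesis aX : forall t, 0 <= t -> measurable_wrt (F t) (X t).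
Hypothesis rX : forall w r, right_continuous (X ^~ w) r.
Hypothesis X0 : forall t w, 0 <= X t w.
Hypothesis aA : forall t, 0 <= t -> measurable_wrt (F t) (A t).
Hypothesis cA : forall w, continuous (A ^~ w).
Hypothesis ndA : forall w u v, u <= v -> A u w <= A v w.
Hypothesis A0 : forall t w, 0 <= A t w.
Hypothesis X_L1 : forall t, 0 <= t -> L1 mu (X t).
Hypothesis X_UI : forall e, 0 < e -> exists k, forall t, 0 <= t ->
  E mu (fun w => Num.max 0 (X t w - k)) <= e.
Hypothesis mz : forall r, 0 <= r -> measurable (z r).
Hypothesis F_nz : forall r s, 0 <= r -> r <= s -> F s (nz r s).
Hypothesis z_split : forall r s, r <= s -> z r = nz r s `&` z s.
Hypothesis K_mart : forall r t x C, 0 <= r -> r <= t -> 0 <= x -> F r C ->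
  (forall w, C w -> A r w <= x) ->
  E mu (fun w => \1_(z r) w * (\1_C w * balayage X A x t w)) =
  E mu (fun w => \1_(z r) w * (\1_C w * balayage X A x r w)).

Local Notation K := (balayage X A).

Lemma KE x t w : K x t w = \1_[set w | A t w <= x] w * (X t w - A t w + x) - x.
Proof.
rewrite /balayage indicE; case: ifPn => h; first by rewrite mem_set//= mul1r addrK.
by rewrite memNset ?mul0r ?sub0r//; exact/negP.
Qed.

Lemma F_A_le x t : 0 <= t -> F t [set w | A t w <= x].
Proof.
move=> t0; have := aA t0 (measurable_itv `]-oo, x]).
by congr (F _ _); apply/seteqP; split => w /=; rewrite in_itv.
Qed.

Lemma F_X_le x t : 0 <= t -> F t [set w | X t w <= x].
Proof.
move=> t0; have := aX t0 (measurable_itv `]-oo, x]).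
by congr (F _ _); apply/seteqP; split => w /=; rewrite in_itv.
Qed.

Lemma K_adapted x t : 0 <= t -> measurable_wrt (F t) (K x t).
Proof.
move=> t0; have Fs := filtration_sigma hF t0.
rewrite (_ : K x t = fun w => \1_[set w | A t w <= x] w * (X t w - A t w + x) - x).
  apply/(measurable_wrtP Fs); apply: measurable_funB; last exact: measurable_cst.
  apply: measurable_funM; first exact/(measurable_wrtP Fs)/(indic_measurable_wrt hF t0)/F_A_le.
  apply: measurable_funD; last exact: measurable_cst.
  by apply: measurable_funB; apply/(measurable_wrtP Fs); [exact: aX|exact: aA].
by apply/funext => w; exact: KE.
Qed.

Lemma K_measurable x t : 0 <= t -> measurable_fun setT (K x t).
Proof. by move=> t0; exact: (sub_measurable_fun (filtration_sub hF t0) (K_adapted _ t0)). Qed.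

Lemma K_ge x t w : 0 <= x -> - x <= K x t w.
Proof.
move=> x0; rewrite /balayage; case: ifPn => // h.
by have := X0 t w; lra.
Qed.

Lemma K_le x t w : 0 <= x -> K x t w <= X t w.
Proof.
move=> x0; rewrite /balayage; case: ifPn => // h; have := X0 t w; have := A0 t w; lra.
Qed.

Lemma K_L1 x t : 0 <= x -> 0 <= t -> L1 mu (K x t).
Proof.
move=> x0 t0; apply: (@L1_le _ _ _ _ _ (fun w => X t w + x)).
- exact: K_measurable.
- move=> w; rewrite ler_norml; have := K_ge t w x0; have := K_le t w x0.
  by have := X0 t w; move=> h1 h2 h3; apply/andP; split; lra.
- by apply: L1D; [exact: X_L1|exact: L1_cst].
Qed.

Section fixed_r.
Variables (r x : R).
Hypotheses (r0 : 0 <= r) (x0 : 0 <= x).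

Let z0 s : r <= s -> 0 <= s. Proof. exact: le_trans. Qed.

Lemma indic_L1 (B : set T) (f : T -> R) : measurable B -> L1 mu f ->
  L1 mu (fun w => \1_(z r) w * (\1_B w * f w)).
Proof. by move=> mB f1; apply: L1_indic; [exact: mz|exact: L1_indic]. Qed.

(** The martingale property from a later time s: the event without zeros after r is
that without zeros after s cut by an event of F_s, and where A_s exceeds x both
sides are -x. *)
Lemma K_mart_from s t C : r <= s -> s <= t -> F s C ->
  E mu (fun w => \1_(z r) w * (\1_C w * K x t w)) =
  E mu (fun w => \1_(z r) w * (\1_C w * K x s w)).
Proof.
move=> rs st FC; have s0 := z0 rs; have t0 := le_trans s0 st.
have Fs := filtration_sigma hF s0.
(* the martingale property at s is applied on the event of F_s where A_s <= x *)
pose C1 := C `&` nz r s `&` [set w | A s w <= x].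
have FC1 : F s C1.
  apply: (sigma_setI Fs); last exact: F_A_le.
  by apply: (sigma_setI Fs) => //; exact: F_nz.
have := K_mart s0 st x0 FC1 (fun w h => h.2).
have mC := filtration_measurable hF s0 FC.
have mC1 := filtration_measurable hF s0 FC1.
have i1 u : s <= u -> L1 mu (fun w => \1_(z s) w * (\1_C1 w * K x u w)).
  move=> su; apply: L1_indic; first exact: mz.
  by apply: L1_indic => //; apply: K_L1 => //; exact: le_trans su.
have i2 u : s <= u -> L1 mu (fun w => \1_(z r) w * (\1_C w * K x u w)).
  by move=> su; apply: indic_L1 => //; apply: K_L1 => //; exact: le_trans su.
move/eqP; rewrite -subr_eq0 -ExB ?i1// => /eqP H.
apply/eqP; rewrite -subr_eq0 -ExB ?i2//; apply/eqP.
rewrite -[RHS]H; apply: eq_Ex => w; rewrite -!mulrBr.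
rewrite (z_split rs) indicI /= /C1 !indicI /=.
have [As|xA] := leP (A s w) x.
  by rewrite [X in _ = _ * (_ * X * _)]indicE mem_set// mulr1; ring.
have -> : K x s w = - x by rewrite /balayage leNgt xA.
have -> : K x t w = - x by rewrite /balayage leNgt (lt_le_trans xA)// ndA.
by rewrite subrr !mulr0.
Qed.

Lemma K_mart_bounded s t W k : r <= s -> s <= t -> measurable_wrt (F s) W ->
  (forall w, `|W w| <= k) ->
  E mu (fun w => \1_(z r) w * (W w * K x t w)) =
  E mu (fun w => \1_(z r) w * (W w * K x s w)).
Proof.
move=> rs st FW Wk; have s0 := z0 rs; have t0 := le_trans s0 st.
have iK u : s <= u -> L1 mu (fun w => \1_(z r) w * K x u w).
  by move=> su; apply: L1_indic; [exact: mz|apply: K_L1 => //; exact: le_trans su].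
have := @Ex_sub_bounded _ _ _ mu (F s) (filtration_sigma hF s0) (filtration_sub hF s0)
  (fun w => \1_(z r) w * K x t w) (fun w => \1_(z r) w * K x s w) W k
  (iK _ st) (iK _ (lexx s)) _ FW Wk.
under eq_Ex do rewrite mulrCA; under [in RHS]eq_Ex do rewrite mulrCA.
apply => C FC; have := K_mart_from rs st FC.
by under eq_Ex do rewrite mulrCA; under [in RHS]eq_Ex do rewrite mulrCA.
Qed.

(** A bounded convex function of the balayage, whose convergence is that of the
balayage except for an escape to infinity. *)
Definition recip t w := (1 + x + K x t w)^-1.

Lemma recip_den_ge1 t w : 1 <= 1 + x + K x t w.
Proof. by have := K_ge t w x0; lra. Qed.

Lemma recip_gt0 t w : 0 < recip t w.
Proof. by rewrite invr_gt0 (lt_le_trans ltr01)// recip_den_ge1. Qed.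

Lemma recip_le1 t w : recip t w <= 1.
Proof. by rewrite invf_le1 ?recip_den_ge1// (lt_le_trans ltr01)// recip_den_ge1. Qed.

Lemma recip_norm t w : `|recip t w| <= 1.
Proof. by rewrite gtr0_norm ?recip_gt0// recip_le1. Qed.

Lemma recip_adapted t : 0 <= t -> measurable_wrt (F t) (recip t).
Proof.
move=> t0; have -> : recip t = (fun y => (Num.max 1 (1 + x + y))^-1) \o K x t.
  by apply/funext => w; rewrite /recip /= max_r// recip_den_ge1.
apply: comp_measurable_wrt; first exact: K_adapted.
apply: measurable_funTS; apply: continuous_measurable_fun => y.
apply: cvgV; first by rewrite gt_eqF// lt_max ltr01.
rewrite maxr_absE; under eq_fun do rewrite maxr_absE.
have c1 : 1 + x + v @[v --> y] --> 1 + x + y.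
  by apply: cvgD; [exact: cvg_cst|exact: cvg_id].
apply: cvgMl; apply: cvgD; first by apply: cvgD c1; exact: cvg_cst.
by apply: cvg_norm; apply: cvgB c1; exact: cvg_cst.
Qed.

Lemma recip_measurable t : 0 <= t -> measurable_fun setT (recip t).
Proof. by move=> t0; exact: (sub_measurable_fun (filtration_sub hF t0) (recip_adapted t0)). Qed.

Lemma recip_L1 t : r <= t -> L1 mu (recip t).
Proof. by move=> rt; apply: (L1_bounded _ _ (recip_norm t)); exact/recip_measurable/z0. Qed.

(** The tangent at K_s to the convex function defining [recip], evaluated at K_t. *)
Definition tangent s t w := recip s w - recip s w ^+ 2 * (K x t w - K x s w).

Lemma tangent_diag s w : tangent s s w = recip s w.
Proof. by rewrite /tangent subrr mulr0 subr0. Qed.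

(** The gain over the tangent is at least the square of the increment, since
1 + x + K >= 1: this is what controls oscillations. *)
Lemma recip_tangent s t w : tangent s t w + (recip t w - recip s w) ^+ 2 <= recip t w.
Proof.
rewrite /tangent /recip; set a := K x s w; set b := K x t w.
have ha : 1 <= 1 + x + a := recip_den_ge1 s w; have hb : 1 <= 1 + x + b := recip_den_ge1 t w.
set p := 1 + x + a in ha *; set q := 1 + x + b in hb *.
have -> : b - a = q - p by rewrite /p /q; lra.
have p0 : p != 0 by rewrite gt_eqF// (lt_le_trans ltr01).
have q0 : q != 0 by rewrite gt_eqF// (lt_le_trans ltr01).
rewrite -subr_ge0.
have -> : q^-1 - (p^-1 - p^-1 ^+ 2 * (q - p) + (q^-1 - p^-1) ^+ 2) =
    (q^-1 - p^-1) ^+ 2 * (q - 1) by field; rewrite p0 q0.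
by rewrite mulr_ge0 ?sqr_ge0// subr_ge0.
Qed.

Lemma tangent_le s t w : tangent s t w <= recip t w.
Proof. by apply: le_trans (recip_tangent s t w); rewrite lerDl sqr_ge0. Qed.

Lemma tangent_L1 s t : r <= s -> r <= t -> L1 mu (tangent s t).
Proof.
move=> rs rt; apply: L1B; first exact: recip_L1.
apply: (L1M (k := 1)).
- exact/measurable_funX/recip_measurable/z0.
- by move=> w; rewrite normrX exprn_ile1// recip_norm.
- by apply: L1B; apply: K_L1 => //; exact: z0.
Qed.

(** The tangent is affine in K_t with coefficients known at time s, so its mean on
events of F_v is the same at v and at t. *)
Lemma Ex_tangent_move s v t C : r <= s -> s <= v -> v <= t -> F v C ->
  E mu (fun w => \1_(z r) w * (\1_C w * tangent s t w)) =
  E mu (fun w => \1_(z r) w * (\1_C w * tangent s v w)).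
Proof.
move=> rs sv vt FC; have rv := le_trans rs sv; have rt := le_trans rv vt.
have v0 := z0 rv; have mC := filtration_measurable hF v0 FC.
pose W w := \1_C w * (recip s w * recip s w).
have FZ := measurable_wrt_mono hF (z0 rs) sv (recip_adapted (z0 rs)).
have FW : measurable_wrt (F v) W.
  apply: (mul_measurable_wrt hF v0); first exact: (indic_measurable_wrt hF v0).
  exact: (mul_measurable_wrt hF v0).
have W1 w : `|W w| <= 1.
  by rewrite !normrM !mulr_ile1 ?norm_indic ?recip_norm// mulr_ge0.
have mW := sub_measurable_fun (filtration_sub hF v0) FW.
have KL u : r <= u -> L1 mu (fun w => \1_(z r) w * (W w * K x u w)).
  move=> ru; apply: L1_indic; first exact: mz.
  by apply: (L1M mW W1); apply: K_L1 => //; exact: z0.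
apply/eqP; rewrite -subr_eq0 -ExB; [|exact/indic_L1/tangent_L1|exact/indic_L1/tangent_L1].
rewrite (_ : E mu _ = E mu (fun w =>
    \1_(z r) w * (W w * K x v w) - \1_(z r) w * (W w * K x t w))).
  by rewrite ExB ?(K_mart_bounded rv vt FW W1) ?subrr//; exact: KL.
by apply: eq_Ex => w; rewrite /tangent /W; ring.
Qed.

Lemma Ex_recip_le s t C : r <= s -> s <= t -> F s C ->
  E mu (fun w => \1_(z r) w * (\1_C w * recip s w)) <=
  E mu (fun w => \1_(z r) w * (\1_C w * recip t w)).
Proof.
move=> rs st FC; have mC := filtration_measurable hF (z0 rs) FC.
have rt := le_trans rs st.
under [leLHS]eq_Ex do rewrite -tangent_diag.
rewrite -(Ex_tangent_move rs (lexx s) st FC); apply: Ex_le.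
- exact/indic_L1/tangent_L1.
- exact/indic_L1/recip_L1.
by move=> w; rewrite !ler_wpM2l ?indicE ?ler0n// tangent_le.
Qed.

Section maximal.
Variables (s h e : R) (n : nat).
Hypotheses (rs : r <= s) (h0 : 0 <= h) (e0 : 0 < e).

Let u i := s + i%:R * h.
Let hit i := [set w | exists2 j, (j <= i)%N & e < `|recip (u j) w - recip s w|].

Let su i : s <= u i. Proof. by rewrite lerDl mulr_ge0. Qed.
Let u0 i : 0 <= u i. Proof. exact: le_trans (z0 rs) (su i). Qed.
Let u_mono i j : (i <= j)%N -> u i <= u j.
Proof. by move=> ij; rewrite lerD2l ler_wpM2r// ler_nat. Qed.

Let far j := [set w | e < `|recip (u j) w - recip s w|].

Let F_far j : F (u j) (far j).
Proof.
have Fs := filtration_sigma hF (u0 j).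
have : measurable_wrt (F (u j)) (fun w => recip (u j) w - recip s w).
  apply/(measurable_wrtP Fs); apply: measurable_funB; apply/(measurable_wrtP Fs).
    exact: recip_adapted.
  by apply: (measurable_wrt_mono hF (z0 rs) (su j)); apply: recip_adapted; exact: z0.
move=> m; have := comp_measurable_wrt m (@normr_measurable R setT).
move=> /(_ _ (measurable_itv `]e, +oo[)).
by congr (F _ _); apply/seteqP; split => w /=; rewrite in_itv/= andbT.
Qed.

Let hitS i : hit i.+1 = hit i `|` far i.+1.
Proof.
apply/seteqP; split => w /=.
  move=> [j]; rewrite leq_eqVlt => /predU1P[-> h'|ji h']; [by right|left; by exists j].
by move=> [[j ji h']|h']; [exists j => //; exact: leq_trans ji _|exists i.+1].
Qed.

Let hit0 : hit 0 = far 0.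
Proof.
apply/seteqP; split => w /=; last by exists 0%N.
by move=> [j]; rewrite leqn0 => /eqP ->.
Qed.

Let F_hit i : F (u i) (hit i).
Proof.
elim: i => [|i IH]; first by rewrite hit0; exact: F_far.
have Fs := filtration_sigma hF (u0 i.+1).
rewrite hitS; apply: (sigma_setU Fs) => //.
exact: (filtration_nondecreasing hF (u0 i) (u_mono (leqnSn i))).
Qed.

Let tang w := tangent s (u n) w + e ^+ 2.

Let ru i : r <= u i. Proof. exact: le_trans (su i). Qed.

Let tang_L1 : L1 mu tang.
Proof. by apply: L1D; [exact: tangent_L1|exact: L1_cst]. Qed.

Let far_step i (C : set T) : (i <= n)%N -> F (u i) C -> C `<=` far i ->
  E mu (fun w => \1_(z r) w * (\1_C w * tang w)) <=
  E mu (fun w => \1_(z r) w * (\1_C w * recip (u n) w)).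
Proof.
move=> i_n FC Cf; have mC := filtration_measurable hF (u0 i) FC.
apply: (le_trans _ (Ex_recip_le (ru i) (u_mono i_n) FC)).
have tE j : E mu (fun w => \1_(z r) w * (\1_C w * (tangent s (u j) w + e ^+ 2))) =
    E mu (fun w => \1_(z r) w * (\1_C w * tangent s (u j) w)) +
    E mu (fun w => \1_(z r) w * (\1_C w * e ^+ 2)).
  rewrite -ExD; [|exact/indic_L1/tangent_L1|exact/indic_L1/L1_cst].
  by apply: eq_Ex => w; ring.
rewrite tE (Ex_tangent_move rs (su i) (u_mono i_n) FC) -tE; apply: Ex_le.
- by apply: indic_L1 => //; apply: L1D; [exact: tangent_L1|exact: L1_cst].
- exact/indic_L1/recip_L1.
move=> w; rewrite !indicE; case: (w \in z r); last by rewrite !mul0r.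
have [Cw|Cw] := pselect (C w); last by rewrite [w \in C]memNset// !mul0r mulr0.
rewrite mem_set// !mul1r; apply: le_trans (recip_tangent s (u i) w).
rewrite lerD2l -[(recip _ _ - _) ^+ 2]real_normK ?num_real//.
by rewrite lerXn2r ?nnegrE ?(ltW e0)//; exact/ltW/Cf.
Qed.

Let hit_step i : (i <= n)%N ->
  E mu (fun w => \1_(z r) w * (\1_(hit i) w * tang w)) <=
  E mu (fun w => \1_(z r) w * (\1_(hit i) w * recip (u n) w)).
Proof.
elim: i => [|i IH] i_n.
  by apply: (far_step i_n (F_hit 0)); rewrite hit0.
have Fs := filtration_sigma hF (u0 i.+1).
pose C := far i.+1 `\` hit i.
have FC : F (u i.+1) C.
  apply: (sigma_setI Fs); first exact: F_far.
  apply: (sigma_setC Fs).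
  exact: (filtration_nondecreasing hF (u0 i) (u_mono (leqnSn i)) (F_hit i)).
have mC := filtration_measurable hF (u0 _) FC.
have mH := filtration_measurable hF (u0 _) (F_hit i).
have hitE w : \1_(hit i.+1) w = \1_(hit i) w + \1_C w :> R.
  rewrite hitS !indicE in_setU in_setD.
  by case: (w \in hit i); case: (w \in far _); rewrite /= ?addr0 ?add0r.
have split_ f : L1 mu f -> E mu (fun w => \1_(z r) w * (\1_(hit i.+1) w * f w)) =
    E mu (fun w => \1_(z r) w * (\1_(hit i) w * f w)) +
    E mu (fun w => \1_(z r) w * (\1_C w * f w)).
  move=> f1; rewrite -ExD; [|exact: indic_L1|exact: indic_L1].
  by apply: eq_Ex => w; rewrite hitE; ring.
rewrite !split_//; last exact: recip_L1.
apply: lerD; first by apply: IH; exact: ltnW.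
by apply: (far_step i_n FC) => w [].
Qed.

(** At the first grid time where recip has moved by more than e since s, the gain
over the tangent at s is at least e^2.  Summing over the disjoint events of first
passage, the total gain cannot exceed that of the means. *)
Lemma maximal_inequality : e ^+ 2 * E mu (fun w => \1_(z r) w * \1_(hit n) w) <=
  E mu (fun w => \1_(z r) w * recip (u n) w) - E mu (fun w => \1_(z r) w * recip s w).
Proof.
have mH := filtration_measurable hF (u0 _) (F_hit n).
have mHC := measurableC mH.
have i1 := hit_step (leqnn n).
have t1 : L1 mu (tangent s (u n)) by exact: tangent_L1.
have Zn1 := recip_L1 (ru n).
have le : E mu (fun w => \1_(z r) w * (\1_(~` hit n) w * tangent s (u n) w)) <=
    E mu (fun w => \1_(z r) w * (\1_(~` hit n) w * recip (u n) w)).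
  apply: Ex_le; [exact: indic_L1|exact: indic_L1|] => w.
  by rewrite !ler_wpM2l ?indicE ?ler0n// tangent_le.
have split_ f : L1 mu f -> E mu (fun w => \1_(z r) w * f w) =
    E mu (fun w => \1_(z r) w * (\1_(hit n) w * f w)) +
    E mu (fun w => \1_(z r) w * (\1_(~` hit n) w * f w)).
  move=> f1; rewrite -ExD; [|exact: indic_L1|exact: indic_L1].
  apply: eq_Ex => w; rewrite !indicE in_setC.
  by case: (w \in hit n); rewrite /=; ring.
have tangE : E mu (fun w => \1_(z r) w * tangent s (u n) w) =
    E mu (fun w => \1_(z r) w * recip s w).
  have := Ex_tangent_move rs (lexx s) (su n) (sigma_setT (filtration_sigma hF (z0 rs))).
  under eq_Ex do rewrite indicT mul1r; under [in RHS]eq_Ex do rewrite indicT mul1r.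
  by under [in RHS]eq_Ex do rewrite tangent_diag.
have tangD : E mu (fun w => \1_(z r) w * (\1_(hit n) w * tang w)) =
    E mu (fun w => \1_(z r) w * (\1_(hit n) w * tangent s (u n) w)) +
    e ^+ 2 * E mu (fun w => \1_(z r) w * \1_(hit n) w).
  have h1 : L1 mu (fun w => \1_(z r) w * \1_(hit n) w).
    by apply: L1_indic; [exact: mz|exact: L1_indicator].
  rewrite -ExZ// -ExD; [|exact: indic_L1|exact: L1Z].
  by apply: eq_Ex => w; rewrite /tang; ring.
have := split_ _ Zn1; have := split_ _ t1.
by move: i1 le; rewrite tangE tangD; lra.
Qed.

End maximal.

Lemma Ex_recip_mono s t : r <= s -> s <= t ->
  E mu (fun w => \1_(z r) w * recip s w) <= E mu (fun w => \1_(z r) w * recip t w).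
Proof.
move=> rs st; have Fs := filtration_sigma hF (z0 rs).
have := Ex_recip_le rs st (sigma_setT Fs).
by under eq_Ex do rewrite indicT mul1r; under [X in _ <= X]eq_Ex do rewrite indicT mul1r.
Qed.

(** The means are nondecreasing in t and at most 1. *)
Lemma Ex_recip_cauchy dl : 0 < dl -> exists N : nat, forall t, r + N%:R <= t ->
  E mu (fun w => \1_(z r) w * recip t w) -
  E mu (fun w => \1_(z r) w * recip (r + N%:R) w) <= dl.
Proof.
move=> dl0; pose a (n : nat) := E mu (fun w => \1_(z r) w * recip (r + n%:R) w).
have Z1 t : r <= t -> L1 mu (fun w => \1_(z r) w * recip t w).
  by move=> rt; apply: L1_indic; [exact: mz|exact: recip_L1].
have rn (n : nat) : r <= r + n%:R by rewrite lerDl.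
have a1 n : a n <= 1.
  rewrite -[leRHS](Ex_cst mu); apply: Ex_le; [exact: Z1|exact: L1_cst|].
  move=> w; rewrite (le_trans (ler_norm _))// normrM.
  by rewrite mulr_ile1 ?norm_indic ?recip_norm.
have nda : nondecreasing_seq a.
  by move=> m n mn; apply: Ex_recip_mono => //; rewrite lerD2l ler_nat.
have uba : has_ubound (range a) by exists 1 => _ [n _ <-].
have supa : has_sup (range a) by split => //; exists (a 0%N); exists 0%N.
have [_ [N _ <-] HN] := sup_adherent dl0 supa.
exists N => t Nt; rewrite -/(a N).
pose M := (Num.truncn (t - r)).+1.
have tM : t <= r + M%:R by rewrite -lerBlDl ltW// truncnS_gt.
have rt : r <= t by exact: le_trans Nt.
have h1 := Ex_recip_mono rt tM; rewrite -/(a M) in h1.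
have h2 : a M <= sup (range a) by apply: ub_le_sup => //; exists M.
by move: h1 h2 HN; set b := sup _; set q := E mu _; lra.
Qed.

(** Dyadic grids of step 2^-m up to time s + m: they are nested, and every real time
is a limit from the right of such times. *)
Definition dyadic_far s (e : R) m := [set w | exists2 j, (j <= m * 2 ^ m)%N &
  e < `|recip (s + j%:R * (2 ^+ m)^-1) w - recip s w|].

Let dyadic_farS s e m : dyadic_far s e m `<=` dyadic_far s e m.+1.
Proof.
move=> w [j jm Hj]; exists (j * 2)%N.
  rewrite expnS mulnCA mulnC leq_mul2l /= (leq_trans jm)// leq_mul2r.
  by rewrite leqnSn orbT.
rewrite (_ : (j * 2)%:R * (2 ^+ m.+1)^-1 = j%:R * (2 ^+ m)^-1)//.
by rewrite natrM exprS invfM mulrA mulfK.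
Qed.

Let dyadic_far_mono s e m n : (m <= n)%N -> dyadic_far s e m `<=` dyadic_far s e n.
Proof.
elim: n => [|n IH]; first by rewrite leqn0 => /eqP ->.
rewrite leq_eqVlt => /predU1P[->//|/IH h]; exact: subset_trans h (@dyadic_farS _ _ _).
Qed.

Let measurable_dyadic_far s e m : r <= s -> measurable (dyadic_far s e m).
Proof.
move=> rs; have s0 := z0 rs.
rewrite (_ : dyadic_far s e m = \bigcup_(j in [set j | (j <= m * 2 ^ m)%N])
   [set w | e < `|recip (s + j%:R * (2 ^+ m)^-1) w - recip s w|]); last first.
  by apply/seteqP; split => w /= [j jm h]; exists j.
apply: bigcup_measurable => j _; rewrite -[X in measurable X]setTI.
apply: measurable_fun_ltr => //.
apply: measurableT_comp => //; apply: measurable_funB; last exact: recip_measurable.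
by apply: recip_measurable; rewrite addr_ge0// mulr_ge0// invr_ge0 exprn_ge0.
Qed.

Let far_union s e dl : r <= s -> 0 < e ->
  (forall t, s <= t -> E mu (fun w => \1_(z r) w * recip t w) -
     E mu (fun w => \1_(z r) w * recip s w) <= dl) ->
  e ^+ 2 * E mu (fun w => \1_(z r) w * \1_(\bigcup_m dyadic_far s e m) w) <= dl.
Proof.
move=> rs e0 H; have mf m := measurable_dyadic_far e m rs.
have mU : measurable (\bigcup_m dyadic_far s e m) by exact: bigcupT_measurable.
have [||||m w|_ c1] := @dct _ _ _ mu (fun m w => \1_(z r) w * \1_(dyadic_far s e m) w)
  (fun w => \1_(z r) w * \1_(\bigcup_m dyadic_far s e m) w) (fun=> 1).
- move=> m; apply: measurable_funM; first exact/measurable_indic/mz.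
  exact: measurable_indic.
- apply: measurable_funM; first exact/measurable_indic/mz.
  exact: measurable_indic.
- apply: aeW => w; apply: cvgM; first exact: cvg_cst.
  apply: cvg_near_cst.
  have [[m0 _ h]|h] := pselect ((\bigcup_m dyadic_far s e m) w).
    have hU : (\bigcup_m dyadic_far s e m) w by exists m0.
    exists m0 => // m /= m0m; have hm := dyadic_far_mono m0m h.
    by rewrite !indicE (mem_set hm) (mem_set hU).
  apply: nearW => m; rewrite !indicE (memNset h) memNset// => h'; apply: h.
  by exists m.
- exact: L1_cst.
- by rewrite normrM mulr_ile1 ?norm_indic.
have c2 : e ^+ 2 * E mu (fun w => \1_(z r) w * \1_(dyadic_far s e m) w) @[m --> \oo] -->
    e ^+ 2 * E mu (fun w => \1_(z r) w * \1_(\bigcup_m dyadic_far s e m) w).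
  by apply: cvgM; [exact: cvg_cst|exact: c1].
apply: (cvgr_to_le c2); apply: nearW => m.
have h0 : (0 : R) <= (2 ^+ m)^-1 by rewrite invr_ge0 exprn_ge0.
apply: le_trans (maximal_inequality (m * 2 ^ m) rs h0 e0) _.
by apply: H; rewrite lerDl mulr_ge0.
Qed.

(** The maximal inequality on finer and longer grids, with s so large that the means
of recip no longer vary. *)
Lemma recip_oscillation e : 0 < e -> mu.-negligible
  (z r `&` \bigcap_N \bigcup_m dyadic_far (r + N%:R) e m).
Proof.
move=> e0; have rN (N : nat) : r <= r + N%:R by rewrite lerDl.
set B := _ `&` _.
have mU N : measurable (\bigcup_m dyadic_far (r + N%:R) e m).
  by apply: bigcupT_measurable => m; exact: measurable_dyadic_far.
have mB : measurable B.
  by apply: measurableI; [exact: mz|exact: bigcapT_measurable].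
have B1 : L1 mu (\1_B : T -> R) by exact: L1_indicator.
apply: negligible_of_Ex => //; apply/ler_addgt0Pr => dl dl0; rewrite add0r.
have dl2 : 0 < dl * e ^+ 2 by rewrite mulr_gt0// exprn_gt0.
have [N HN] := Ex_recip_cauchy dl2.
have := far_union (rN N) e0 HN.
rewrite mulrC -ler_pdivlMr ?exprn_gt0// mulfK ?gt_eqF ?exprn_gt0// => h.
apply: le_trans h; apply: Ex_le => //.
  apply: L1_indic; first exact: mz.
  exact: L1_indicator.
move=> w; have [[zw Bw]|Bw] := pselect (B w); last first.
  by rewrite [leLHS]indicE memNset// mulr_ge0 ?indicE.
rewrite !indicE mem_set// mem_set// mem_set ?mulr1//; exact: Bw.
Qed.

Lemma recip_right_continuous w : (forall t, A t w <= x) ->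
  right_continuous (recip ^~ w) r.
Proof.
move=> Ax u ru; apply: cvgV; first by rewrite gt_eqF// (lt_le_trans ltr01)// recip_den_ge1.
apply: cvgD; first exact: cvg_cst.
have -> : (fun t => K x t w) = fun t => X t w - A t w.
  by apply/funext => t; rewrite /balayage Ax.
rewrite /balayage Ax; apply: cvgB; first exact: (@rX w r).
by apply: cvg_within_filter; exact: cA.
Qed.

Lemma recip_not_far w s e : (forall t, A t w <= x) -> r <= s ->
  ~ (\bigcup_m dyadic_far s e m) w -> forall t, s <= t -> `|recip t w - recip s w| <= e.
Proof.
move=> Ax rs nf t st.
(* u m is the first dyadic time of order m strictly after t *)
pose j m := (Num.truncn ((t - s) * 2 ^+ m)).+1.
pose u m := s + (j m)%:R * (2 ^+ m)^-1.
have p2 m : (0 : R) < 2 ^+ m by exact: exprn_gt0.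
have ut m : t < u m.
  by rewrite /u -ltrBlDl ltr_pdivlMr// truncnS_gt.
have ut' m : u m <= t + (2 ^+ m)^-1.
  rewrite /u /j -natr1 mulrDl mul1r addrA lerD2r -lerBrDl ler_pdivrMr//.
  by rewrite truncn_le mulr_ge0 ?subr_ge0// ltW.
have cu : u m @[m --> \oo] --> t^'+.
  move=> B; rewrite /at_right /within/= => /nbhs_ballP[e'/= e'0 He].
  change (\forall m \near \oo, B (u m)).
  have c0 : (2 ^+ m)^-1 @[m --> \oo] --> (0 : R).
    rewrite (_ : (fun m => _) = fun m => (2^-1 : R) ^+ m).
      by apply: cvg_expr; rewrite ger0_norm ?invr_ge0// invf_lt1// ltr1n.
    by apply/funext => m; rewrite exprVn.
  have hN : \forall m \near \oo, (2 ^+ m)^-1 < e' by exact: (cvgr_lt 0 c0).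
  near=> m; apply: (He (u m) _ (ut m)).
  have h : (2 ^+ m)^-1 < e' by near: m.
  rewrite /ball/= ltr_distlC; have := ut m; have := ut' m => h1 h2.
  by apply/andP; split; lra.
have cZ : `|recip (u m) w - recip s w| @[m --> \oo] --> `|recip t w - recip s w|.
  apply: cvg_norm; apply: cvgB; last exact: cvg_cst.
  apply: (@cvg_comp _ _ _ u (recip ^~ w) _ _ _ cu).
  by apply: recip_right_continuous => //; exact: le_trans st.
apply: (cvgr_to_le cZ); exists (Num.truncn (t - s)).+2 => // m /= hm.
rewrite leNgt; apply/negP => far; apply: nf; exists m => //; exists (j m) => //.
rewrite /j; apply: (@leq_trans ((Num.truncn (t - s)).+1 * 2 ^ m)).
  rewrite -(ltr_nat R) (le_lt_trans (_ : _ <= (t - s) * 2 ^+ m))//.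
    by rewrite truncn_le mulr_ge0 ?subr_ge0// ltW.
  by rewrite natrM natrX ltr_pM2r// truncnS_gt.
by rewrite leq_mul2r (ltnW hm) orbT.
Unshelve. all: by end_near. Qed.

(** Outside the oscillation events for e = 1/(k+1) the path is Cauchy at infinity. *)
Lemma recip_cvg : {ae mu, forall w, z r w -> (forall t, A t w <= x) ->
  cvg (recip t w @[t --> +oo])}.
Proof.
have h : {ae mu, forall w, forall k : nat,
    ~ (z r `&` \bigcap_N \bigcup_m dyadic_far (r + N%:R) k.+1%:R^-1 m) w}.
  apply: ae_foralln => k.
  have k0 : (0 : R) < k.+1%:R^-1 by [].
  apply: negligibleS (recip_oscillation k0).
  by move=> w /= /contrapT.
apply: filterS h => w hw zw Ax; apply: R_complete; apply: cauchy_exP => e e0.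
have [//|] := (not_andP _ _).1 (hw (Num.truncn e^-1)).
move=> /existsNP[N /not_implyP[_ nf]].
exists (recip (r + N%:R) w).
have rN : r <= r + N%:R by rewrite lerDl.
exists (r + N%:R); split; first exact: num_real.
move=> t Nt; rewrite /ball/= distrC.
apply: (le_lt_trans (recip_not_far Ax rN nf (ltW Nt))).
by rewrite invf_plt ?posrE// truncnS_gt.
Qed.

End fixed_r.

Lemma X_mean : exists kappa, forall t, 0 <= t -> E mu (X t) <= kappa.
Proof.
have [k Hk] := X_UI ltr01; exists (1 + `|k|) => t t0.
have XL := X_L1 t0.
have i1 := L1_excess k XL.
rewrite (le_trans (_ : _ <= E mu (fun w => Num.max 0 (X t w - k) + `|k|)))//.
  apply: Ex_le => //; first by apply: L1D => //; exact: L1_cst.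
  move=> w; have h : X t w - k <= Num.max 0 (X t w - k) by rewrite le_max lexx orbT.
  by have := ler_norm k; move: h; lra.
rewrite ExD//; last exact: L1_cst.
by rewrite Ex_cst lerD2r; exact: Hk.
Qed.

Lemma X_not_infty : {ae mu, forall w, ~ (X n%:R w)%:E @[n --> \oo] --> +oo%E}.
Proof.
have [kappa Hk] := X_mean.
apply: (@ae_not_cvg_infty _ _ _ mu (fun n => X n%:R) kappa) => // n; first exact: X_L1.
exact: Hk.
Qed.

Lemma K_min x t w : K x t w + Num.min (A t w) x <= X t w.
Proof.
rewrite /balayage; have [h|h] := leP (A t w) x; last by rewrite addNr.
by rewrite subrK.
Qed.

(** The martingale property bounds the mean of min(A, x) by that of X plus a
constant independent of x; so min(A_n, n) cannot tend to infinity. *)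
Lemma A_bounded r : 0 <= r ->
  {ae mu, forall w, z r w -> exists k : nat, forall t, A t w <= k%:R}.
Proof.
move=> r0; have [kappa Hk] := X_mean.
pose C (y : nat) := [set w | A r w <= y%:R].
have rn (n : nat) : r <= r + n%:R by rewrite lerDl.
have rn0 (n : nat) : 0 <= r + n%:R by exact: le_trans (rn n).
have FC y : F r (C y) := F_A_le y%:R r0.
have mC y : measurable (C y) := filtration_measurable hF r0 (FC y).
have mA t : 0 <= t -> measurable_fun setT (A t).
  by move=> t0; apply: (sub_measurable_fun (filtration_sub hF t0)); exact: aA.
(* the level y + n of the truncation grows with the time r + n *)
pose cap y n w := Num.min (A (r + n%:R) w) (y + n)%:R.
have cap0 y n w : 0 <= cap y n w by rewrite le_min A0 ler0n.
pose g y n w := \1_(z r) w * (\1_(C y) w * cap y n w).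
have g1 y n : L1 mu (g y n).
  by apply: L1_indic; [exact: mz|apply: L1_indic => //; apply: L1_minc => //; exact: mA].
have g_le y n : E mu (g y n) <= kappa + y%:R.
  have k0 : (0 : R) <= (y + n)%:R by [].
  have CA w : C y w -> A r w <= (y + n)%:R.
    by move=> h; rewrite (le_trans h)// ler_nat leq_addr.
  have KL t : 0 <= t -> L1 mu (fun w => \1_(z r) w * (\1_(C y) w * K (y + n)%:R t w)).
    by move=> t0; apply: L1_indic; [exact: mz|apply: L1_indic => //; exact: K_L1].
  have low : - y%:R <= E mu (fun w => \1_(z r) w * (\1_(C y) w * K (y + n)%:R r w)).
    rewrite -[leLHS](Ex_cst mu); apply: Ex_le; [exact: L1_cst|exact: KL|].
    move=> w; rewrite !indicE; case: (w \in z r); last by rewrite mul0r oppr_le0.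
    have [Cw|Cw] := pselect (C y w); last by rewrite [w \in _]memNset// mul0r mulr0 oppr_le0.
    rewrite mem_set// !mul1r /balayage (CA _ Cw).
    by move: Cw; rewrite /C /=; have := X0 r w; lra.
  move: low; rewrite -(K_mart r0 (rn n) k0 (FC y) CA) => low.
  suff : E mu (fun w => g y n w + \1_(z r) w * (\1_(C y) w * K (y + n)%:R (r + n%:R) w)) <=
      kappa by rewrite ExD//; [lra|exact: KL].
  apply: le_trans (Hk _ (rn0 n)); apply: Ex_le.
  - by apply: L1D => //; exact: KL.
  - exact: X_L1.
  move=> w; rewrite /g -!mulrDr; have := K_min (y + n)%:R (r + n%:R) w; rewrite addrC => h.
  rewrite !indicE; case: (w \in z r); last by rewrite mul0r.
  by case: (w \in C y); rewrite ?mul0r ?mulr0 ?mul1r.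
have : {ae mu, forall w, forall y : nat, ~ (g y n w)%:E @[n --> \oo] --> +oo%E}.
  apply: ae_foralln => y; apply: (ae_not_cvg_infty (g1 y) _ (g_le y)) => n w.
  by rewrite mulr_ge0 ?indicE// mulr_ge0 ?ler0n.
apply: filterS => w hw zw.
pose y := (Num.truncn (A r w)).+1.
have Cy : C y w by rewrite /C /= ltW// truncnS_gt.
apply: contrapT => unbounded; apply: (hw y); apply/cvgeyPge => k.
have [t kA] : exists t, k <= A t w.
  apply: contrapT => h; apply: unbounded; exists (Num.truncn k).+1 => t.
  rewrite leNgt; apply/negP => kA; apply: h; exists t.
  by rewrite ltW// (lt_trans (truncnS_gt k)).
near=> n; rewrite lee_fin /g !indicE !mem_set// !mul1r le_min; apply/andP; split.
  apply: (le_trans kA); apply: ndA; rewrite -lerBlDl (le_trans (ltW (truncnS_gt _)))// ler_nat.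
  near: n; exact: nbhs_infty_ge.
apply: le_trans (ltW (truncnS_gt k)) _; rewrite ler_nat (leq_trans _ (leq_addl _ _))//.
near: n; exact: nbhs_infty_ge.
Unshelve. all: by end_near. Qed.

Hypothesis z_ae : {ae mu, forall w, exists n : nat, z n%:R w}.

(** On a path where A is at most k, the balayage at level k is X - A.  The limit
of its [recip] is not 0, as X does not tend to infinity. *)
Lemma X_A_cvg : {ae mu, forall w, exists a l : R,
  [/\ A t w @[t --> +oo] --> a, X t w @[t --> +oo] --> l & forall t, A t w <= a]}.
Proof.
have h1 : {ae mu, forall w, forall n : nat,
    z n%:R w -> exists k : nat, forall t, A t w <= k%:R}.
  by apply: ae_foralln => n; exact: A_bounded.
have h2 : {ae mu, forall w, forall n k : nat,
    z n%:R w -> (forall t, A t w <= k%:R) -> cvg (recip k%:R t w @[t --> +oo])}.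
  apply: ae_foralln => n; apply: ae_foralln => k.
  by apply: recip_cvg.
have h3 := X_not_infty.
near=> w.
have [n zn] : exists n : nat, z n%:R w by near: w.
have [k Ak] : exists k : nat, forall t, A t w <= k%:R.
  have := near h1 w; apply=> //; exact: zn.
have /cvg_ex[l Zl] : cvg (recip k%:R t w @[t --> +oo]).
  have := near h2 w; apply=> //; exact: zn.
have hX : ~ (X n%:R w)%:E @[n --> \oo] --> +oo%E by near: w.
have uA : has_ubound (range (A ^~ w)) by exists k%:R => _ [t _ <-].
have cvA := nondecreasing_cvgr (ndA w) uA.
have k0 : (0 : R) <= k%:R by [].
have ZE t : recip k%:R t w = (1 + k%:R + (X t w - A t w))^-1 by rewrite /recip /balayage Ak.
have pos t : 0 < 1 + k%:R + (X t w - A t w).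
  by have := X0 t w; have := Ak t; lra.
have l0 : l != 0.
  apply/eqP => l0; apply: hX; apply/cvgeyPge => m.
  pose m' := Num.max m 0; have m'0 : 0 <= m' by rewrite le_max lexx orbT.
  have m1 : (0 : R) < 1 + k%:R + m' by rewrite -addrA ltr_pwDl// addr_ge0.
  have m0 : (0 : R) < (1 + k%:R + m')^-1 by rewrite invr_gt0.
  rewrite l0 in Zl; have /= [M [_ HM]] := cvgr_lt 0 Zl _ m0.
  exists (Num.truncn M).+1 => // j Mj.
  have Mj' : M < j%:R by rewrite (lt_le_trans (truncnS_gt _))// ler_nat.
  rewrite lee_fin; apply: (@le_trans _ _ m'); first by rewrite le_max lexx.
  have := HM _ Mj'; rewrite /= ZE ltf_pV2 ?posrE ?pos//.
  by have := A0 j%:R w; lra.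
exists (sup (range (A ^~ w))), (l^-1 - (1 + k%:R) + sup (range (A ^~ w))); split.
- exact: cvA.
- rewrite (_ : (fun t => X t w) = fun t => (recip k%:R t w)^-1 - (1 + k%:R) + A t w).
    apply: cvgD => //; apply: cvgB; last exact: cvg_cst.
    exact: cvgV.
  by apply/funext => t; rewrite ZE invrK; lra.
- by move=> t; apply: ub_le_sup => //; exists t.
Unshelve. all: by end_near. Qed.

(** * The terminal identity *)

Section terminal_identity.
Variables (g Xi Ai : T -> R) (x : R).
Hypothesis x0 : 0 < x.
Hypothesis g0 : forall w, 0 <= g w.
Hypothesis g_ae : {ae mu, forall w,
  [/\ forall r, 0 <= r -> z r w -> g w <= r,
      forall r, g w < r -> z r w, X (g w) w = 0 & A (g w) w = 0]}.
Hypothesis mXi : measurable_fun setT Xi.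
Hypothesis mAi : measurable_fun setT Ai.
Hypothesis Xi0 : forall w, 0 <= Xi w.
Hypothesis Ai0 : forall w, 0 <= Ai w.
Hypothesis lim_ae : {ae mu, forall w,
  [/\ A t w @[t --> +oo] --> Ai w, X t w @[t --> +oo] --> Xi w & forall t, A t w <= Ai w]}.

(* terminal value of the balayage at level x *)
Let Kinf w := if Ai w <= x then Xi w - Ai w else - x.
Let XA t w := \1_[set w | A t w <= x] w * X t w.
Let XAi w := \1_[set w | Ai w <= x] w * Xi w.

Let mAle t : 0 <= t -> measurable [set w | A t w <= x].
Proof. by move=> t0; exact: (filtration_measurable hF t0 (F_A_le x t0)). Qed.

Let mAile : measurable [set w | Ai w <= x].
Proof.
rewrite -[X in measurable X]setTI; apply: measurable_fun_ler => //.
Qed.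

Let K_split t w : K x t w = XA t w - Num.min (A t w) x.
Proof.
rewrite /balayage /XA indicE; case: ifPn => h.
  by rewrite mem_set// mul1r min_l.
by rewrite memNset ?mul0r ?sub0r ?min_r//; [rewrite ltW// ltNge|exact/negP].
Qed.

Let Kinf_split w : Kinf w = XAi w - Num.min (Ai w) x.
Proof.
rewrite /Kinf /XAi indicE; case: ifPn => h.
  by rewrite mem_set// mul1r min_l.
by rewrite memNset ?mul0r ?sub0r ?min_r//; [rewrite ltW// ltNge|exact/negP].
Qed.

Let XA0 t w : 0 <= XA t w. Proof. by rewrite mulr_ge0 ?indicE. Qed.
Let XAi0 w : 0 <= XAi w. Proof. by rewrite mulr_ge0 ?indicE. Qed.

Let XA_le t w : XA t w <= X t w.
Proof. by rewrite ler_piMl// indicE lern1 leq_b1. Qed.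

Let XA_L1 t : 0 <= t -> L1 mu (XA t).
Proof. by move=> t0; apply: L1_indic; [exact: mAle|exact: X_L1]. Qed.

Let mXAi : measurable_fun setT XAi.
Proof. by apply: measurable_funM => //; exact: measurable_indic. Qed.

Let cvg_nat (y : R -> R) (r l : R) : y t @[t --> +oo] --> l ->
  y (r + n%:R) @[n --> \oo] --> l.
Proof.
move=> yl; apply: (@cvg_comp _ _ _ (fun n : nat => r + n%:R) y _ _ _ _ yl).
move=> B [M [_ HM]]; exists (Num.truncn (M - r)).+1 => // n /= nM; apply: HM.
by rewrite -ltrBlDl (lt_le_trans (truncnS_gt _))// ler_nat.
Qed.

Let XA_cvg r : {ae mu, forall w, XA (r + n%:R) w @[n --> \oo] --> XAi w}.
Proof.
apply: filterS lim_ae => w [cvA cvX leA].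
rewrite /XA /XAi; apply: cvgM; last exact: (cvg_nat r cvX).
have [h|h] := leP (Ai w) x.
  apply: cvg_near_cst; apply: nearW => n; rewrite !indicE !mem_set//=.
  exact: le_trans (leA _) h.
apply: cvg_near_cst.
have : \forall n \near \oo, x < A (r + n%:R) w.
  exact: (cvgr_gt (Ai w) (cvg_nat r cvA) x h).
apply: filterS => n hn; rewrite !indicE !memNset//=; apply/negP; rewrite -ltNge//.
Qed.

(** The martingale property with t tending to infinity: X is uniformly integrable
and min(A, x) is bounded. *)
Let terminal_mart r C : 0 <= r -> F r C -> (forall w, C w -> A r w <= x) ->
  E mu (fun w => \1_(z r) w * (\1_C w * Kinf w)) =
  E mu (fun w => \1_(z r) w * (\1_C w * K x r w)).
Proof.
move=> r0 FC CA; have mC := filtration_measurable hF r0 FC.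
have rn (n : nat) : r <= r + n%:R by rewrite lerDl.
have rn0 (n : nat) : 0 <= r + n%:R by exact: le_trans (rn n).
have mz1 := mz r0.
have mA t : 0 <= t -> measurable_fun setT (A t).
  by move=> t0; apply: (sub_measurable_fun (filtration_sub hF t0)); exact: aA.
have [||||||||f1 c1] := @vitali_dominated _ _ _ mu
  (fun n w => \1_(z r) w * (\1_C w * XA (r + n%:R) w)) (fun n => X (r + n%:R))
  (fun w => \1_(z r) w * (\1_C w * XAi w)).
- by move=> n w; case/andP: (indic2_mul_bounds (z r) C w (XA0 (r + n%:R) w)).
- move=> n w; apply: le_trans (XA_le (r + n%:R) w).
  by case/andP: (indic2_mul_bounds (z r) C w (XA0 (r + n%:R) w)).
- move=> n; apply: measurable_funM; first exact: measurable_indic.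
  by apply: measurable_funM; [exact: measurable_indic|exact: L1_measurable (XA_L1 _)].
- by move=> n; exact: X_L1.
- apply: measurable_funM; first exact: measurable_indic.
  by apply: measurable_funM => //; exact: measurable_indic.
- by move=> w; case/andP: (indic2_mul_bounds (z r) C w (XAi0 w)).
- apply: filterS (XA_cvg r) => w cw; apply: cvgM; first exact: cvg_cst.
  by apply: cvgM => //; exact: cvg_cst.
- by move=> e /X_UI[k Hk]; exists k => n; exact: Hk.
have [||||n w|f2 c2] := @dct _ _ _ mu
  (fun n w => \1_(z r) w * (\1_C w * Num.min (A (r + n%:R) w) x))
  (fun w => \1_(z r) w * (\1_C w * Num.min (Ai w) x)) (fun=> x).
- move=> n; apply: measurable_funM; first exact: measurable_indic.
  apply: measurable_funM; first exact: measurable_indic.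
  by apply: measurable_minr; [exact: mA|exact: measurable_cst].
- apply: measurable_funM; first exact: measurable_indic.
  apply: measurable_funM; first exact: measurable_indic.
  by apply: measurable_minr => //; exact: measurable_cst.
- apply: filterS lim_ae => w [cvA _ _]; apply: cvgM; first exact: cvg_cst.
  apply: cvgM; first exact: cvg_cst.
  by apply: cvg_minr; [exact: (cvg_nat r cvA)|exact: cvg_cst].
- exact: L1_cst.
- rewrite !normrM mulrA [X in _ * X]ger0_norm; last by rewrite le_min A0 ltW.
  rewrite (le_trans (_ : _ <= Num.min (A (r + n%:R) w) x))//.
    by rewrite ler_piMl ?mulr_ile1 ?norm_indic// le_min A0 ltW.
  by rewrite ge_min lexx orbT.
have e1 n : E mu (fun w => \1_(z r) w * (\1_C w * XA (r + n%:R) w)) -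
    E mu (fun w => \1_(z r) w * (\1_C w * Num.min (A (r + n%:R) w) x)) =
    E mu (fun w => \1_(z r) w * (\1_C w * K x r w)).
  rewrite -(K_mart r0 (rn n) (ltW x0) FC CA) -ExB; last 2 first.
  - by apply: L1_indic => //; apply: L1_indic => //; exact: XA_L1.
  - apply: L1_indic => //; apply: L1_indic => //; apply: (@L1_bounded _ _ _ _ _ x).
      by apply: measurable_minr; [exact: mA|exact: measurable_cst].
    by move=> w; rewrite ger0_norm ?ge_min ?lexx ?orbT// le_min A0 ltW.
  by apply: eq_Ex => w; rewrite K_split; ring.
have e2 : E mu (fun w => \1_(z r) w * (\1_C w * Kinf w)) =
    E mu (fun w => \1_(z r) w * (\1_C w * XAi w)) -
    E mu (fun w => \1_(z r) w * (\1_C w * Num.min (Ai w) x)).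
  by rewrite -ExB//; apply: eq_Ex => w; rewrite Kinf_split; ring.
rewrite e2; apply: (cvg_unique (@norm_hausdorff _ R^o) (cvgB c1 c2)).
by apply: cvg_near_cst; apply: nearW => n; exact: e1.
Qed.

Let Xi_L1 : L1 mu XAi.
Proof.
have [kappa Hk] := X_mean.
have [||||||] // := @fatou_real _ _ _ mu (fun n => XA (0 + n%:R)) XAi kappa.
- by move=> n; apply: XA_L1; rewrite add0r.
- move=> n; have n0 : (0 : R) <= 0 + n%:R by rewrite add0r.
  apply: le_trans (Hk _ n0); apply: Ex_le => //; [exact: XA_L1|exact: X_L1].
Qed.

Let minAi_L1 : L1 mu (fun w => Num.min (Ai w) x).
Proof.
apply: (@L1_bounded _ _ _ _ _ x).
  by apply: measurable_minr => //; exact: measurable_cst.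
by move=> w; rewrite ger0_norm ?ge_min ?lexx ?orbT// le_min Ai0 ltW.
Qed.

Let Kinf_L1 : L1 mu Kinf.
Proof.
rewrite (_ : Kinf = fun w => XAi w - Num.min (Ai w) x); first exact: L1B.
by apply/funext => w; rewrite Kinf_split.
Qed.

Section grid.
Variables (eta : R) (m : nat).
Hypotheses (eta0 : 0 < eta) (etax : eta <= x).

Let q i : R := i.+1%:R / m.+1%:R.
Let q0 i : 0 <= q i. Proof. by rewrite divr_ge0. Qed.
Let q_mono i : q i <= q i.+1. Proof. by rewrite ler_pM2r// ler_nat. Qed.

(** Together with [z (q i)], that q i is the first grid point after the last zero. *)
Definition fresh i := if i is j.+1 then ~` nz (q j) (q i) else setT.
(** The last zero g is approached from the right, where X and A tend to 0. *)
Definition small i := [set w | A (q i) w <= eta] `&` [set w | X (q i) w <= eta].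

Let F_fresh i : F (q i) (fresh i).
Proof.
have Fs := filtration_sigma hF (q0 i).
case: i Fs => [|j] Fs; first exact: sigma_setT.
by apply: (sigma_setC Fs); exact: F_nz.
Qed.

Let F_small i : F (q i) (small i).
Proof.
have Fs := filtration_sigma hF (q0 i).
by apply: (sigma_setI Fs); [exact: F_A_le|exact: F_X_le].
Qed.

Let unit01 (B : set T) w : (0 : R) <= \1_B w <= (1 : R).
Proof. exact: indic01. Qed.

Let cell_L1 i : L1 mu (fun w => \1_(z (q i)) w * \1_(fresh i) w).
Proof.
apply: L1_indic; first exact: mz.
apply: (L1_bounded _ _ (norm_indic _)); apply: measurable_indic.
exact: (filtration_measurable hF (q0 i) (F_fresh i)).
Qed.

(** By the martingale property Kinf may be replaced by the value at the grid point,
which is at most eta in absolute value on [small]. *)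
Let cell_bound i :
  `|E mu (fun w => \1_(z (q i)) w * (\1_(fresh i `&` small i) w * Kinf w))| <=
  eta * E mu (fun w => \1_(z (q i)) w * \1_(fresh i) w).
Proof.
have Fs := filtration_sigma hF (q0 i).
have FC : F (q i) (fresh i `&` small i) by apply: (sigma_setI Fs).
have mC := filtration_measurable hF (q0 i) FC.
have CA w : (fresh i `&` small i) w -> A (q i) w <= x.
  by move=> [_ [h _]]; exact: le_trans h etax.
rewrite (terminal_mart (q0 i) FC CA).
have i1 : L1 mu (fun w => \1_(z (q i)) w * (\1_(fresh i `&` small i) w * K x (q i) w)).
  by apply: L1_indic; [exact: mz|apply: L1_indic => //; apply: K_L1 => //; exact: ltW].
apply: (le_trans (Ex_norm i1)); rewrite -ExZ//; apply: Ex_le.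
- exact: L1_norm.
- exact: L1Z.
move=> w; rewrite indicI /=.
have [sw|sw] := pselect (small i w); last first.
  rewrite [\1_(small i) w]indicE memNset// mulr0 mul0r mulr0 normr0.
  have /andP[a0 _] := unit01 (z (q i)) w; have /andP[b0 _] := unit01 (fresh i) w.
  by apply: mulr_ge0; [exact: ltW|exact: mulr_ge0].
rewrite [\1_(small i) w]indicE mem_set// mulr1.
have /andP[a0 _] := unit01 (z (q i)) w; have /andP[b0 _] := unit01 (fresh i) w.
rewrite !normrM (ger0_norm a0) (ger0_norm b0) mulrA mulrC ler_wpM2r ?mulr_ge0//.
have [/= h1 h2] := sw.
rewrite /balayage ifT; last exact: le_trans etax.
by rewrite ler_norml; have := X0 (q i) w; have := A0 (q i) w; move=> h3 h4; apply/andP; split; lra.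
Qed.

Let cell_sum I w : \sum_(i < I.+1) \1_(z (q i)) w * \1_(fresh i) w = \1_(z (q I)) w :> R.
Proof.
elim: I => [|I IH]; first by rewrite big_ord1 /= indicT mulr1.
rewrite big_ord_recr/= IH (z_split (q_mono I)) indicI /= !indicE in_setC.
by case: (w \in nz _ _); case: (w \in z _); rewrite /= ?mul1r ?mul0r ?mulr1 ?mulr0 ?addr0 ?add0r.
Qed.

(** The indicator of the event that X and A are small at the first grid point after
the last zero.  The grid has step 1/(m+1) and covers [0, m+1]. *)
Definition weight w : R :=
  \sum_(i < (m.+1 * m.+1).+1) \1_(z (q i)) w * \1_(fresh i `&` small i) w.

Lemma weight_measurable : measurable_fun setT weight.
Proof.
apply: measurable_sum => i; apply: measurable_funM.
  by apply: measurable_indic; exact: mz.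
apply: measurable_indic; apply: measurableI.
  exact: (filtration_measurable hF (q0 i) (F_fresh i)).
exact: (filtration_measurable hF (q0 i) (F_small i)).
Qed.

Lemma weight_norm w : `|weight w| <= 1.
Proof.
rewrite ger0_norm; last first.
  apply: sumr_ge0 => i _.
  have /andP[a0 _] := unit01 (z (q i)) w.
  have /andP[b0 _] := unit01 (fresh i `&` small i) w; exact: mulr_ge0.
have /andP[_ h] := unit01 (z (q (m.+1 * m.+1))) w; apply: le_trans h.
rewrite -cell_sum; apply: ler_sum => i _.
have /andP[a0 _] := unit01 (z (q i)) w; rewrite ler_wpM2l// indicI /=.
have /andP[b0 _] := unit01 (fresh i) w; have /andP[_ c1] := unit01 (small i) w.
by rewrite ler_piMr.
Qed.

Lemma weight_bound : `|E mu (fun w => weight w * Kinf w)| <= eta.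
Proof.
have i1 i : L1 mu (fun w => \1_(z (q i)) w * (\1_(fresh i `&` small i) w * Kinf w)).
  apply: L1_indic; first exact: mz.
  apply: L1_indic => //; apply: measurableI.
    exact: (filtration_measurable hF (q0 i) (F_fresh i)).
  exact: (filtration_measurable hF (q0 i) (F_small i)).
rewrite (_ : E mu _ = E mu (fun w => \sum_(i < (m.+1 * m.+1).+1)
    \1_(z (q i)) w * (\1_(fresh i `&` small i) w * Kinf w))); last first.
  apply: eq_Ex => w; rewrite /weight mulr_suml; apply: eq_bigr => i _.
  by rewrite mulrA.
rewrite (Ex_sum _ i1) (le_trans (ler_norm_sum _ _ _))//.
apply: (@le_trans _ _ (\sum_(i < (m.+1 * m.+1).+1)
    eta * E mu (fun w => \1_(z (q i)) w * \1_(fresh i) w))).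
  by apply: ler_sum => i _; exact: cell_bound.
rewrite -mulr_sumr -(Ex_sum _ cell_L1) -[leRHS]mulr1 ler_wpM2l ?(ltW eta0)//.
rewrite -(Ex_cst mu 1); apply: Ex_le; [exact: (L1_sum _ cell_L1)|exact: L1_cst|].
by move=> w; rewrite cell_sum; have /andP[] := unit01 (z (q (m.+1 * m.+1))) w.
Qed.

(** The first grid point after g lies within one step of g. *)
Lemma weight1 w (n : nat) (dl : R) : (n <= m)%N -> z n%:R w ->
  (forall r, 0 <= r -> z r w -> g w <= r) -> (forall r, g w < r -> z r w) ->
  m.+1%:R^-1 < dl ->
  (forall u, g w <= u -> u < g w + dl -> A u w <= eta /\ X u w <= eta) ->
  weight w = 1.
Proof.
move=> nm zn gle glt mdl Hs.
have z_le r s : r <= s -> z r w -> z s w by move=> rs; rewrite (z_split rs) => -[].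
have q_le i j : (i <= j)%N -> q i <= q j by move=> ij; rewrite ler_pM2r// ler_nat.
(* the sum reduces to the term of the first grid point q i without later zeros *)
have exq : exists i, `[< z (q i) w >].
  exists (n * m.+1)%N; apply/asboolP; apply: z_le zn.
  by rewrite /q ler_pdivlMr// -natrM ler_nat leqW.
have [i /asboolP zi imin] := ex_minnP exq.
have iI : (i < (m.+1 * m.+1).+1)%N.
  have h : `[< z (q (n * m.+1)%N) w >].
    apply/asboolP; apply: z_le zn.
    by rewrite /q ler_pdivlMr// -natrM ler_nat leqW.
  rewrite ltnS (leq_trans (imin _ h))// leq_mul2r orbC (leq_trans nm)//.
have gq : g w <= q i by exact: gle.
have qg : q i <= g w + m.+1%:R^-1.
  case: i zi imin iI gq => [|j] zi imin iI gq.
    by rewrite /q mul1r lerDr.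
  have nzj : ~ z (q j) w.
    by move=> h; have := imin j (asboolT h); rewrite ltnn.
  have qjg : q j <= g w by rewrite leNgt; apply/negP => /glt.
  by rewrite /q -natr1 mulrDl mul1r lerD2r.
have qdl : q i < g w + dl by rewrite (le_lt_trans qg)// ltrD2l.
have [h1 h2] := Hs (q i) gq qdl.
have fi : fresh i w.
  case: i zi imin {iI gq qg qdl h1 h2} => [//|j] zi imin /= nzj.
  have : z (q j) w by rewrite (z_split (q_mono j)).
  by move=> h; have := imin j (asboolT h); rewrite ltnn.
rewrite /weight (bigD1 (Ordinal iI))//= big1 ?addr0.
  by rewrite !indicE !mem_set// mulr1.
move=> j ji; have {}ji : (j : nat) != i.
  by apply: contra ji => /eqP h; apply/eqP/val_inj.
have [zj|zj] := pselect (z (q j) w); last by rewrite indicE memNset// mul0r.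
have ij : (i < j)%N by rewrite ltn_neqAle eq_sym ji imin//; exact: asboolT.
rewrite indicI /= [X in _ * (X * _)]indicE memNset ?mul0r ?mulr0//.
move=> fj; move: fj zj; case: (j : nat) ij => [//|k] ik /= nk _; apply: nk.
have : z (q k) w by exact: (z_le _ _ (q_le i k ik) zi).
by rewrite (z_split (q_mono k)) => -[].
Qed.

End grid.

(** The weights tend to 1 as the grid is refined, for each fixed eta. *)
Let Kinf_mean0 : E mu Kinf = 0.
Proof.
suff H eta : 0 < eta -> eta <= x -> `|E mu Kinf| <= eta.
  apply/eqP; rewrite -normr_le0; apply/ler_addgt0Pr => e e0; rewrite add0r.
  apply: (le_trans (H (Num.min e x) _ _)).
  - by rewrite lt_min e0.
  - by rewrite ge_min lexx orbT.
  - by rewrite ge_min lexx.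
move=> eta0 etax.
have [||||m w|_ c1] := @dct _ _ _ mu (fun m w => weight eta m w * Kinf w) Kinf
  (fun w => `|Kinf w|).
- move=> m; apply: measurable_funM; first exact: weight_measurable.
  exact: L1_measurable Kinf_L1.
- exact: L1_measurable Kinf_L1.
- near=> w.
  have [gle glt Xg Ag] : [/\ forall r, 0 <= r -> z r w -> g w <= r,
      forall r, g w < r -> z r w, X (g w) w = 0 & A (g w) w = 0] by near: w.
  have [n zn] : exists n : nat, z n%:R w by near: w.
  have [dl dl0 Hdl] : exists2 dl, 0 < dl &
      forall u, g w <= u -> u < g w + dl -> A u w <= eta /\ X u w <= eta.
    have nX : \forall u \near (g w)^'+, X u w < eta.
      by apply: (cvgr_lt (X (g w) w) (@rX w (g w) (g w) (lexx _)) eta); rewrite Xg.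
    have nA : \forall u \near (g w)^'+, A u w < eta.
      apply: (cvgr_lt (A (g w) w) _ eta); last by rewrite Ag.
      by apply: cvg_within_filter; exact: cA.
    have [dl /= dl0 Hdl] : nbhs_ball (g w) (fun u => g w < u -> A u w < eta /\ X u w < eta).
      by apply/nbhs_ballP; near=> u => gu; split; move: gu; near: u.
    exists dl => // u; rewrite le_eqVlt => /predU1P[<- _|gu udl].
      by rewrite Xg Ag (ltW eta0).
    have ub : ball (g w) dl u.
      by rewrite /ball/= ltr_distlC; apply/andP; split; lra.
    by have [/ltW h1 /ltW h2] := Hdl u ub gu.
  apply: cvg_near_cst; near=> m.
  rewrite (@weight1 eta m w n dl) ?mul1r//.
    by near: m; exists n.
  near: m; exact: (near_infty_natSinv_lt (PosNum dl0)).
- exact: L1_norm.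
- by rewrite normrM ler_piMl// weight_norm.
have c2 : `|E mu (fun w => weight eta m w * Kinf w)| @[m --> \oo] --> `|E mu Kinf|.
  exact: cvg_norm.
apply: (cvgr_to_le c2); apply: nearW => m; exact: weight_bound.
Unshelve. all: by end_near. Qed.

Lemma terminal_identity :
  E mu (fun w => \1_[set w | Ai w <= x] w * Xi w) = E mu (fun w => Num.min (Ai w) x).
Proof.
apply/eqP; rewrite -subr_eq0 -ExB//; apply/eqP; rewrite -[RHS]Kinf_mean0.
by apply: eq_Ex => w; rewrite Kinf_split.
Qed.

End terminal_identity.

End convergence.

(** * Exponential decay *)

(** Comparison of G with the exponential of -H when dG lies between -G_- dH and
-G dH, for H continuous and G merely monotone. *)
Section exponential_uniqueness.
Context {R : realType}.
Variables (G H : R -> R) (x : R).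
Hypothesis x0 : 0 <= x.
Hypothesis cH : {within `[0, x], continuous H}.
Hypothesis G_pos : forall u, 0 <= u -> u <= x -> 0 < G u.
Hypothesis H_mono : forall u v, 0 <= u -> u <= v -> v <= x -> 0 <= H v - H u.
Hypothesis slope : forall u v, 0 <= u -> u <= v -> v <= x ->
  G v * (H v - H u) <= G u - G v /\ G u - G v <= G u * (H v - H u).

Let err u v := ln (G u) - ln (G v) - (H v - H u).

Let G_mono u v : 0 <= u -> u <= v -> v <= x -> G v <= G u.
Proof.
move=> u0 uv vx; have [h1 _] := slope u0 uv vx.
have gv := G_pos (le_trans u0 uv) vx; rewrite -subr_ge0; apply: le_trans h1.
by apply: mulr_ge0; [exact: ltW|exact: H_mono].
Qed.

(** The logarithm of the ratio of G u to G v lies between 1 - G v / G u and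
G u / G v - 1, as does the increment of H by [slope]. *)
Let err_le u v : 0 <= u -> u <= v -> v <= x ->
  `|err u v| <= (G x)^-1 * ((G u - G v) * (H v - H u)).
Proof.
move=> u0 uv vx; have [h1 h2] := slope u0 uv vx.
have gu := G_pos u0 (le_trans uv vx); have gv := G_pos (le_trans u0 uv) vx.
have gx := G_pos x0 (lexx x).
have Guv := G_mono u0 uv vx; have Hh := H_mono u0 uv vx.
have Gvx := G_mono (le_trans u0 uv) vx (lexx x).
have lnE : ln (G u) - ln (G v) = ln (G u / G v) by rewrite ln_div ?posrE.
have ratio0 : 0 < G u / G v by rewrite divr_gt0.
have ratio0' : 0 < G v / G u by rewrite divr_gt0.
have up : ln (G u / G v) <= G u / G v - 1.
  by have := le_ln1Dx (x := G u / G v - 1); rewrite [1 + _]addrC subrK; apply; lra.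
have low : 1 - G v / G u <= ln (G u / G v).
  have := le_ln1Dx (x := G v / G u - 1); rewrite [1 + _]addrC subrK.
  have -> : ln (G v / G u) = - ln (G u / G v).
    by rewrite -lnV ?posrE// invf_div.
  have h1' : -1 < G v / G u - 1 by lra.
  by move=> /(_ h1'); lra.
have a1 : G u / G v - 1 <= (G u / G v) * (H v - H u).
  rewrite -(ler_pM2l gv); apply: le_trans (_ : _ <= G u - G v) _.
    by rewrite mulrBr mulrCA divff ?gt_eqF// !mulr1.
  by rewrite mulrA mulrCA divff ?gt_eqF// mulr1.
have a2 : (G v / G u) * (H v - H u) <= 1 - G v / G u.
  rewrite -(ler_pM2l gu); apply: (le_trans (y := G u - G v)).
    by rewrite mulrA mulrCA divff ?gt_eqF// mulr1.
  by rewrite mulrBr mulrCA divff ?gt_eqF// !mulr1.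
have inv_le : (G v)^-1 <= (G x)^-1 by rewrite lef_pV2 ?posrE.
have inv_le' : (G u)^-1 <= (G x)^-1.
  by rewrite lef_pV2 ?posrE// (le_trans Gvx).
have D0 : 0 <= (G u - G v) * (H v - H u).
  by apply: mulr_ge0 => //; rewrite subr_ge0.
rewrite /err lnE ler_norml; apply/andP; split.
  have : (1 - G v / G u) * (H v - H u) <= (G x)^-1 * ((G u - G v) * (H v - H u)).
    have -> : (1 - G v / G u) * (H v - H u) = (G u)^-1 * ((G u - G v) * (H v - H u)).
      by field; rewrite gt_eqF.
    by rewrite ler_wpM2r.
  by move: low a2; lra.
have : (G u / G v - 1) * (H v - H u) <= (G x)^-1 * ((G u - G v) * (H v - H u)).
  have -> : (G u / G v - 1) * (H v - H u) = (G v)^-1 * ((G u - G v) * (H v - H u)).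
    by field; rewrite gt_eqF.
  by rewrite ler_wpM2r.
by move: up a1; lra.
Qed.

(** Splitting where H takes the midpoint value halves the sum of the bounds on the
two pieces; H is continuous, so there is such a point. *)
Let err_bisect n u v : 0 <= u -> u <= v -> v <= x ->
  `|err u v| <= 2^-1 ^+ n * ((G x)^-1 * ((G u - G v) * (H v - H u))).
Proof.
elim: n u v => [|n IH] u v u0 uv vx; first by rewrite expr0 mul1r; exact: err_le.
have Hh := H_mono u0 uv vx.
have cHuv : {within `[u, v], continuous H}.
  apply: continuous_subspaceW cH => s /=; rewrite !in_itv/= => /andP[us sv].
  by rewrite (le_trans u0 us) (le_trans sv vx).
have [] := @IVT R H u v ((H u + H v) / 2) uv cHuv.
  by rewrite ge_min le_max; apply/andP; split; apply/orP; [left|right]; lra.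
move=> m; rewrite in_itv/= => /andP[um mv] Hm.
have m0 := le_trans u0 um; have mx := le_trans mv vx.
have e1 := IH u m u0 um mx; have e2 := IH m v m0 mv vx.
have -> : err u v = err u m + err m v by rewrite /err; ring.
apply: (le_trans (ler_normD _ _)); apply: (le_trans (lerD e1 e2)).
rewrite le_eqVlt; apply/orP; left; apply/eqP.
by rewrite Hm exprS; field; rewrite gt_eqF// G_pos.
Qed.

Lemma exponential_decay : G x = G 0 * expR (- (H x - H 0)).
Proof.
have e0 : err 0 x = 0.
  apply/eqP; rewrite -normr_le0.
  set c := (G x)^-1 * ((G 0 - G x) * (H x - H 0)).
  have cv : 2^-1 ^+ n * c @[n --> \oo] --> (0 : R).
    rewrite -(mul0r c); apply: cvgMl; apply: cvg_expr.
    by rewrite ger0_norm ?invr_ge0// invf_lt1// ltr1n.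
  by apply: (cvgr_to_ge cv); apply: nearW => n; exact: err_bisect.
have g0 := G_pos (lexx 0) x0; have gx := G_pos x0 (lexx x).
have : ln (G x) = ln (G 0) - (H x - H 0) by move: e0; rewrite /err; lra.
move=> /(congr1 expR); rewrite expRD !lnK ?posrE//.
Qed.

End exponential_uniqueness.

(** * From the terminal identity to the law *)

(** y / (y^2 + 1/n) is continuous and tends to y^-1, including at 0 where the
inverse is 0. *)
Lemma measurable_inv {R : realType} : measurable_fun setT (fun y : R => y^-1).
Proof.
have sq (y : R) : 0 <= y * y by rewrite -expr2 sqr_ge0.
apply: (@measurable_fun_cvg _ (measurableTypeR R) R setT
  (fun n y => y * (y * y + n.+1%:R^-1)^-1)) => [n|y _].
  apply: measurable_funTS; apply: continuous_measurable_fun => y.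
  apply: cvgM; first exact: cvg_id.
  apply: cvgV; first by rewrite gt_eqF// ltr_wpDl.
  by apply: cvgD; [apply: cvgM; exact: cvg_id|exact: cvg_cst].
have [->|y0] := eqVneq y 0.
  by under eq_fun do rewrite mul0r; rewrite invr0; exact: cvg_cst.
rewrite (_ : y^-1 = y * (y * y + 0)^-1); last by field.
apply: cvgM; first exact: cvg_cst.
apply: cvgV; first by rewrite addr0 mulf_neq0.
by apply: cvgD; [exact: cvg_cst|exact: cvg_harmonic].
Qed.

Section law.
Context {d : measure_display} {T : measurableType d} {R : realType}.
Variables (mu : probability T R) (V : {RV mu >-> R}) (lam : R -> R).
Hypothesis V0 : forall w, 0 <= V w.
Hypothesis mlam : measurable_fun setT lam.
Hypothesis lam_pos : {ae mu, forall w, 0 < lam (V w)}.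
Hypothesis lam1 : L1 mu (fun w => lam (V w)).
Hypothesis lamE : forall y, 0 <= y ->
  E mu (fun w => \1_[set w | V w <= y] w * lam (V w)) = E mu (fun w => Num.min (V w) y).

Local Notation leb := (@lebesgue_measure R).
Let mV : measurable_fun setT V. Proof. exact: measurable_funPT. Qed.
Let mV' : @measurable_fun _ _ T (measurableTypeR R) setT V. Proof. exact: mV. Qed.
Let W : {mfun T >-> measurableTypeR R} :=
  @mfun_Sub _ _ T (measurableTypeR R) V (mem_set mV').
Let nu : probability (measurableTypeR R) R := distribution mu W.
Let G z : R := fine (ccdf V z).
(* lam is positive only almost surely for the law of V *)
Let lamp z : R := Num.max (lam z) 0.

Let GE z : ccdf V z = (G z)%:E.
Proof. by rewrite /G fineK// fin_num_measure. Qed.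

Let mG : measurable_fun setT G.
Proof.
apply/measurable_EFinP; rewrite (_ : EFin \o G = ccdf V); first exact: ccdf_measurable.
by apply/funext => z /=; rewrite -GE.
Qed.

Let G0 z : 0 <= G z. Proof. by rewrite fine_ge0. Qed.

Let G1 z : G z <= 1.
Proof. by rewrite -lee_fin -GE probability_le1. Qed.

Let mlamp : measurable_fun setT lamp.
Proof. by apply: measurable_maxr => //; exact: measurable_cst. Qed.

Let lamp0 z : 0 <= lamp z. Proof. by rewrite le_max lexx orbT. Qed.

Let mVle y : measurable [set w | V w <= y].
Proof. by rewrite -[X in measurable X]setTI; apply: measurable_fun_ler. Qed.

(** The right-hand side is the mean of min(V, y), written with its tail. *)
Let layer_cake y : 0 <= y ->
  (\int[nu]_(z in `[0%R, y]) (lamp z)%:E = \int[leb]_(z in `[0%R, y]) (G z)%:E)%E.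
Proof.
move=> y0.
have mM : measurable_fun setT (fun w => Num.min (V w) y).
  by apply: measurable_minr => //; exact: measurable_cst.
have M1 : L1 mu (fun w => Num.min (V w) y).
  apply: (@L1_bounded _ _ _ _ _ y) => // w.
  by rewrite ger0_norm ?ge_min ?lexx ?orbT// le_min V0.
transitivity (\int[mu]_(w in [set w | (V w <= y)%R]) (lamp (V w))%:E)%E.
  rewrite ge0_integral_pushforward//; last 2 first.
  - by apply/measurable_EFinP; exact: measurable_funTS.
  - by move=> z _; rewrite lee_fin.
  congr (integral mu _ _); apply/seteqP; split => w /=; rewrite in_itv/= ?V0//.
transitivity (\int[mu]_(w in [set w | (V w <= y)%R]) (lam (V w))%:E)%E.
  apply: ae_eq_integral => //.
  - by apply/measurable_EFinP/measurable_funTS; exact: measurableT_comp.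
  - by apply/measurable_EFinP/measurable_funTS; exact: measurableT_comp.
  - by apply: filterS lam_pos => w h _; rewrite /lamp max_l// ltW.
rewrite -Ex_indic_EFin// lamE// Ex_EFin//.
pose M : {RV mu >-> R} := mfun_Sub (mem_set mM).
have M0 w : 0 <= M w by rewrite /M /= le_min V0.
have := ge0_expectation_ccdf M0; rewrite expectation_def => ->.
transitivity (\int[leb]_(z in `[0%R, y[) (G z)%:E)%E.
  rewrite [LHS]integral_mkcond [RHS]integral_mkcond; apply: eq_integral => z _.
  rewrite !patchE.
  have -> : (z \in [set` `[0%R, +oo[]) = (0 <= z) by apply/idP/idP; rewrite inE/= in_itv/= andbT.
  have -> : (z \in [set` `[0%R, y[]) = (0 <= z < y) by apply/idP/idP; rewrite inE/= in_itv.
  have [z0|//] := leP 0 z; rewrite /ccdf /distribution /pushforward.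
  have [zy|yz] := ltP z y => /=.
    rewrite -GE /ccdf /distribution /pushforward.
    rewrite (_ : M @^-1` _ = V @^-1` `]z, +oo[%classic)//.
    by apply/seteqP; split => w /=; rewrite !in_itv/= !andbT lt_min zy andbT.
  rewrite (_ : M @^-1` _ = set0) ?measure0//; apply/seteqP; split => // w /=.
  by rewrite in_itv/= andbT lt_min => /andP[_]; rewrite ltNge yz.
rewrite integral_itv_bndo_bndc//.
by apply/measurable_EFinP; exact: measurable_funTS.
Qed.

Section fixed_x.
Variables (x : R).
Hypothesis x0 : 0 <= x.

Local Notation D := (`[0%R, x]%classic : set R).

Let fin_nu B : measurable B ->
  (\int[nu]_(z in D `&` B) (lamp z)%:E < +oo)%E.
Proof.
move=> mB; apply: (@le_lt_trans _ _ (\int[nu]_(z in D) (lamp z)%:E)%E).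
  apply: ge0_subset_integral => //; first exact: measurableI.
  - by apply/measurable_EFinP; exact: measurable_funTS.
  - by move=> z _; rewrite lee_fin.
rewrite layer_cake//; apply: (@le_lt_trans _ _ (\int[leb]_(z in D) 1%:E)%E).
  apply: ge0_le_integral => //.
  - by move=> z _; rewrite lee_fin.
  - by apply/measurable_EFinP; exact: measurable_funTS.
  - by move=> z _; rewrite lee_fin.
rewrite integral_cst//; have /= lebD := @lebesgue_measure_itv R `[0%R, x].
rewrite mul1e; apply: (@le_lt_trans _ _ _ _ _
  (eq_ind_r (fun u => (u <= _)%E) (lexx _) lebD)).
by case: ifP => _; rewrite ?ltry.
Qed.

(** Half-lines generate the sigma-algebra and are stable by intersection; for them
this is a difference of two instances of [layer_cake]. *)
Lemma law_density B : measurable B ->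
  (\int[nu]_(z in D `&` B) (lamp z)%:E = \int[leb]_(z in D `&` B) (G z)%:E)%E.
Proof.
move: B; pose H : set (set R) := [set B | measurable B /\
  (\int[nu]_(z in D `&` B) (lamp z)%:E = \int[leb]_(z in D `&` B) (G z)%:E)%E].
suff : measurable `<=` H by move=> h B /h[].
have ml B : measurable_fun B (EFin \o lamp) by apply/measurable_EFinP; exact: measurable_funTS.
have mg B : measurable_fun B (EFin \o G) by apply/measurable_EFinP; exact: measurable_funTS.
have split_ (m : {measure set (measurableTypeR R) -> \bar R}) (f : R -> R) A B :
    (forall z, 0 <= f z) -> measurable_fun setT f -> measurable A -> measurable B ->
    B `<=` A -> (\int[m]_(z in D `&` A) (f z)%:E =
     \int[m]_(z in D `&` (A `\` B)) (f z)%:E + \int[m]_(z in D `&` B) (f z)%:E)%E.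
  move=> f0 mf mA mB BA; rewrite -ge0_integral_setU//.
  - by rewrite -setIUr [(_ `\` _) `|` _]setUC setDUK.
  - by apply: measurableI => //; exact: measurableD.
  - exact: measurableI.
  - by apply/measurable_EFinP; exact: measurable_funTS.
  - by move=> z _; rewrite lee_fin.
  - by apply/disj_setPS => z [[_ [_ nB]] [_ Bz]].
have HD A B : H A -> H B -> B `<=` A -> H (A `\` B).
  move=> [mA hA] [mB hB] BA; split; first exact: measurableD.
  move: hA; rewrite (split_ nu lamp A B)// (split_ leb G A B)// hB.
  have finB : (\int[leb]_(z in D `&` B) (G z)%:E)%E \is a fin_num.
    by rewrite -hB ge0_fin_numE ?fin_nu// integral_ge0// => z _; rewrite lee_fin.
  by move=> /(congr1 (fun u => u - \int[leb]_(z in D `&` B) (G z)%:E)%E); rewrite !addeK.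
have HT : H setT by split => //; rewrite setIT layer_cake.
change ((@ocitv R).-sigma.-measurable `<=` H); rewrite RGenOInfty.measurableE.
apply: lambda_system_subset => //.
- move=> A B [a ->] [b ->]; exists (Num.max a b); apply/seteqP; split => z /=.
    by rewrite !in_itv/= !andbT gt_max => -[-> ->].
  by rewrite !in_itv/= !andbT gt_max => /andP[].
- split => //.
    by move=> B A BA HA HB; exact: HD.
  move=> B ndB HB; split; first by apply: bigcupT_measurable => i; case: (HB i).
  rewrite setI_bigcupr.
  have ndDB : nondecreasing_seq (fun i => D `&` B i).
    by move=> m n mn; apply/subsetPset; apply: setIS; apply/subsetPset/ndB.
  have mDB i : measurable (D `&` B i).
    by apply: measurableI => //; case: (HB i).
  have c1 := @ge0_nondecreasing_set_cvg_integral _ (measurableTypeR R) _ (fun i => D `&` B i)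
    (EFin \o lamp) nu ndDB mDB (fun i => ml _) (fun _ z _ => lamp0 z).
  have c2 := @ge0_nondecreasing_set_cvg_integral _ (measurableTypeR R) R
    (fun i => D `&` B i) (EFin \o G) leb ndDB mDB (fun i => mg _) (fun _ z _ => G0 z).
  apply: (cvg_unique (@ereal_hausdorff R) c1).
  rewrite (_ : (fun i => _) = (fun i => \int[leb]_(z in D `&` B i) (G z)%:E)%E) //.
  by apply/funext => i; case: (HB i).
- move=> B [a ->]; have [a0|a0] := ltP a 0.
    split => //; rewrite (_ : D `&` _ = D) ?layer_cake//.
    apply/seteqP; split => z /=; first by case.
    by rewrite !in_itv/= => /andP[z0 zx]; rewrite z0 zx (lt_le_trans a0).
  rewrite -(setCK `]a, +oo[%classic) -setTD; apply: HD => //.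
  split; first exact: measurableC.
  have [ax|xa] := leP a x.
    rewrite (_ : D `&` _ = `[0%R, a]%classic) ?layer_cake//.
    apply/seteqP; split => z /=; rewrite !in_itv/= andbT.
      by move=> [/andP[z0 zx] /negP]; rewrite -leNgt z0.
    by move=> /andP[z0 za]; split; [rewrite z0 (le_trans za)|apply/negP; rewrite -leNgt].
  rewrite (_ : D `&` _ = D) ?layer_cake//.
  apply/seteqP; split => z /=; first by case.
  rewrite !in_itv/= andbT => /andP[z0 zx]; split; first by rewrite z0.
  by apply/negP; rewrite -leNgt (le_trans zx)// ltW.
Qed.

Let rho z : R := (lamp z)^-1.

Let rho0 z : 0 <= rho z. Proof. by rewrite invr_ge0. Qed.

Let mrho : measurable_fun setT rho.
Proof. exact: (measurableT_comp (@measurable_inv R) mlamp). Qed.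

Let nu_le : nu D = (1 - G x)%:E.
Proof.
rewrite EFinB -(cdf_ccdf_1 V x) GE addeK//.
rewrite /cdf /nu /distribution /pushforward; congr (mu _).
by apply/seteqP; split => w /=; rewrite !in_itv/= V0.
Qed.

Lemma law_integral : (\int[leb]_(z in D) (rho z * G z)%:E = (1 - G x)%:E)%E.
Proof.
have mrho' : measurable_wrt (@measurable _ (measurableTypeR R)) rho.
  by move=> B mB; rewrite -[_ @^-1` _]setTI; exact: mrho.
have := @integral_same_density _ (measurableTypeR R) R nu leb D lamp G _
  (@sigma_algebra_measurable _ (measurableTypeR R)) (@subset_refl _ _) (measurable_itv _)
  mlamp mG lamp0 G0 law_density rho mrho' rho0.
under [in RHS]eq_integral do rewrite -EFinM.
move=> <-; rewrite -nu_le.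
rewrite (_ : nu D = \int[nu]_(z in D) 1%:E)%E; last by rewrite integral_cst// mul1e.
apply: ae_eq_integral => //.
- by apply: emeasurable_funM; apply/measurable_EFinP; exact: measurable_funTS.
have [N [mN N0 sN]] := lam_pos.
exists [set z | lam z <= 0]; split.
- by rewrite -[X in measurable X]setTI; apply: measurable_fun_ler => //; exact: measurable_cst.
- rewrite /nu /distribution /pushforward.
  apply: (subset_measure0 _ mN _ N0).
    rewrite -[X in measurable X]setTI; apply: mV => //.
    by rewrite -[X in measurable X]setTI; apply: measurable_fun_ler => //; exact: measurable_cst.
  by move=> w /= h; apply: sN => /=; apply/negP; rewrite -leNgt.
move=> z /= h; rewrite leNgt; apply/negP => lz; apply: h => _.
by rewrite -EFinM /rho /lamp max_l ?ltW// mulVf ?gt_eqF.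
Qed.

End fixed_x.

(** The identity [law_integral] on subintervals traps the decrement of G between
G v and G u times the increment of the integral of 1 / lam.  The hypothesis on
the tail makes this integral finite. *)
Lemma law_formula x : 0 <= x -> (0 < mu [set w | (x < V w)%R])%E ->
  (mu [set w | (x < V w)%R] =
   expeR (- \int[leb]_(z in `[0%R, x]) ((lam z)^-1)%:E))%E.
Proof.
move=> x0.
have -> : mu [set w | (x < V w)%R] = (G x)%:E.
  rewrite -GE /ccdf /distribution /pushforward; congr (mu _).
  by apply/seteqP; split => w /=; rewrite in_itv/= andbT.
rewrite lte_fin => Gx.
pose rho z : R := (Num.max (lam z) 0)^-1.
have rho0 z : 0 <= rho z by rewrite invr_ge0 le_max lexx orbT.
have mrho : measurable_fun setT rho.
  exact: (measurableT_comp (@measurable_inv R) mlamp).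
have G_mono u v : u <= v -> G v <= G u.
  by move=> uv; rewrite -lee_fin -!GE; exact: ccdf_nonincreasing.
have law y : 0 <= y -> (\int[leb]_(z in `[0%R, y]) (rho z * G z)%:E = (1 - G y)%:E)%E.
  exact: law_integral.
have mrG B : measurable_fun B (fun z : R => (rho z * G z)%:E).
  by apply/measurable_EFinP; apply: measurable_funTS; exact: measurable_funM.
have rho1 : leb.-integrable `[0%R, x] (EFin \o rho).
  apply/integrableP; split; first by apply/measurable_EFinP; exact: measurable_funTS.
  apply: (@le_lt_trans _ _ (\int[leb]_(z in `[0%R, x]) (((G x)^-1)%:E * (rho z * G z)%:E))%E).
    apply: ge0_le_integral => //.
    - by apply: measurableT_comp => //; apply/measurable_EFinP; exact: measurable_funTS.
    - apply/measurable_EFinP; apply: measurable_funTS.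
      by apply: measurable_funM; [exact: measurable_cst|exact: measurable_funM].
    move=> z /=; rewrite in_itv/= => /andP[z0 zx].
    rewrite lee_fin ger0_norm// mulrC -mulrA ler_peMr//.
    by rewrite ler_pdivlMr// mul1r G_mono.
  rewrite ge0_integralZl//.
  - by rewrite law// -EFinM ltry.
  - exact: mrG.
  - by move=> z _; rewrite lee_fin mulr_ge0.
  - by rewrite lee_fin invr_ge0.
have rhoG1 : leb.-integrable `[0%R, x] (EFin \o (fun z => rho z * G z)).
  apply: (le_integrable _ _ _ rho1) => //.
    by apply/measurable_EFinP; apply: measurable_funTS; exact: measurable_funM.
  move=> z _ /=; rewrite lee_fin normrM ler_piMr//.
  by rewrite ger0_norm// G1.
pose H y : R := \int[leb]_(z in `[0, y]) rho z.
have subI v : v <= x -> `[0%R, v] `<=` `[0%R, x].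
  move=> vx z /=; rewrite !in_itv/= => /andP[-> zv] /=; exact: le_trans vx.
have HB u v : 0 <= u -> u <= v -> v <= x ->
    H v - H u = \int[leb]_(z in `]u, v]) rho z.
  move=> u0 uv vx; rewrite /H Rintegral_itvB//.
  by apply: integrableS rho1 => //; exact: subI vx.
have GB u v : 0 <= u -> u <= v -> v <= x ->
    G u - G v = \int[leb]_(z in `]u, v]) (rho z * G z).
  move=> u0 uv vx; rewrite -(@Rintegral_itvB _ _ (BLeft 0) (BRight v))//; last first.
    by apply: integrableS rhoG1 => //; exact: subI vx.
  by rewrite /Rintegral !law ?(le_trans u0)//=; lra.
have iS u v (f : R -> R) : 0 <= u -> v <= x -> leb.-integrable `[0%R, x] (EFin \o f) ->
    leb.-integrable `]u, v] (EFin \o f).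
  move=> u0 vx; apply: integrableS => //.
  move=> z /=; rewrite !in_itv/= => /andP[uz zv].
  by rewrite (le_trans u0 (ltW uz)) (le_trans zv vx).
have Hx : G x = G 0 * expR (- (H x - H 0)).
  apply: exponential_decay => //.
  - exact: parameterized_integral_continuous.
  - by move=> u _ ux; rewrite (lt_le_trans Gx)// G_mono.
  - by move=> u v u0 uv vx; rewrite HB//; exact: Rintegral_ge0.
  - move=> u v u0 uv vx; rewrite HB// GB//.
    have i1 := iS u v rho u0 vx rho1; have i2 := iS u v _ u0 vx rhoG1.
    rewrite -!RintegralZl//; split; apply: le_Rintegral => //.
    + exact: (integrableZl _ _ i1).
    + move=> z /=; rewrite in_itv/= => /andP[uz zv].
      by rewrite mulrC ler_wpM2l// G_mono.
    + exact: (integrableZl _ _ i1).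
    + move=> z /=; rewrite in_itv/= => /andP[uz zv].
      by rewrite [leRHS]mulrC ler_wpM2l// G_mono// ltW.
have H0 : H 0 = 0 by rewrite /H set_itv1 Rintegral_set1.
have G00 : G 0 = 1.
  have := law 0 (lexx 0); rewrite set_itv1 integral_set1 => // -[]; lra.
rewrite Hx G00 H0 subr0 mul1r.
suff -> : (\int[leb]_(z in `[0%R, x]) ((lam z)^-1)%:E = (H x)%:E)%E by [].
rewrite /H fineK; last exact: integrable_fin_num.
apply: ae_eq_integral => //.
- apply/measurable_EFinP; apply: measurable_funTS.
  exact: (measurableT_comp (@measurable_inv R) mlam).
- by apply/measurable_EFinP; exact: measurable_funTS.
(* lam and its positive part differ on a set of zero Lebesgue measure, as G > 0 *)
pose B := [set z | lam z < 0].
have mB : measurable B.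
  rewrite -[X in measurable X]setTI; apply: measurable_fun_ltr => //; exact: measurable_cst.
exists (`[0%R, x] `&` B); split.
- exact: measurableI.
- have := law_density x0 mB.
  rewrite (_ : (\int[nu]_(z in _) _ = 0)%E); last first.
    by apply: integral0_eq => z [_ /= lz]; rewrite /lamp max_r// ltW.
  move=> h; apply/eqP; rewrite eq_le measure_ge0 andbT.
  have mDB : measurable (`[0%R, x] `&` B) by exact: measurableI.
  have : ((G x)%:E * leb (`[0%R, x] `&` B) <= 0)%E.
    rewrite h -integral_cst; last exact: measurableI.
    apply: ge0_le_integral => //.
    + by move=> z _; rewrite lee_fin ltW.
    + by apply/measurable_EFinP; exact: measurable_funTS.
    + move=> z [/=]; rewrite in_itv/= => /andP[_ zx] _; by rewrite lee_fin G_mono.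
  by rewrite pmule_rle0.
move=> z /= /not_implyP[zD nz]; split => //; rewrite /B /= ltNge; apply/negP => lz.
by apply: nz; rewrite /rho max_l.
Qed.

End law.

(** * Modification on null sets *)

Lemma ae_dominates {d} {T : measurableType d} {R : realType} (m1 m2 : {measure set T -> \bar R})
  (H : set T) : m1 `<< m2 -> {ae m2, forall w, H w} -> {ae m1, forall w, H w}.
Proof.
move=> /null_content_dominatesP m12 [B [mB B0 sB]].
by exists B; split => //; exact: m12.
Qed.

Section completion.
Context {d : measure_display} {T : measurableType d} {R : realType}.
Variables (P : probability T R) (F : R -> set (set T)).
Hypothesis hF : usual_filtration P F.

Lemma complete_measurable_set (B : set T) : P.-negligible B -> measurable B.
Proof. by move=> nB; exact: (filtration_measurable hF (lexx 0) (filtration_complete hF nB)). Qed.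

Lemma complete_measurable_fun (f g : T -> R) : measurable_fun setT g ->
  {ae P, forall w, f w = g w} -> measurable_fun setT f.
Proof.
move=> mg fg _ S mS; rewrite setTI.
pose B := [set w | f w = g w].
have mB : measurable B by rewrite -[B]setCK; apply/measurableC/complete_measurable_set.
rewrite (_ : f @^-1` S = (B `&` g @^-1` S) `|` (~` B `&` f @^-1` S)); last first.
  apply/seteqP; split => w /=; last by case=> [[<-]|[]].
  by move=> fS; have [Bw|nBw] := pselect (B w); [left; split => //; rewrite -Bw|right].
apply: measurableU; last first.
  by apply: complete_measurable_set; apply: negligibleS fg; exact: subIsetl.
by apply: measurableI => //; rewrite -[_ @^-1` _]setTI; exact: mg.
Qed.

Lemma complete_measurable_cvg (h : nat -> T -> R) (f : T -> R) :
  (forall n, measurable_fun setT (h n)) ->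
  {ae P, forall w, h n w @[n --> \oo] --> f w} -> measurable_fun setT f.
Proof.
move=> mh hf; pose B := [set w | h n w @[n --> \oo] --> f w].
have mB : measurable B by rewrite -[B]setCK; apply/measurableC/complete_measurable_set.
apply: (@complete_measurable_fun _ (fun w => \1_B w * f w)); last first.
  by apply: filterS hf => w Bw; rewrite indicE mem_set// mul1r.
apply: (measurable_fun_cvg (fun n => _ : measurable_fun setT (fun w => \1_B w * h n w))).
  by move=> n; apply: measurable_funM => //; exact: measurable_indic.
move=> w _; have [Bw|nBw] := pselect (B w).
  by rewrite indicE mem_set//; under eq_fun do rewrite mul1r; rewrite mul1r.
by rewrite indicE memNset//; under eq_fun do rewrite mul0r; rewrite mul0r; exact: cvg_cst.
Qed.

Lemma full_set_F (B : set T) t : {ae P, forall w, B w} -> 0 <= t -> F t B.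
Proof.
move=> aeB t0; rewrite -[B]setCK; apply: (sigma_setC (filtration_sigma hF t0)).
exact: (filtration_nondecreasing hF (lexx 0) t0 (filtration_complete hF aeB)).
Qed.

(** Time is clamped to the half-line, so that paths live on all of R and are
continuous from both sides at 0; off B the path is the constant c. *)
Definition modify (B : set T) (c : R) (Y : R -> T -> R) (t : R) (w : T) : R :=
  if w \in B then Y (Num.max 0 t) w else c.

Lemma modify_ge0 B c Y t w : 0 <= t -> B w -> modify B c Y t w = Y t w.
Proof. by move=> t0 Bw; rewrite /modify mem_set// max_r. Qed.

Lemma adapted_modify (B : set T) c Y : {ae P, forall w, B w} -> adapted F Y ->
  adapted F (modify B c Y).
Proof.
move=> aeB aY t t0 S mS; have sF := filtration_sigma hF t0.
rewrite (_ : _ @^-1` _ = (B `&` Y t @^-1` S) `|` (~` B `&` [set _ | S c])); last first.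
  apply/seteqP; split => w /=; rewrite /modify max_r//.
    by have [/set_mem|/negP h] := boolP (w \in B); [left|right; split => // /mem_set].
  by case=> [[Bw]|[nBw]]; [rewrite mem_set|rewrite memNset].
have FB := full_set_F aeB t0; apply: (sigma_setU sF).
  by apply: (sigma_setI sF) => //; exact: aY.
apply: (sigma_setI sF); first exact: (sigma_setC sF).
have [Sc|nSc] := pselect (S c).
  by rewrite (_ : mkset _ = setT); [exact: (sigma_setT sF)|apply/seteqP; split].
by rewrite (_ : mkset _ = set0); [case: sF|apply/seteqP; split].
Qed.

Lemma martingale_modify (B : set T) Y Z : {ae P, forall w, B w} -> martingale P F Y ->
  (forall t w, 0 <= t -> Z t w = if w \in B then Y t w else 0) ->
  martingale P F Z.
Proof.
move=> aeB [aY iY mY] ZE.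
have Zt t : 0 <= t -> Z t = modify B 0 Y t.
  by move=> t0; apply/funext => w; rewrite ZE// /modify max_r.
have aZ : adapted F Z by move=> t t0; rewrite Zt//; exact: adapted_modify.
have mF t (f : T -> R) : 0 <= t -> measurable_wrt (F t) f -> measurable_fun setT f.
  by move=> t0; apply: sub_measurable_fun; exact: (filtration_sub hF).
have YZ t : 0 <= t -> {ae P, forall w, Y t w = Z t w}.
  by move=> t0; apply: filterS aeB => w Bw; rewrite ZE// mem_set.
split => // [t t0|s t s0 st C FC].
  by apply: (L1_ae _ (YZ t t0)); [exact: (mF t _ t0 (aZ t t0))|exact: iY].
have t0 := le_trans s0 st; have mC := filtration_measurable hF s0 FC.
have eqC u : 0 <= u -> (\int[P]_(w in C) (Z u w)%:E = \int[P]_(w in C) (Y u w)%:E)%E.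
  move=> u0; apply: ae_eq_integral => //.
  - by apply/measurable_EFinP/measurable_funTS/(mF u _ u0); exact: aZ.
  - by apply/measurable_EFinP/measurable_funTS/(mF u _ u0); exact: aY.
  - by apply: filterS (YZ u u0) => w ->.
by rewrite !eqC//; exact: mY.
Qed.

(** This is where the right-continuity of the filtration is used. *)
Lemma optional_stopping_time N (S : T -> R) : optional_time F 0 N S ->
  stopping_time F (EFin \o S).
Proof.
move=> oS; split => [w|t t0]; first by rewrite lee_fin (optional_ge oS).
apply: (filtration_right_continuous hF t0) => s /= ts.
have s0 : 0 <= s by rewrite (le_trans t0)// ltW.
rewrite (_ : mkset _ = \bigcap_(n : nat) [set w | S w < Num.min s (t + n.+1%:R^-1)]); last first.
  apply/seteqP; split => w /=; rewrite lee_fin.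
    move=> St n _ /=; rewrite lt_min (le_lt_trans St ts)/=.
    by rewrite (le_lt_trans St)// ltrDl.
  move=> h; rewrite leNgt; apply/negP => tS.
  have e0 : 0 < S w - t by rewrite subr_gt0.
  near \oo => n; have /= := h n I; rewrite lt_min => /andP[_].
  apply/negP; rewrite -leNgt -lerBrDl ltW//.
  by near: n; exact: (near_infty_natSinv_lt (PosNum e0)).
apply: (F_bigcap hF) => // n.
have m0 : 0 <= Num.min s (t + n.+1%:R^-1) by rewrite le_min s0 addr_ge0.
apply: (filtration_nondecreasing hF m0); first by rewrite ge_min lexx.
exact: (optional_lt oS).
Unshelve. all: by end_near. Qed.

End completion.

Section class_D_bounds.
Context {d : measure_display} {T : measurableType d} {R : realType}.
Variables (P P' : probability T R) (F : R -> set (set T)).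
Hypothesis hF : usual_filtration P F.
Variables (X X' : R -> T -> R).
Hypothesis aX' : adapted F X'.
Hypothesis rX' : forall w r, right_continuous (X' ^~ w) r.
Hypothesis X'0 : forall t w, 0 <= X' t w.
Hypothesis XX' : {ae P, forall w, forall t, 0 <= t -> X t w = X' t w}.
Hypothesis P'P : P' `<< P.
Hypothesis hD : class_D P' F X.

Let value_m N S : optional_time F 0 N S -> measurable_fun setT (fun w => X' (S w) w).
Proof. by move=> oS; apply: (value_measurable hF (lexx 0) oS) => //; move=> t; exact: aX'. Qed.

(** The excess of |X_S| over k is at most |X_S| on the event that it exceeds k. *)
Let excess e : 0 < e -> exists k, forall N S, optional_time F 0 N S ->
  (\int[P']_w (Num.max 0 (X' (S w) w - k))%:E <= e%:E)%E.
Proof.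
move=> e0; have [k hk] := hD e0; exists `|k| => N S oS.
have mh := value_m oS.
have XS : {ae P, forall w, X (S w) w = X' (S w) w}.
  by apply: filterS XX' => w h; apply: h; exact: (optional_ge oS).
have mf : measurable_fun setT (fun w => X (S w) w) := complete_measurable_fun hF mh XS.
have XS' : {ae P', forall w, X (S w) w = X' (S w) w} := ae_dominates P'P XS.
pose f w := X (S w) w; pose C := [set w | k <= `|f w|].
have mC : measurable C.
  rewrite /C -[X in measurable X]setTI; apply: measurable_fun_ler => //.
  exact: measurableT_comp.
apply: (@le_trans _ _ (\int[P']_(w in C) `|f w|%:E)%E); last first.
  apply: hk; exists (EFin \o S) => //; split; last by move=> w; rewrite ltry.
  exact: (optional_stopping_time hF oS).
rewrite [leRHS]integral_mkcond; apply: ae_ge0_le_integral => //.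
- by move=> w _; rewrite lee_fin le_max lexx.
- apply/measurable_EFinP; apply: measurable_maxr; first exact: measurable_cst.
  by apply: measurable_funB => //; exact: measurable_cst.
- by move=> w _; rewrite patchE; case: ifP.
- apply/(measurable_restrictT _ mC)/measurable_EFinP/measurable_funTS.
  exact: measurableT_comp.
apply: filterS XS' => w fh _; rewrite patchE; have [/set_mem|] := boolP (w \in C).
  rewrite /C /= /f fh => _; rewrite lee_fin ge_max normr_ge0/= (ger0_norm (X'0 _ _)).
  by rewrite lerBlDr lerDl.
move=> /negP nC; rewrite max_l//; rewrite subr_le0 leNgt; apply/negP => kh; apply: nC.
by apply/mem_set; rewrite /C /f /= fh (le_trans (ler_norm k))// (le_trans (ltW kh))// ler_norm.
Qed.

Lemma class_D_L1 N S : optional_time F 0 N S -> L1 P' (fun w => X' (S w) w).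
Proof.
move=> oS; have [k hk] := excess ltr01; have mh := value_m oS.
apply: (@L1_le _ _ _ _ _ (fun w => Num.max 0 (X' (S w) w - k) + `|k|)) => // [w|].
  rewrite ger0_norm// -lerBlDr le_max; apply/orP; right; rewrite lerB//; exact: ler_norm.
apply: L1D; last exact: L1_cst.
apply/integrableP; split.
  apply/measurable_EFinP; apply: measurable_maxr; first exact: measurable_cst.
  by apply: measurable_funB => //; exact: measurable_cst.
apply: le_lt_trans (ltry 1); apply: le_trans (hk N S oS).
by under eq_integral do rewrite /= ger0_norm ?le_max ?lexx//.
Qed.

Lemma class_D_excess e : 0 < e -> exists k, forall N S, optional_time F 0 N S ->
  E P' (fun w => Num.max 0 (X' (S w) w - k)) <= e.
Proof.
move=> e0; have [k hk] := excess e0; exists k => N S oS.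
have mh := value_m oS; have i1 := class_D_L1 oS.
rewrite -lee_fin Ex_EFin ?hk//; first exact: hk oS.
apply: (@L1_le _ _ _ _ _ (fun w => X' (S w) w + `|k|)); last by apply: L1D => //; exact: L1_cst.
  apply: measurable_maxr; first exact: measurable_cst.
  by apply: measurable_funB => //; exact: measurable_cst.
move=> w; rewrite ger0_norm ?le_max ?lexx// ge_max addr_ge0//= lerD//.
by rewrite -normrN ler_norm.
Qed.

End class_D_bounds.

(** * The law of the terminal value *)

Section paths_on_the_line.
Context {R : realType}.
Implicit Types (y : R -> R).

Lemma continuous_path_extension y : continuous_path y ->
  continuous (fun t : R => y (Num.max 0 t)).
Proof.
move=> /subspace_continuousP cy t.
have h0 : `[0, +oo[%classic (Num.max 0 t) by rewrite /= in_itv/= andbT le_max lexx.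
have cm : {for t, continuous (fun x : R => Num.max 0 x)}.
  apply: (@continuous_max R _ (cst 0 : R -> R^o) (id : R -> R^o)); [exact: cvg_cst|exact: cvg_id].
apply: cvg_trans (cy _ h0) => U /= hU; have := cm _ hU.
apply: (filterS (P := (fun x : R => `[0%R, +oo[%classic (Num.max 0 x) -> U (y (Num.max 0 x))))) => x /= h.
by apply: h; rewrite in_itv/= andbT le_max lexx.
Qed.

Lemma right_continuous_extension y r : (forall t, 0 <= t -> y x @[x --> t^'+] --> y t) ->
  right_continuous (fun t : R => y (Num.max 0 t)) r.
Proof.
move=> ry u _; have [u0|u0] := leP 0 u.
  apply: cvg_trans (ry u u0); apply: near_eq_cvg; near=> x.
  by rewrite max_r// (le_trans u0)// ltW//; near: x; exact: nbhs_right_gt.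
apply: cvg_near_cst; near=> x; rewrite max_l//.
by near: x; exact: nbhs_right_le.
Unshelve. all: by end_near. Qed.

(** The interval ]u, v] has path measure y v - y u > 0, so it is not contained in
the null set N. *)
Lemma path_measure_charges y (N : set R) u v : null_for_path_measure y N ->
  0 <= u -> u < v -> y u < y v -> exists2 s, `]u, v]%classic s & ~ N s.
Proof.
move=> [a aE [B [mB B0 NB]]] u0 uv yuv; apply: contrapT => h.
have uvB : `]u, v]%classic `<=` B.
  by move=> s us; apply: NB; apply: contrapT => nN; apply: h; exists s.
have : (lebesgue_stieltjes_measure a `]u, v]%classic <= lebesgue_stieltjes_measure a B)%E.
  by apply: le_measure; rewrite ?inE.
rewrite B0 /lebesgue_stieltjes_measure /measure_extension/=.
rewrite measurable_mu_extE/= ?wlength_itv_bnd//; [|exact: ltW|exact: is_ocitv].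
by rewrite !aE !max_r ?(ltW (le_lt_trans u0 uv))// lee_fin subr_le0 leNgt yuv.
Qed.

End paths_on_the_line.

Section regular_version.
Context {d : measure_display} {T : measurableType d} {R : realType}.
Variables (P P' : probability T R) (Q : {charge set T -> \bar R}) (F : R -> set (set T)).
Variables (D : R -> T -> R) (Dinf : T -> R) (X M A : R -> T -> R) (tau : nat -> T -> \bar R).
Hypothesis hsetting : signed_measure_setting P Q F D Dinf.
Hypothesis hP' : normalized_variation P Dinf P'.
Hypothesis hX : class_SigmaH P F D X M A.
Hypothesis hD : class_D P' F X.
Hypothesis hXg : {ae P, forall w, value_at X (gbar D) w = 0}.
Hypothesis hAg : {ae P, forall w, value_at A (gbar D) w = 0}.
Hypothesis tau_stop : forall n, stopping_time F (tau n).
Hypothesis tau_lim : {ae P, forall w, tau n w @[n --> \oo] --> +oo%E}.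
Hypothesis tau_mart : forall n, martingale P F
  (fun t w => stopped (fun t w => M t w * D t w) (tau n) t w - M 0 w * D 0 w).

Let hF := setting_filtration hsetting.

(** The paths for which all the almost sure hypotheses hold. *)
Let good : set T := [set w |
  [/\ continuous_path (D ^~ w), cadlag_path (M ^~ w), M 0 w = 0 &
      forall t, 0 <= t -> X t w = M t w + A t w] /\
  [/\ forall t, 0 <= t -> 0 <= X t w, continuous_path (A ^~ w),
      nondecreasing_path (A ^~ w) & A 0 w = 0] /\
  [/\ null_for_path_measure (A ^~ w) (`[0, +oo[ `\` ([set t | X t w = 0] `|` zeros D w)),
      tau n w @[n --> \oo] --> +oo%E,
      value_at X (gbar D) w = 0 & value_at A (gbar D) w = 0]].

Let good_ae : {ae P, forall w, good w}.
Proof.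
have h1 := setting_continuous hsetting; have h2 := SigmaH_M_cadlag hX.
have h3 := SigmaH_M0 hX; have h4 := SigmaH_decomposition hX.
have h5 := SigmaH_ge0 hX; have h6 := SigmaH_A_continuous hX.
have h7 := SigmaH_A_nondecreasing hX; have h8 := SigmaH_A0 hX.
have h9 := SigmaH_carried hX.
have aeI (p q : set T) : {ae P, forall w, p w} -> {ae P, forall w, q w} ->
    {ae P, forall w, p w /\ q w} by apply: filterS2 => w; split.
have k1 := aeI _ _ (aeI _ _ h1 h2) (aeI _ _ h3 h4).
have k2 := aeI _ _ (aeI _ _ h5 h6) (aeI _ _ h7 h8).
have k3 := aeI _ _ (aeI _ _ h9 tau_lim) (aeI _ _ hXg hAg).
apply: filterS (aeI _ _ k1 (aeI _ _ k2 k3)) => w.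
by move=> [[[? ?] [? ?]] [[[? ?] [? ?]] [[? ?] [? ?]]]]; split; [split|split; split].
Qed.

Let D' := modify good 1 D.
Let X' := modify good 0 X.
Let A' := modify good 0 A.
(** Off the good paths D' = 1 and X' = A' = 0, which satisfies all requirements,
with tau' = +oo. *)
Let tau' n w := if w \in good then tau n w else +oo%E.

Let aD' : forall t, 0 <= t -> measurable_wrt (F t) (D' t).
Proof.
move=> t t0; apply: (adapted_modify hF) t0 => // u u0.
by case: (setting_density hsetting u0).
Qed.

Let bad c Y w : ~ good w -> (modify good c Y) ^~ w = (fun=> c) :> (R -> R).
Proof. by move=> nw; apply/funext => t; rewrite /modify memNset. Qed.

Let nice c Y w : good w -> (modify good c Y) ^~ w = (fun t => Y (Num.max 0 t) w) :> (R -> R).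
Proof. by move=> nw; apply/funext => t; rewrite /modify mem_set. Qed.

Let cD' : forall w, continuous (D' ^~ w).
Proof.
move=> w; have [gw|bw] := pselect (good w); last by rewrite bad// => t; exact: cvg_cst.
rewrite nice//; apply: (@continuous_path_extension _ (D ^~ w)); by case: gw => [[]].
Qed.

Let aX' : forall t, 0 <= t -> measurable_wrt (F t) (X' t).
Proof. by apply: (adapted_modify hF) => //; case: (SigmaH_semimartingale hX). Qed.

Let rX' : forall w r, right_continuous (X' ^~ w) r.
Proof.
move=> w r; have [gw|bw] := pselect (good w); last by rewrite bad// => t _; exact: cvg_cst.
rewrite nice//; apply: (@right_continuous_extension _ (X ^~ w)) => t t0.
case: gw => [[_ [rM _] _ XE] [[_ cA _ _] _]].
rewrite XE//.
have : (M x w + (A (Num.max 0 x) w)) @[x --> t^'+] --> M t w + A t w.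
  apply: cvgD; first exact: rM.
  rewrite -[in X in _ --> X](max_r t0); apply: cvg_within_filter.
  exact: (@continuous_path_extension _ (A ^~ w)).
apply: cvg_trans; apply: near_eq_cvg; near=> x.
have x0 : 0 <= x by rewrite (le_trans t0)// ltW//; near: x; exact: nbhs_right_gt.
by rewrite max_r// XE.
Unshelve. all: by end_near. Qed.

Let X'0 : forall t w, 0 <= X' t w.
Proof.
move=> t w; rewrite /X' /modify; case: ifPn => // /set_mem gw.
by case: gw => [_ [[h _ _ _] _]]; rewrite h// le_max lexx.
Qed.

(** Adaptedness of A comes from A = X - M. *)
Let aA' : forall t, 0 <= t -> measurable_wrt (F t) (A' t).
Proof.
rewrite (_ : A' = modify good 0 (fun t w => X t w - M t w)); last first.
  apply/funext => t; apply/funext => w; rewrite /A' /modify; case: ifPn => // /set_mem gw.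
  by case: gw => [[_ _ _ ->]] //; [rewrite addrC addKr|rewrite le_max lexx].
apply: (adapted_modify hF) => // t t0.
have /measurable_wrtP mX : measurable_wrt (F t) (X t).
  by case: (SigmaH_semimartingale hX) => + _ _; apply.
have /measurable_wrtP mM : measurable_wrt (F t) (M t).
  by case: (SigmaH_M hX) => -[+ _ _] _; apply.
have sF := filtration_sigma hF t0.
by apply/(measurable_wrtP sF); apply: measurable_funB; [exact: mX|exact: mM].
Qed.

Let cA' : forall w, continuous (A' ^~ w).
Proof.
move=> w; have [gw|bw] := pselect (good w); last by rewrite bad// => t; exact: cvg_cst.
rewrite nice//; apply: (@continuous_path_extension _ (A ^~ w)); by case: gw => [_ [[]]].
Qed.

Let ndA' : forall w u v, u <= v -> A' u w <= A' v w.
Proof.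
move=> w u v uv; rewrite /A' /modify; case: ifPn => // /set_mem gw.
case: gw => [_ [[_ _ ndA _] _]]; apply: ndA; first by rewrite le_max lexx.
by rewrite ge_max !le_max lexx uv orbT.
Qed.

Let A'0 : forall t w, 0 <= A' t w.
Proof.
move=> t w; rewrite /A' /modify; case: ifPn => // /set_mem gw.
case: gw => [_ [[_ _ ndA A0] _]]; rewrite -[leLHS]A0; apply: ndA => //.
by rewrite le_max lexx.
Qed.

Let carried' : forall w u v, 0 <= u -> u < v -> A' u w < A' v w ->
  exists s, [/\ u < s, s <= v & X' s w = 0 \/ D' s w = 0].
Proof.
move=> w u v u0 uv; have v0 : 0 <= v by rewrite ltW// (le_lt_trans u0).
have [gw|bw] := pselect (good w); last by rewrite /A' /modify memNset// ltxx.
rewrite /A' !modify_ge0// => Auv.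
have [_ [_ [carr _ _ _]]] := gw.
have [s /=] := path_measure_charges carr u0 uv Auv.
rewrite in_itv/= => /andP[us sv] /not_andP[|].
  by rewrite in_itv/= andbT => /negP; rewrite -ltNge ltNge (le_trans u0)// ltW.
have s0 : 0 <= s by rewrite (le_trans u0)// ltW.
move=> /contrapT h; exists s; split => //; rewrite /X' /D' !modify_ge0//.
by case: h => [|[_]]; [left|right].
Qed.

Let tau'_stop : forall n, stopping_time F (tau' n).
Proof.
move=> n; have [tau0 tauF] := tau_stop n; split => [w|t t0].
  by rewrite /tau'; case: ifP => // _; rewrite leey.
rewrite (_ : mkset _ = good `&` [set w | (tau n w <= t%:E)%E]).
  have sF := filtration_sigma hF t0.
  by apply: (sigma_setI sF); [exact: (full_set_F hF)|exact: tauF].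
apply/seteqP; split => w /=; rewrite /tau'; last by case=> gw; rewrite mem_set.
by case: ifPn => [/set_mem//|_]; rewrite leye_eq.
Qed.

Let tau'_cvg : forall w t, \forall n \near \oo, (t%:E < tau' n w)%E.
Proof.
move=> w t; rewrite /tau'; case: (boolP (w \in good)) => [/set_mem gw|_]; last by near=> n; rewrite ltry.
have [_ [_ [_ lim_tau _ _]]] := gw; move: t.
by apply/cvgeyPgt.
Unshelve. all: by end_near. Qed.

Let L'_mart : forall n, martingale P F (fun t w =>
  (X' (stop_at (tau' n w) t) w - A' (stop_at (tau' n w) t) w) * D' (stop_at (tau' n w) t) w).
Proof.
move=> n; apply: (martingale_modify hF good_ae (tau_mart n)) => t w t0.
case: ifPn => [/[dup] gw' /set_mem gw|bw]; last first.
  by rewrite /X' /A' /D' /modify (negbTE bw) subrr mul0r.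
have [[_ _ M0 XE] _] := gw; have [tau0 _] := tau_stop n.
have s0 : 0 <= stop_at (tau n w) t by rewrite /stop_at fine_ge0// le_min lee_fin t0 tau0.
rewrite /tau' gw' /X' /A' /D' !modify_ge0// XE// M0 mul0r subr0 addrK.
by rewrite /stopped /value_at.
Qed.

Let Dinf1 : L1 P Dinf. Proof. by case: (setting_density_infty hsetting). Qed.

Let c : R := fine 'E_P[fun v => `|Dinf v|].

(** Otherwise the division by zero would make P' the null measure. *)
Let c0 : 0 < c.
Proof.
rewrite lt_neqAle; apply/andP; split; last by rewrite fine_ge0// expectation_ge0.
apply/eqP => c0; have := hP' measurableT; rewrite probability_setT -/c -c0.
under eq_integral do rewrite invr0 mulr0.
by rewrite integral0 => /eqP; rewrite onee_eq0.
Qed.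

Let P'P : P' `<< P.
Proof.
apply: (density_dominates _ hP'); rewrite -/c.
rewrite (_ : EFin \o _ = EFin \o (fun w => c^-1 * `|Dinf w|)); last first.
  by apply/funext => w /=; rewrite mulrC.
by apply: L1Z; exact: L1_norm.
Qed.

Let mDinf : measurable_fun setT Dinf. Proof. exact: L1_measurable Dinf1. Qed.

(** Dinf vanishes almost nowhere, so P and P' have the same null sets and
completeness for P can be used for properties that hold P'-almost surely. *)
Let PP' (H : set T) : {ae P', forall w, H w} -> {ae P, forall w, H w}.
Proof.
move=> [B [mB B0 sB]].
have nz : {ae P, forall w, Dinf w <> 0}.
  exists [set w | Dinf w = 0]; split; last by move=> w /= /contrapT.
    by rewrite -[X in measurable X]setTI -[X in _ `&` X]/(Dinf @^-1` [set 0]); exact: mDinf.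
  exact: (setting_neq0 hsetting).
have m0 : measurable_fun B (fun w => (Dinf w * c^-1)%:E).
  by apply/measurable_EFinP/measurable_funTS/measurable_funM => //; exact: measurable_cst.
have : (\int[P]_(w in B) `|(Dinf w * c^-1)%:E| = 0)%E.
  rewrite -B0 hP'//; apply: eq_integral => w _.
  by rewrite /= normrM normfV -/c (gtr0_norm c0).
move=> /(ae_eq_integral_abs P mB m0); apply: filterS2 nz => w Dw h.
apply: contrapT => nH; apply: Dw; have /eqP := EFin_inj (h (sB _ nH)).
by rewrite mulf_eq0 invr_eq0 (gt_eqF c0) orbF => /eqP.
Qed.

Let D'_closed : forall t, 0 <= t -> L1 P (D' t) /\
  forall C, F t C -> E P (fun w => \1_C w * D' t w) = E P (fun w => \1_C w * Dinf w).
Proof.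
move=> t t0; have [mD iD QD] := setting_density hsetting t0.
have [_ _ QDi] := setting_density_infty hsetting.
have DD' : {ae P, forall w, D t w = D' t w}.
  by apply: filterS good_ae => w gw; rewrite /D' modify_ge0.
have mD' : measurable_fun setT (D' t).
  by apply: (sub_measurable_fun (filtration_sub hF t0)); exact: aD'.
have iD' := L1_ae mD' DD' iD; split => // C FC.
have mC := filtration_measurable hF t0 FC.
rewrite !Ex_indic// -QDi// (QD C FC); congr fine; apply: ae_eq_integral => //.
- by apply/measurable_EFinP/measurable_funTS.
- by apply/measurable_EFinP/measurable_funTS/(L1_measurable iD).
- by apply: filterS DD' => w ->.
Qed.

Let XX' : {ae P, forall w, forall t, 0 <= t -> X t w = X' t w}.
Proof. by apply: filterS good_ae => w gw t t0; rewrite /X' modify_ge0. Qed.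

Let opt_L1 := class_D_L1 hF aX' rX' X'0 XX' P'P hD.
Let opt_excess := class_D_excess hF aX' rX' X'0 XX' P'P hD.

Let K_mart := balayage_martingale hF aD' cD' Dinf1 D'_closed c0 hP' aX' rX' X'0 aA' cA'
  ndA' A'0 carried' tau'_stop tau'_cvg L'_mart opt_L1 opt_excess.

Let optional_cst t : 0 <= t -> optional_time F 0 t (fun=> t).
Proof.
move=> t0; split => // u u0; have sF := filtration_sigma hF u0.
have [tu|ut] := ltP t u.
  by rewrite (_ : mkset _ = setT); [exact: (sigma_setT sF)|apply/seteqP; split].
by rewrite (_ : mkset _ = set0); [case: sF|apply/seteqP; split => // w /=; rewrite ltNge ut].
Qed.

Let X'1 t (t0 : 0 <= t) : L1 P' (X' t) := opt_L1 (optional_cst t0).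

Let X'_excess e : 0 < e -> exists k, forall t, 0 <= t ->
  E P' (fun w => Num.max 0 (X' t w - k)) <= e.
Proof. by move=> /opt_excess[k h]; exists k => t t0; exact: h _ _ (optional_cst t0). Qed.

Let z_split r s : r <= s -> nozero_after D' r = nozero D' r s `&` nozero_after D' s.
Proof.
move=> rs; apply/seteqP; split => w /=.
  move=> h; split => [u ru _|u su]; first exact: h.
  by apply: h; exact: le_trans su.
by move=> [h1 h2] u ru; have [us|/ltW su] := leP u s; [exact: h1|exact: h2].
Qed.

Let mz r (r0 : 0 <= r) := measurable_nozero_after hF aD' cD' r0.
Let F_nz r s (r0 : 0 <= r) (rs : r <= s) := F_nozero hF aD' cD' r0 rs.

Let z_aeP : {ae P, forall w, exists n : nat, nozero_after D' n%:R w} :=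
  ae_last_zero hF aD' cD' Dinf1 D'_closed (setting_neq0 hsetting).
Let z_ae := ae_dominates P'P z_aeP.

Let limits := X_A_cvg hF aX' rX' X'0 aA' cA' ndA' A'0 X'1 X'_excess mz F_nz z_split K_mart z_ae.

Local Notation Ainf := (limit_infty A).
Local Notation Xinf := (limit_infty X).

Let limits_infty : {ae P', forall w, [/\ A' t w @[t --> +oo] --> Ainf w,
  X' t w @[t --> +oo] --> Xinf w & forall t, A' t w <= Ainf w]}.
Proof.
have limE (Y Y' : R -> T -> R) w l : (forall t, 0 <= t -> Y' t w = Y t w) ->
    Y' t w @[t --> +oo] --> l -> limit_infty Y w = l.
  move=> YY' cl; apply: cvg_lim => //; apply: cvg_trans cl.
  apply: near_eq_cvg; near=> t; apply: YY'.
  by near: t; exact: nbhs_pinfty_ge.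
apply: filterS2 (ae_dominates P'P good_ae) limits => w gw [a [l [cA cX Aa]]].
rewrite (limE A A' w a) ?(limE X X' w l)//.
  by move=> t t0; rewrite /X' modify_ge0.
by move=> t t0; rewrite /A' modify_ge0.
Unshelve. all: by end_near. Qed.

(** Nonnegative versions of the limits, equal to them P'-almost surely and
measurable by completeness. *)
Let Ai w : R := Num.max 0 (Ainf w).
Let Xi w : R := Num.max 0 (Xinf w).

Let Ai0 w : 0 <= Ai w. Proof. by rewrite le_max lexx. Qed.
Let Xi0 w : 0 <= Xi w. Proof. by rewrite le_max lexx. Qed.

Let AiE : {ae P', forall w, Ai w = Ainf w}.
Proof.
by apply: filterS limits_infty => w [_ _ h]; rewrite /Ai max_r// (le_trans (A'0 0 w)).
Qed.

Let XiE : {ae P', forall w, Xi w = Xinf w}.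
Proof.
apply: filterS limits_infty => w [_ h _]; rewrite /Xi max_r//.
have := cvg_lim (@Rhausdorff R) h => <-; apply: limr_ge; first by apply/cvg_ex; exists (Xinf w).
by near=> t; exact: X'0.
Unshelve. all: by end_near. Qed.

Let lim_ae : {ae P', forall w, [/\ A' t w @[t --> +oo] --> Ai w,
  X' t w @[t --> +oo] --> Xi w & forall t, A' t w <= Ai w]}.
Proof. by apply: filterS3 AiE XiE limits_infty => w -> -> . Qed.

Let mF t (f : T -> R) (t0 : 0 <= t) : measurable_wrt (F t) f -> measurable_fun setT f :=
  @sub_measurable_fun _ _ _ _ (filtration_sub hF t0) f.

Let cvg_nat (y : R -> R) (l : R) : y t @[t --> +oo] --> l -> y n%:R @[n --> \oo] --> l.
Proof. by move=> h; apply: cvg_comp h; exact: cvgr_idn. Qed.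

Let mAi : measurable_fun setT Ai.
Proof.
apply: (complete_measurable_cvg hF (h := fun n => A' n%:R)) => [n|].
  by apply: (mF (ler0n R n)); exact: aA'.
by apply: filterS (PP' lim_ae) => w [/cvg_nat].
Qed.

Let mXi : measurable_fun setT Xi.
Proof.
apply: (complete_measurable_cvg hF (h := fun n => X' n%:R)) => [n|].
  by apply: (mF (ler0n R n)); exact: aX'.
by apply: filterS (PP' lim_ae) => w [_ /cvg_nat].
Qed.

(** Finite by [ae_last_zero]. *)
Let g w := if w \in good then fine (gbar D w) else 0.

Let gbar0 w : (0 <= gbar D w)%E. Proof. by rewrite le_max lexx. Qed.

Let g0 w : 0 <= g w.
Proof. by rewrite /g; case: ifP => // _; rewrite fine_ge0. Qed.

Let g_ae : {ae P', forall w, [/\ forall r, 0 <= r -> nozero_after D' r w -> g w <= r,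
  forall r, g w < r -> nozero_after D' r w, X' (g w) w = 0 & A' (g w) w = 0]}.
Proof.
apply: filterS2 (ae_dominates P'P good_ae) z_ae => w gw [n zn].
have gbar_le r : 0 <= r -> nozero_after D' r w -> (gbar D w <= r%:E)%E.
  move=> r0 zr; rewrite ge_max lee_fin r0/=; apply: ge_ereal_sup => _ [t [t0 Dt] <-].
  rewrite lee_fin leNgt; apply/negP => /ltW rt.
  by have := zr t rt; rewrite /D' modify_ge0// Dt eqxx.
have gE : (g w)%:E = gbar D w.
  rewrite /g mem_set// fineK// ge0_fin_numE//.
  by rewrite (le_lt_trans (gbar_le n%:R _ zn)) ?ltry.
have [_ [_ [_ _ Xg Ag]]] := gw.
split=> [r r0 zr|r gr u ru||].
- by rewrite -lee_fin gE gbar_le.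
- have u0 : 0 <= u by rewrite (le_trans (g0 w))// (le_trans (ltW gr)).
  rewrite /D' modify_ge0//; apply/eqP => Du; move: (lt_le_trans gr ru).
  apply/negP; rewrite -leNgt -lee_fin gE le_max; apply/orP; right.
  by apply: ereal_sup_ubound; exists u.
- by rewrite /X' modify_ge0// /g mem_set.
- by rewrite /A' modify_ge0// /g mem_set.
Qed.

Let terminal y : 0 < y ->
  E P' (fun w => \1_[set w | Ai w <= y] w * Xi w) = E P' (fun w => Num.min (Ai w) y).
Proof.
move=> y0; exact: (terminal_identity hF aX' rX' X'0 aA' cA' A'0 X'1 X'_excess mz F_nz z_split
  K_mart z_ae y0 g0 g_ae mXi mAi Xi0 Ai0 lim_ae).
Qed.

Variable lambda : R -> R.
Hypothesis hlambda : conditional_expectation_given P' Xinf Ainf lambda.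
Hypothesis hlambda0 : {ae P', forall w, lambda (Ainf w) != 0}.

Let mlambda : measurable_fun setT lambda. Proof. by case: hlambda. Qed.

Let mlambdaA : measurable_fun setT (fun w => lambda (Ai w)).
Proof. exact: (measurableT_comp mlambda mAi). Qed.

Let lambdaE : {ae P', forall w, lambda (Ainf w) = lambda (Ai w)}.
Proof. by apply: filterS AiE => w ->. Qed.

Let lambdaA1 : L1 P' (fun w => lambda (Ai w)).
Proof. by case: hlambda => _ h _; exact: L1_ae mlambdaA lambdaE h. Qed.

Let mAinf : measurable_fun setT Ainf.
Proof. by apply: (complete_measurable_fun hF mAi); apply: PP'; apply: filterS AiE => w ->. Qed.

Let mXinf : measurable_fun setT Xinf.
Proof. by apply: (complete_measurable_fun hF mXi); apply: PP'; apply: filterS XiE => w ->. Qed.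

(** The hypothesis on lambda, transferred to the nonnegative versions. *)
Let cond (B : set R) : measurable B ->
  (\int[P']_(w in Ai @^-1` B) (lambda (Ai w))%:E = \int[P']_(w in Ai @^-1` B) (Xi w)%:E)%E.
Proof.
move=> mB; have [_ _ /(_ _ mB) h] := hlambda.
have mC (f : T -> R) : measurable_fun setT f -> measurable (f @^-1` B).
  by move=> mf; rewrite -[X in measurable X]setTI; exact: mf.
have swap (f f' : T -> R) : measurable_fun setT f -> measurable_fun setT f' ->
    {ae P', forall w, f w = f' w} ->
    (\int[P']_(w in Ai @^-1` B) (f w)%:E = \int[P']_(w in Ainf @^-1` B) (f' w)%:E)%E.
  move=> mf mf' ff'; rewrite [LHS]integral_mkcond [RHS]integral_mkcond.
  apply: ae_eq_integral => //.
  - by apply/(measurable_restrictT _ (mC _ mAi))/measurable_EFinP/measurable_funTS.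
  - by apply/(measurable_restrictT _ (mC _ mAinf))/measurable_EFinP/measurable_funTS.
  apply: filterS2 AiE ff' => w Aw fw _; rewrite !patchE fw.
  by congr (if _ then _ else _); apply/idP/idP; rewrite !inE/= Aw.
rewrite (swap _ (fun w => lambda (Ainf w))) ?(swap Xi Xinf)//.
  exact: (measurableT_comp mlambda mAinf).
by apply: filterS lambdaE => w ->.
Qed.

Let Xi1 : L1 P' Xi.
Proof.
apply/integrableP; split; first exact/measurable_EFinP.
under eq_integral do rewrite /= ger0_norm//.
rewrite -[X in integral _ X _](preimage_setT Ai) -cond// preimage_setT.
by rewrite -Ex_EFin// ltry.
Qed.

Let condE y : E P' (fun w => \1_[set w | Ai w <= y] w * lambda (Ai w)) =
  E P' (fun w => \1_[set w | Ai w <= y] w * Xi w).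
Proof.
have mB : measurable [set w | Ai w <= y].
  by rewrite -[X in measurable X]setTI; apply: measurable_fun_ler => //; exact: mAi.
rewrite !Ex_indic//; congr fine.
rewrite (_ : mkset _ = Ai @^-1` `]-oo, y]%classic); last first.
  by apply/seteqP; split => w /=; rewrite in_itv.
exact: cond.
Qed.

(** For y > 0 this is the terminal identity after conditioning; y = 0 is reached as
a limit, because the grid points after the last zero need a level above the small
values of A. *)
Let lamE y : 0 <= y ->
  E P' (fun w => \1_[set w | Ai w <= y] w * lambda (Ai w)) = E P' (fun w => Num.min (Ai w) y).
Proof.
rewrite condE le_eqVlt => /predU1P[<-|]; last exact: terminal.
have mB z : measurable [set w | Ai w <= z].
  by rewrite -[X in measurable X]setTI; apply: measurable_fun_ler => //; exact: mAi.
have i1 z : L1 P' (fun w => \1_[set w | Ai w <= z] w * Xi w) by exact: L1_indic.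
rewrite [RHS](_ : _ = 0); last first.
  transitivity (E P' (fun=> 0 : R)); last exact: Ex_cst.
  by apply: eq_Ex => w; rewrite min_r.
apply/eqP; rewrite eq_le; apply/andP; split; last by apply: Ex_ge0 => w; rewrite mulr_ge0.
apply/ler_addgt0Pr => e e0; rewrite add0r.
apply: (@le_trans _ _ (E P' (fun w => \1_[set w | Ai w <= e] w * Xi w))).
  apply: Ex_le => // w; rewrite ler_wpM2r// !indicE ler_nat.
  have [/set_mem /= h|//] := boolP (w \in [set w | Ai w <= 0]).
  by rewrite mem_set//= (le_trans h)// ltW.
rewrite terminal// -[leRHS](Ex_cst P' e); apply: Ex_le.
- apply: (@L1_bounded _ _ _ _ _ e) => [|w]; last by rewrite ger0_norm ?ge_min ?lexx ?orbT// le_min Ai0 ltW.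
  by apply: measurable_minr => //; exact: measurable_cst.
- exact: L1_cst.
- by move=> w; rewrite ge_min lexx orbT.
Qed.

(** On the event that lambda is negative its integral is that of X_oo >= 0. *)
Let lambda_pos : {ae P', forall w, 0 < lambda (Ai w)}.
Proof.
pose B := [set z | lambda z < 0].
have mB : measurable B.
  by rewrite -[X in measurable X]setTI; apply: measurable_fun_ltr => //; exact: measurable_cst.
pose C := Ai @^-1` B.
have mC : measurable C by rewrite -[C]setTI; exact: mAi.
have i1 := L1_indic mC lambdaA1.
have labs : (\int[P']_(w in C) `|(lambda (Ai w))%:E| = 0)%E.
  apply/eqP; rewrite eq_le integral_ge0 ?andbT; last by move=> w _; rewrite lee_fin.
  rewrite -(Ex_indic_EFin (f := fun w => `|lambda (Ai w)|))//; last exact: L1_norm.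
  rewrite (eq_Ex P' (g := fun w => (-1) * (\1_C w * lambda (Ai w)))).
    rewrite ExZ// mulN1r lee_fin oppr_le0.
    rewrite Ex_indic// cond// -Ex_indic//; apply: Ex_ge0 => w; exact: mulr_ge0.
  move=> w; rewrite indicE; have [/set_mem Cw|_] := boolP (w \in C); last by rewrite !mul0r mulr0.
  by rewrite !mul1r mulN1r ltr0_norm.
have mlC : measurable_fun C (fun w => (lambda (Ai w))%:E).
  exact/measurable_EFinP/measurable_funTS.
have /(ae_eq_integral_abs P' mC mlC) := labs.
apply: filterS3 lambdaE hlambda0 => w -> l0 h; rewrite lt_def l0/= leNgt; apply/negP => lneg.
by have e0 := EFin_inj (h lneg); move: lneg; rewrite e0 ltxx.
Qed.

Variable x : R.
Hypothesis x0 : 0 <= x.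
Hypothesis xb : (x%:E < ereal_inf (EFin @` [set u | P' [set w | (u <= Ainf w)%R] = 0%E]))%E.

(** If the tail vanished at x then every u > x would belong to the set defining b. *)
Let tail_pos : (0 < P' [set w | (x < Ainf w)%R])%E.
Proof.
rewrite lt0e measure_ge0 andbT; apply/eqP => P0; move: xb; apply/negP; rewrite -leNgt.
have mle u : measurable [set w | u <= Ainf w].
  by rewrite -[X in measurable X]setTI; apply: measurable_fun_ler => //; exact: mAinf.
have mlt : measurable [set w | x < Ainf w].
  by rewrite -[X in measurable X]setTI; apply: measurable_fun_ltr => //; exact: mAinf.
apply/lee_addgt0Pr => e e0; rewrite -EFinD; apply: ereal_inf_lbound; exists (x + e) => //=.
apply: (subset_measure0 (mle _) mlt _ P0) => w /=.
by apply: lt_le_trans; rewrite ltrDl.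
Qed.

Lemma law_of_limit : (P' [set w | (x < Ainf w)%R] =
  expeR (- \int[lebesgue_measure]_(z in `[0%R, x]) ((lambda z)^-1)%:E))%E.
Proof.
pose V : {RV P' >-> R} := mfun_Sub (mem_set mAi).
have VE : [set w | x < V w] = [set w | x < Ainf w].
  by apply/seteqP; split => w; rewrite /V /= /Ai lt_max [x < 0]ltNge x0.
have := @law_formula _ _ _ P' V lambda Ai0 mlambda lambda_pos lambdaA1 lamE x x0.
by rewrite VE; apply.
Qed.

End regular_version.

Theorem theorem10 (d : measure_display) (T : measurableType d) (R : realType)
    (P : probability T R) (Q : {charge set T -> \bar R})
    (F : R -> set (set T)) (D : R -> T -> R) (Dinf : T -> R)
    (hsetting : signed_measure_setting P Q F D Dinf)
    (P' : probability T R) (hP' : normalized_variation P Dinf P')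
    (X M A : R -> T -> R)
    (hX : class_SigmaH P F D X M A)
    (hD : class_D P' F X)
    (hXg : {ae P, forall w, value_at X (gbar D) w = 0})
    (hAg : {ae P, forall w, value_at A (gbar D) w = 0})
    (lambda : R -> R)
    (hlambda : conditional_expectation_given P'
                 (limit_infty X) (limit_infty A) lambda)
    (hlambda0 : {ae P', forall w, lambda (limit_infty A w) != 0})
    (b : \bar R)
    (hb : b = ereal_inf (EFin @`
                [set u | P' [set w | u <= limit_infty A w] = 0%E])) :
  forall x : R, 0 <= x -> (x%:E < b)%E ->
    (P' [set w | (x < limit_infty A w)%R] =
     expeR (- \int[lebesgue_measure]_(z in `[0%R, x]) ((lambda z)^-1)%:E))%E.
Proof.
move=> x x0 xb.
have [_ [_ _ [tau [tau_stop _ tau_lim tau_mart]]]] := SigmaH_M hX.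
move: xb; rewrite hb => xb.
exact: (law_of_limit hsetting hP' hX hD hXg hAg tau_stop tau_lim tau_mart hlambda hlambda0 x0 xb).
Qed.
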